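(* There exists a universal constant $K>0$ such that for all $\omega,L>0$ there exists $C=C(\omega,L)>0$ such that the transition semigroup $(\hat P_t)$ on $L^2(\hat\mu)$ of the jamming RTP process on $[0,L]$ with parameter $\omega$ satisfies $$\|\hat P_tf\|_{L^2(\hat\mu)}\le C\,e^{-\frac{K\omega}{1+(\omega L)^2}t}\,\|f\|_{L^2(\hat\mu)}$$ for all $t\ge0$ and $f\in L_0^2(\hat\mu)$.
   Context: Jamming RTP (run-and-tumble particle) process on $[0,L]$ with parameter $\omega$: for an initial state $(x_0,v_0)\in[0,L]\times\{-2,0,2\}$, $v(t)$ is the Markov jump process on $\{-2,0,2\}$ started at $v_0$ with jump rates $2\to0$: $2\omega$; $0\to2$: $\omega$; $0\to-2$: $\omega$; $-2\to0$: $2\omega$ (other rates zero). Let $0=T_0<T_1<\cdots$ be its jump times. Then $x(0)=x_0$ and recursively $x(t)=\max[0,\min[L,x(T_n)+v(T_n)(t-T_n)]]$ for $t\in[T_n,T_{n+1})$ (with $x$ continuous). The process is $(x(t),v(t))$ with values in $[0,L]\times\{-2,0,2\}$. Its unique invariant probability measure is known to be $\hat\mu=\sum_{v}(d_v^0\delta_0+a_v\,dx+d_v^L\delta_L)\otimes\delta_v$ with, after multiplication by $2+\omega L$: $d_2^0=0$, $d_0^0=d_{-2}^0=\frac12$; $a_2=a_{-2}=\frac\omega4$, $a_0=\frac\omega2$; $d_2^L=d_0^L=\frac12$, $d_{-2}^L=0$. $L_0^2(\hat\mu)$ is the space of $f\in L^2(\hat\mu)$ with $\int f\,d\hat\mu=0$.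 *)

(* Defs.v *)
From HB Require Import structures.
From mathcomp Require Import all_boot all_order all_algebra.
From mathcomp Require Import all_classical all_reals all_analysis.

Set Implicit Arguments.
Unset Strict Implicit.
Unset Printing Implicit Defensive.

Import Order.TTheory GRing.Theory Num.Theory.
Import numFieldNormedType.Exports.

Local Open Scope classical_set_scope.
Local Open Scope ring_scope.

Variant velocity := Neg2 | Zero | Pos2.

Definition ord_of_velocity (v : velocity) : 'I_3 :=
  match v with
  | Neg2 => @Ordinal 3 0 isT | Zero => @Ordinal 3 1 isT | Pos2 => @Ordinal 3 2 isT
  end.

Definition velocity_of_ord (i : 'I_3) : velocity :=
  match val i with 0%N => Neg2 | 1%N => Zero | _ => Pos2 end.

Lemma ord_of_velocityK : cancel ord_of_velocity velocity_of_ord.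
Proof. by case. Qed.

HB.instance Definition _ := Finite.copy velocity (can_type ord_of_velocityK).
HB.instance Definition _ := isPointed.Build velocity Zero.
HB.instance Definition _ := @isMeasurable.Build default_measure_display
  velocity discrete_measurable discrete_measurable0
  discrete_measurableC discrete_measurableU.

Notation state R := (measurableTypeR R * velocity)%type.

Section jump_process.
Context {R : realType}.

Definition exit_rate (q : velocity -> velocity -> R) (u : velocity) : R :=
  \sum_(w : velocity) q u w.

Definition jump_prob (q : velocity -> velocity -> R) (u w : velocity) : R :=
  q u w / exit_rate q u.

(* [T n] is the n-th jump time and [V n] the value on [T n, T n.+1[. The law
   is given by the jump-chain/holding-time description of the Markov jump
   process with rates [q] (whose diagonal is 0) started at [v0]: [V] is a
   Markov chain with transition matrix [jump_prob q] and, conditionally on it,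
   the holding times are independent, the i-th one being exponential with
   parameter [exit_rate q (V i)]. *)
Record is_jump_process (q : velocity -> velocity -> R) (v0 : velocity)
    (d : measure_display) (Omega : measurableType d) (P : probability Omega R)
    (T : nat -> Omega -> R) (V : nat -> Omega -> velocity) : Prop := {
  jump_time_measurable : forall n, measurable_fun [set: Omega] (T n) ;
  jump_value_measurable : forall n, measurable_fun [set: Omega] (V n) ;
  jump_time0 : forall om, T 0%N om = 0 ;
  jump_time_lt : forall n om, T n om < T n.+1 om ;
  jump_law : forall (n : nat) (s : nat -> velocity) (A : nat -> set R),
    (forall i, measurable (A i)) ->
    P [set om | (forall i, (i <= n)%N -> V i om = s i) /\
                (forall i, (i < n)%N -> A i (T i.+1 om - T i om))] =
    ((s 0%N == v0)%:R *
     \prod_(i < n) (jump_prob q (s i) (s i.+1) *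
                    fine (exponential_prob (exit_rate q (s i)) (A i))))%:E }.

End jump_process.

Section jamming_rtp.
Context {R : realType}.

Definition speed (v : velocity) : R :=
  match v with Neg2 => - 2 | Zero => 0 | Pos2 => 2 end.

Definition rtp_rate (omega : R) (u w : velocity) : R :=
  match u, w with
  | Pos2, Zero => 2 * omega
  | Zero, Pos2 => omega
  | Zero, Neg2 => omega
  | Neg2, Zero => 2 * omega
  | _, _ => 0
  end.

Definition clip (L x : R) : R := Num.max 0 (Num.min L x).

Section path.
Context (L : R) {Omega : Type}.
Context (T : nat -> Omega -> R) (V : nat -> Omega -> velocity).

(* The unique [n] such that [T n <= t < T n.+1]; the junk value 0 is only
   taken on the null event where the jump times accumulate before [t]. *)
Definition jump_index (t : R) (om : Omega) : nat :=
  xget 0%N [set n | T n om <= t < T n.+1 om].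

Fixpoint position_at_jump (x0 : R) (n : nat) (om : Omega) : R :=
  if n is m.+1 then
    clip L (position_at_jump x0 m om
            + speed (V m om) * (T m.+1 om - T m om))
  else x0.

Definition rtp_velocity (t : R) (om : Omega) : velocity :=
  V (jump_index t om) om.

Definition rtp_position (x0 t : R) (om : Omega) : R :=
  let n := jump_index t om in
  clip L (position_at_jump x0 n om + speed (V n om) * (t - T n om)).

End path.

(* [P v] is the law under which the velocity starts at [v], so that this is
   the expectation of [f] at time [t] for the process started at [z]. *)
Definition rtp_semigroup (L : R) (d : measure_display)
    (Omega : measurableType d) (P : velocity -> probability Omega R)
    (T : nat -> Omega -> R) (V : nat -> Omega -> velocity)
    (t : R) (f : state R -> R) (z : state R) : \bar R :=
  'E_(P z.2)[fun om => f (rtp_position L T V z.1 t om, rtp_velocity T V t om)].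

Definition line_measure (L : R) (d0 a dL : {nonneg R}) :
    {measure set (measurableTypeR R) -> \bar R} :=
  measure_add (mscale d0 \d_(0 : measurableTypeR R))
    (measure_add
      (mscale a (mrestr lebesgue_measure (measurable_itv `[0, L])))
      (mscale dL \d_(L : measurableTypeR R))).

Definition rtp_layer (omega L : {posnum R}) (v : velocity) :
    {measure set (state R) -> \bar R} :=
  match v with
  | Neg2 =>
      (line_measure L%:num 2^-1%:nng (omega%:num / 4)%:nng 0%:nng)%R \x \d_Neg2
  | Zero =>
      (line_measure L%:num 2^-1%:nng (omega%:num / 2)%:nng 2^-1%:nng)%R \x \d_Zero
  | Pos2 =>
      (line_measure L%:num 0%:nng (omega%:num / 4)%:nng 2^-1%:nng)%R \x \d_Pos2
  end%E.

(* The measure is carried by [0, L] * {-2, 0, 2}, so functions on [state R]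
   modulo null sets are functions on the latter modulo null sets. *)
Definition rtp_invariant (omega L : {posnum R}) :
    {measure set (state R) -> \bar R} :=
  mscale ((2 + omega%:num * L%:num)^-1)%:nng
    (measure_add (rtp_layer omega L Neg2)
      (measure_add (rtp_layer omega L Zero) (rtp_layer omega L Pos2))).

End jamming_rtp.

(* Main.v *)
Require Import Defs.
From HB Require Import structures.
From mathcomp Require Import all_boot all_order all_algebra.
From mathcomp Require Import all_classical all_reals all_analysis.
From mathcomp Require Import measurable_realfun ring lra.
Import Order.TTheory GRing.Theory Num.Theory.
Import numFieldNormedType.Exports.
Local Open Scope classical_set_scope.
Local Open Scope ring_scope.
Set Implicit Arguments.
Unset Strict Implicit.
Unset Printing Implicit Defensive.

(** The velocity jumps at the constant rate [2 omega] out of every state, so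
    the expectation of [f] at time [t] is the minimal solution of a renewal
    equation, and every supersolution of that equation bounds it from above.
    Two bounds follow.  Driving two positions by the same velocities, the
    larger one decreases to the smaller one and both coincide once the larger
    one has visited a wall; an explicit quadratic supersolution shows that
    they differ at time [t] with probability at most
    [merge_const * exp (- merge_rate * t)], where [merge_rate] is of order
    [omega / (1 + (omega L)^2)].  The velocity alone relaxes at the rates
    [2 omega] and [4 omega], read off its eigenfunctions.

    The invariance of [rtp_invariant] comes from one step of length [e] of the
    renewal expansion, which preserves the integral of [g] with values in
    [[0, 1]] up to [O(e^2)] from below; iterating [t / e] times, and applying
    the result to [1 - g], gives equality.

    For bounded centred [f], write [P_(t+s) f = P_t (h - F) + P_t F] with
    [h = P_s f] and [F v] the average of [h] over positions in the layer of
    velocity [v].  By coupling and the Cauchy-Schwarz inequality,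
    [(h (x, v) - h (x', v))^2] is at most the merging probability times
    [2 (P_s f^2 (x, v) + P_s f^2 (x', v))], which makes [h - F] small in mean
    square, whereas [P_t F] decays with the velocity.  General square-integrable [f]
    are approximated by bounded ones. *)

(** * Change of variables and the exponential law *)

(** The minimal solution is reached from one side at a time: supersolutions bound it from above,
    discarding terms of the expansion bounds it from below. The semigroup property and the
    invariance are therefore proved as inequalities for a class of functions closed under passing
    from [f] to [- f] or from [g] to [1 - g], and this passage reverses them. The coupled positions
    must share their velocities, so the coupling compares only starting points in the same layer.
    What it cannot see is a function of the velocity alone, which is why [F] is split off and
    treated by the velocity modes. The scale [1 + (omega L)^2] comes from the quadratic [lyap]:
    inside the interval the generator of the killed process lowers it at rate at least [omega / 2],
    while its values lie between [1] and [5 (1 + (omega L)^2)]; [merge_rate] is the quotient of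
    these two numbers. *)

Lemma eq_leW {d} {T : porderType d} (x y : T) : x = y -> (x <= y)%O.
Proof. by move=> ->. Qed.

Lemma disjoint_adjacent_itv {d} {T : orderType d} (a b c : itv_bound T) :
  [disjoint [set` Interval a b] & [set` Interval b c]].
Proof.
apply/disj_setPS => u /=; rewrite !itv_boundlr => -[/andP[_ ub] /andP[bu _]].
by have := le_trans ub bu; rewrite bnd_simp ltxx.
Qed.

Section density.
Local Open Scope ereal_scope.
Context d (T : measurableType d) (R : realType).
Variables (mu nu : {measure set T -> \bar R}) (g : T -> R).
Hypothesis g0 : forall x, (0 <= g x)%R.
Hypothesis mg : measurable_fun setT g.
Hypothesis nuE : forall A, measurable A -> nu A = \int[mu]_(x in A) (g x)%:E.

Import HBNNSimple.

Let density_nnsfun (h : {nnsfun T >-> R}) :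
  \int[nu]_x (h x)%:E = \int[mu]_x ((g x)%:E * (h x)%:E).
Proof.
have mgh r : measurable_fun setT
    ((fun x => (r * \1_(h @^-1` [set r]) x)%:E * (g x)%:E) : T -> \bar R).
  apply: emeasurable_funM; last exact/measurable_EFinP.
  by apply/measurable_EFinP; apply: measurable_funM.
rewrite integralT_nnsfun sintegralE.
under [RHS]eq_integral => x _.
  rewrite muleC fimfunE -fsumEFin// ge0_mule_fsuml; last first.
    by move=> r; exact: nnfun_muleindic_ge0.
  over.
rewrite /= ge0_integral_fsum//; last first.
  by move=> r x _; apply: mule_ge0; [exact: nnfun_muleindic_ge0 | rewrite lee_fin].
apply: eq_fsbigr => r; rewrite inE => -[x _ hx].
have r0 : (0 <= r)%R by rewrite -hx.
under [RHS]eq_integral do rewrite EFinM -muleA.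
rewrite ge0_integralZl_EFin//; last 2 first.
  by move=> y _; rewrite mule_ge0 ?lee_fin.
  apply: emeasurable_funM; first exact/measurable_EFinP.
  exact/measurable_EFinP.
congr (_ * _); rewrite nuE// integral_mkcond; apply: eq_integral => y _.
by rewrite patchE indicE; case: ifP => _; rewrite ?mul1e ?mul0e.
Qed.

(** Simple functions increasing to [f] reduce the claim to [density_nnsfun], and monotone
    convergence applies on both sides. *)
Lemma ge0_integral_density (f : T -> \bar R) :
  measurable_fun setT f -> (forall x, 0 <= f x) ->
  \int[nu]_x f x = \int[mu]_x ((g x)%:E * f x).
Proof.
move=> mf f0; pose f_ := nnsfun_approx measurableT mf.
transitivity (limn (fun n => \int[nu]_x (f_ n x)%:E)).
  rewrite -monotone_convergence//=.
  - apply: eq_integral => x /[!inE] xD; apply/esym/cvg_lim => //=.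
    exact: cvg_nnsfun_approx.
  - by move=> n; exact/measurable_EFinP/measurable_funTS.
  - by move=> n x _; rewrite lee_fin.
  - by move=> x _ a b /(nd_nnsfun_approx measurableT mf)/lefP /(_ x); rewrite lee_fin.
under eq_fun do rewrite density_nnsfun.
rewrite -monotone_convergence//=.
- apply: eq_integral => x /[!inE] xD.
  apply/cvg_lim => //=; apply: cvgeZl => //.
  exact: cvg_nnsfun_approx.
- move=> n; apply: emeasurable_funM; first exact/measurable_EFinP.
  exact/measurable_EFinP.
- by move=> n x _; rewrite mule_ge0 ?lee_fin.
- move=> x _ a b /(nd_nnsfun_approx measurableT mf)/lefP /(_ x) ab.
  by apply: lee_wpmul2l; rewrite ?lee_fin.
Qed.

End density.

Lemma ge0_integral_mrestr d (T : measurableType d) (R : realType)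
    (mu : {measure set T -> \bar R}) (D : set T) (mD : measurable D)
    (f : T -> \bar R) : measurable_fun setT f -> (forall x, (0 <= f x)%E) ->
  (\int[mrestr mu mD]_x f x = \int[mu]_(x in D) f x)%E.
Proof.
move=> mf f0.
rewrite (@ge0_integral_density _ _ _ mu (mrestr mu mD) (\1_D))//.
- rewrite [RHS]integral_mkcond; apply: eq_integral => x _.
  by rewrite patchE indicE; case: ifP => _; rewrite ?mul1e ?mul0e.
- by move=> A mA; rewrite integral_indic// setIC.
Qed.

Section pushm.
Local Open Scope ereal_scope.
Context d1 d2 (T1 : measurableType d1) (T2 : measurableType d2) (R : realType).

Definition pushm (m : {measure set T1 -> \bar R}) (f : T1 -> T2)
    (mf : measurable_fun setT f) : {measure set T2 -> \bar R} :=
  measure_function_pushforward__canonical__measure_function_Measure m mf.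

Lemma pushmE m f mf A : @pushm m f mf A = m (f @^-1` A).
Proof. by []. Qed.

Lemma ge0_integral_pushm m f mf (g : T2 -> \bar R) :
  measurable_fun setT g -> (forall y, 0 <= g y) ->
  \int[@pushm m f mf]_y g y = \int[m]_x g (f x).
Proof. by move=> mg g0; rewrite (ge0_integral_pushforward mf). Qed.

End pushm.

Section lebesgue_affine.
Local Open Scope ereal_scope.
Context {R : realType}.
Notation leb := (@lebesgue_measure R).

(** Lebesgue measure is characterised by its values on half-open intervals, and [a] times its image
    under [x -> a * x + b] takes the same values there. *)
Lemma ge0_integral_affine (a b : R) (f : R -> \bar R) : (0 < a)%R ->
  measurable_fun setT f -> (forall x, 0 <= f x) ->
  \int[leb]_x f x = a%:E * \int[leb]_x f (a * x + b)%R.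
Proof.
move=> a0 mf f0.
pose phi : measurableTypeR R -> measurableTypeR R := fun x => (a * x + b)%R.
have mphi : @measurable_fun _ _ (measurableTypeR R) (measurableTypeR R) setT phi.
  by apply: measurable_funD => //; exact: measurable_funM.
pose nu := mscale (NngNum (ltW a0)) (pushm leb mphi).
have lebnu A : measurable A -> leb A = nu A.
  apply: lebesgue_measure_unique => X [[x y] /= xy <-{X}].
  rewrite /nu /mscale/= /pushforward.
  have -> : phi @^-1` [set` `]x, y]%R] = [set` `]((x - b) / a), ((y - b) / a)]%R].
    apply/seteqP; split => z /=; rewrite !in_itv/= /phi.
    - by rewrite ltr_pdivrMr// ler_pdivlMr// ltrBlDr lerBrDr mulrC.
    - by rewrite ltr_pdivrMr// ler_pdivlMr// ltrBlDr lerBrDr mulrC.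
  rewrite !lebesgue_measure_itv/= !lte_fin ltr_pM2r ?invr_gt0// ltrD2r.
  case: ifPn => // _; last by rewrite mule0.
  by rewrite -!EFinD -EFinM; congr EFin; field; rewrite gt_eqF.
rewrite (eq_measure_integral nu); last by move=> A mA _; exact: lebnu.
by rewrite ge0_integral_mscale// ge0_integral_pushm.
Qed.

End lebesgue_affine.

Section exponential_law.
Local Open Scope ereal_scope.
Context {R : realType}.
Variable lam : {posnum R}.
Notation leb := (@lebesgue_measure R).

(* Kept opaque: simplification would otherwise unfold it to the set function
   [exponential_prob], whose measure structure depends on a positivity proof. *)
Fact expo_subproof : {P : probability (measurableTypeR R) R |
  forall A, P A = exponential_prob lam%:num A}.
Proof.
have lam0 : (0 < lam%:num)%R by [].
by exists (exponential_distribution_exponential_prob__canonical__probability_measure_Probability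
  lam0).
Qed.

Definition expo := sval expo_subproof.

Lemma expoE (A : set R) : expo A = exponential_prob lam%:num A.
Proof. exact: (svalP expo_subproof). Qed.

Lemma integral_expo (D : set R) (f : R -> \bar R) :
  measurable D -> D `<=` `[0%R, +oo[ ->
  measurable_fun D f -> (forall x, D x -> 0 <= f x) ->
  \int[expo]_(u in D) f u =
  \int[leb]_(u in D) ((lam%:num * expR (- lam%:num * u))%:E * f u).
Proof.
move=> mD D0 mf f0; rewrite integral_mkcond [RHS]integral_mkcond.
rewrite (@ge0_integral_density _ _ _ leb expo (exponential_pdf lam%:num))//.
- apply: eq_integral => u _.
  rewrite /exponential_pdf !patchE; have [uD|uD] := boolP (u \in D).
    by rewrite mem_set//; apply: D0; rewrite inE in uD.
  by rewrite mule0.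
- by move=> x; exact: exponential_pdf_ge0.
- exact: measurable_exponential_pdf.
- by move=> A _; exact: expoE.
- exact/(measurable_restrictT _ _).1.
- by move=> x; exact: erestrict_ge0.
Qed.

Lemma integral_expo_nneg (f : R -> \bar R) :
  measurable_fun setT f -> (forall x, 0 <= f x) ->
  \int[expo]_(u in `[0%R, +oo[) f u = \int[expo]_u f u.
Proof.
move=> mf f0; rewrite integral_expo//; last exact: measurable_funTS.
rewrite integral_mkcond.
rewrite (@ge0_integral_density _ _ _ leb expo (exponential_pdf lam%:num))//.
- apply: eq_integral => u _; rewrite /exponential_pdf !patchE.
  by case: ifP; rewrite ?mul0e.
- by move=> x; exact: exponential_pdf_ge0.
- exact: measurable_exponential_pdf.
- by move=> A _; exact: expoE.
Qed.

Lemma expo_itv0c (a : R) : (0 <= a)%R ->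
  expo `[0%R, a]%classic = (1 - expR (- lam%:num * a))%:E.
Proof.
rewrite le_eqVlt => /predU1P[<-|a0]; last by rewrite expoE exponential_prob_itv0c.
rewrite expoE /exponential_prob mulr0 expR0 subrr.
by rewrite set_itv1 integral_set1.
Qed.

Lemma expo_memoryless (a : R) (f : R -> \bar R) : (0 <= a)%R ->
  measurable_fun setT f -> (forall x, 0 <= f x) ->
  \int[expo]_(u in `]a, +oo[) f u =
  (expR (- lam%:num * a))%:E * \int[expo]_(u in `[0%R, +oo[) f (a + u)%R.
Proof.
move=> a0 mf f0.
have mdens : measurable_fun setT (fun u : R => (lam%:num * expR (- lam%:num * u))%:E).
  apply/measurable_EFinP; apply: measurable_funM => //.
  by apply: measurableT_comp => //; exact: measurable_funM.
pose G u := (lam%:num * expR (- lam%:num * u))%:E * f u.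
have mG : measurable_fun setT G by exact: emeasurable_funM.
have G0 x : 0 <= G x by rewrite mule_ge0// lee_fin mulr_ge0 ?expR_ge0.
have mfa : measurable_fun setT (fun u : R => f (a + u)%R).
  by apply: measurableT_comp => //; exact: measurable_funD.
rewrite !integral_expo//; last 3 first.
- exact: measurable_funTS.
- by move=> u /=; rewrite !in_itv/= !andbT => /ltW; exact: le_trans.
- exact: measurable_funTS.
rewrite -integral_itv_obnd_cbnd; last exact: measurable_funTS (emeasurable_funM mdens mfa).
rewrite -ge0_integralZl_EFin ?expR_ge0//; last 2 first.
- by move=> u _; rewrite mule_ge0// lee_fin mulr_ge0 ?expR_ge0.
- exact: measurable_funTS (emeasurable_funM mdens mfa).
rewrite [LHS]integral_mkcond [RHS]integral_mkcond.
rewrite [LHS](ge0_integral_affine a ltr01)//.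
- rewrite mul1e; apply: eq_integral => u _; rewrite !patchE mul1r addrC.
  rewrite !mem_setE !in_itv/= !andbT ltrDl; case: ifP => // _.
  by rewrite muleA -EFinM mulrCA -expRD mulrDr.
- by apply/(measurable_restrictT _ _).1 => //; exact: measurable_funTS.
- by move=> x; apply: erestrict_ge0 => y _; exact: G0.
Qed.

End exponential_law.

(** * The renewal equation *)

Section jump_kernel.
Local Open Scope ereal_scope.
Context {R : realType} dS (S : measurableType dS).
Variables (lam : {posnum R}) (p : velocity -> velocity -> R).
Variable Phi : velocity -> R -> S -> S.
Hypothesis p0 : forall v w, (0 <= p v w)%R.
Hypothesis p1 : forall v, (\sum_w p v w = 1)%R.
Hypothesis mPhi : forall v,
  measurable_fun setT (fun z : measurableTypeR R * S => Phi v z.1 z.2).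

Notation Z := (measurableTypeR R * S)%type.
Implicit Types (H G : velocity -> Z -> \bar R) (g : velocity -> S -> \bar R).

Definition meas H := forall v, measurable_fun setT (H v).
Definition nneg H := forall v z, 0 <= H v z.

(** The old velocity [v] drives the state for the whole holding time [u], and only then is the new
    velocity [w] drawn. The state space [S] is abstract because the kernel serves one position and a
    pair of positions alike. *)
Definition jump_int H v (z : Z) (u : R) : \bar R :=
  \sum_w (p v w)%:E * H w ((z.1 + u)%R, Phi v u z.2).

(* A pair [(T, y)] consists of the time of the last jump and the state just
   after it; [jump_op] averages over the next jump. *)
Definition jump_op H v (z : Z) : \bar R :=
  \int[expo lam]_(u in `[0%R, +oo[) jump_int H v z u.

Lemma jump_int_ge0 H v z u : nneg H -> 0 <= jump_int H v z u.
Proof. by move=> H0; apply: sume_ge0 => w _; rewrite mule_ge0// lee_fin. Qed.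

Lemma measurable_jump_int2 H v : meas H ->
  measurable_fun setT (fun zu : Z * measurableTypeR R => jump_int H v zu.1 zu.2).
Proof.
move=> mH; apply: emeasurable_sum => w.
apply: emeasurable_funM => //; apply: measurableT_comp; first exact: mH.
apply/measurable_fun_pairP; split => /=.
  apply: measurable_funD; last by apply: measurable_snd.
  by apply: (measurableT_comp measurable_fst measurable_fst).
apply: (measurableT_comp (mPhi v) (g := fun zu : Z * measurableTypeR R => (zu.2, zu.1.2))).
apply/measurable_fun_pairP; split => /=; first by apply: measurable_snd.
by apply: (measurableT_comp measurable_snd measurable_fst).
Qed.

Lemma measurable_jump_int H v z : meas H ->
  measurable_fun setT (jump_int H v z : measurableTypeR R -> \bar R).
Proof. by move=> mH; have := measurableT_comp (measurable_jump_int2 v mH) (pair1_measurable z).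
  Qed.

Lemma jump_op_ge0 H : nneg H -> nneg (jump_op H).
Proof. by move=> H0 v z; apply: integral_ge0 => u _; exact: jump_int_ge0. Qed.

Lemma measurable_jump_op H : meas H -> nneg H -> meas (jump_op H).
Proof.
move=> mH H0 v.
pose f (zu : Z * measurableTypeR R) :=
  (jump_int H v zu.1 \_ `[0%R, +oo[) zu.2.
have -> : jump_op H v = fubini_F (expo lam) f.
  by apply/funext => z; rewrite /jump_op integral_mkcond.
apply: measurable_fun_fubini_tonelli_F => /=; last first.
  by move=> zu; apply: erestrict_ge0 => u _; exact: jump_int_ge0.
have -> : f = (fun zu => jump_int H v zu.1 zu.2) \_ (setT `*` `[0%R, +oo[).
  apply/funext => zu; rewrite /f !patchE; congr (if _ then _ else _).
  by apply/idP/idP; rewrite !inE//= => -[].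
apply/(measurable_restrictT _ _).1; first exact: measurableX.
by apply: measurable_funTS; exact: measurable_jump_int2.
Qed.

Lemma jump_opD H G : meas H -> nneg H -> meas G -> nneg G ->
  jump_op (fun v z => H v z + G v z) =
  (fun v z => jump_op H v z + jump_op G v z).
Proof.
move=> mH H0 mG G0; apply/funext => v; apply/funext => z.
rewrite /jump_op -ge0_integralD//.
- apply: eq_integral => u _; rewrite /jump_int -big_split/=.
  by apply: eq_bigr => w _; rewrite ge0_muleDr.
- by move=> u _; exact: jump_int_ge0.
- by apply: measurable_funTS; exact: measurable_jump_int.
- by move=> u _; exact: jump_int_ge0.
- by apply: measurable_funTS; exact: measurable_jump_int.
Qed.

Lemma jump_opZ (c : R) H : meas H -> nneg H -> (0 <= c)%R ->
  jump_op (fun v z => c%:E * H v z) = (fun v z => c%:E * jump_op H v z).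
Proof.
move=> mH H0 c0; apply/funext => v; apply/funext => z.
rewrite /jump_op -ge0_integralZl_EFin//.
- apply: eq_integral => u _; rewrite /jump_int ge0_sume_distrr.
    by apply: eq_bigr => w _; rewrite muleCA.
  by move=> w _; rewrite mule_ge0 ?lee_fin.
- by move=> u _; exact: jump_int_ge0.
- by apply: measurable_funTS; exact: measurable_jump_int.
Qed.

(** Supersolution inequalities hold only on states that can be reached (ordered pairs, positions in
    the interval, nonnegative times); stability lets the comparison be iterated there. *)
Definition flow_stable (B : set Z) := forall v u z, (0 <= u)%R -> B z ->
  B ((z.1 + u)%R, Phi v u z.2).

Lemma le_jump_op (B : set Z) H G : flow_stable B ->
  meas H -> nneg H -> meas G ->
  (forall v z, B z -> H v z <= G v z) ->
  forall v z, B z -> jump_op H v z <= jump_op G v z.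
Proof.
move=> Bst mH H0 mG HG v z Bz; apply: ge0_le_integral => //.
- by move=> u _; exact: jump_int_ge0.
- by apply: measurable_funTS; exact: measurable_jump_int.
- by apply: measurable_funTS; exact: measurable_jump_int.
- move=> u /=; rewrite in_itv/= andbT => u0.
  apply: lee_sum => w _; apply: lee_wpmul2l; rewrite ?lee_fin//.
  by apply: HG; exact: Bst.
Qed.

(** The branch [0] covers a last jump that already lies beyond [t]: such paths belong to an earlier
    term of the expansion. *)
Definition no_jump g t v (z : Z) : \bar R :=
  if (z.1 <= t)%R
  then (expR (- lam%:num * (t - z.1)))%:E * g v (Phi v (t - z.1)%R z.2) else 0.

(** Contribution of the paths that make exactly [n] jumps between time [z.1] and time [t]. *)
Definition jump_term g t n := iter n jump_op (no_jump g t).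

Lemma jump_termS g t n : jump_term g t n.+1 = jump_op (jump_term g t n).
Proof. by []. Qed.

Definition jump_sum g t v z := \sum_(0 <= n <oo) jump_term g t n v z.

Definition semigroup g t v y := jump_sum g t v (0%R, y).

Definition gmeas g := forall v, measurable_fun setT (g v).
Definition gnneg g := forall v y, 0 <= g v y.

Lemma no_jump_ge0 g t : gnneg g -> nneg (no_jump g t).
Proof.
move=> g0 v z; rewrite /no_jump; case: ifP => // _.
by rewrite mule_ge0// lee_fin expR_ge0.
Qed.

Lemma measurable_no_jump g t : gmeas g -> meas (no_jump g t).
Proof.
move=> mg v; have mt : measurable_fun setT (fun z : Z => (t - z.1)%R : R).
  by apply: measurable_funB => //; apply: measurable_fst.
apply: measurable_fun_ifT => //=.
  by apply: measurable_fun_ler => //; apply: measurable_fst.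
apply: emeasurable_funM.
  apply/measurable_EFinP; apply: measurableT_comp => //.
  exact: measurable_funM.
apply: measurableT_comp => //.
apply: (measurableT_comp (mPhi v) (g := fun z : Z => ((t - z.1)%R, z.2))).
by apply/measurable_fun_pairP; split => /=; [apply: mt|apply: measurable_snd].
Qed.

Lemma jump_term_ge0 g t n : gnneg g -> nneg (jump_term g t n).
Proof.
by move=> g0; elim: n => [|n ih]; [exact: no_jump_ge0|exact: jump_op_ge0].
Qed.

Lemma measurable_jump_term g t n : gmeas g -> gnneg g -> meas (jump_term g t n).
Proof.
move=> mg g0; elim: n => [|n ih]; first exact: measurable_no_jump.
by apply: measurable_jump_op => //; exact: jump_term_ge0.
Qed.

Lemma jump_sum_ge0 g t : gnneg g -> nneg (jump_sum g t).
Proof. by move=> g0 v z; apply: nneseries_ge0 => n _ _; exact: jump_term_ge0. Qed.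

Lemma measurable_jump_sum g t : gmeas g -> gnneg g -> meas (jump_sum g t).
Proof.
move=> mg g0 v; apply: ge0_emeasurable_sum => [n z _ _|n _].
- exact: jump_term_ge0.
- exact: measurable_jump_term.
Qed.

(** The zeroth term is split off, and monotone convergence moves the series inside the integral over
    the next jump. *)
Lemma jump_sumE g t v z : gmeas g -> gnneg g ->
  jump_sum g t v z = no_jump g t v z + jump_op (jump_sum g t) v z.
Proof.
move=> mg g0; rewrite {1}/jump_sum nneseries_recl//; last by move=> n _; exact: jump_term_ge0.
congr (_ + _); rewrite -nneseries_addn; last by move=> n; exact: jump_term_ge0.
transitivity (\int[expo lam]_(u in `[0%R, +oo[)
    \sum_(0 <= n <oo) jump_int (jump_term g t n) v z u).
  rewrite integral_nneseries//.
  - by apply: eq_eseriesr => n _; rewrite addn1.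
  - move=> n; apply: measurable_funTS; apply: measurable_jump_int.
    exact: measurable_jump_term.
  - by move=> n u _; apply: jump_int_ge0; exact: jump_term_ge0.
apply: eq_integral => u _; rewrite /jump_int nneseries_sum.
  apply: eq_bigr => w _; rewrite nneseriesZl// => n _.
  exact: jump_term_ge0.
by move=> w n _; rewrite mule_ge0 ?lee_fin//; exact: jump_term_ge0.
Qed.

Let psum g t n v z := \sum_(0 <= k < n) jump_term g t k v z.

Let psum_ge0 g t n : gnneg g -> nneg (psum g t n).
Proof. by move=> g0 v z; apply: sume_ge0 => k _; exact: jump_term_ge0. Qed.

Let measurable_psum g t n : gmeas g -> gnneg g -> meas (psum g t n).
Proof.
by move=> mg g0 v; apply: emeasurable_sum => k; exact: measurable_jump_term.
Qed.

(** The partial sums are the Picard iterates, started at [0], of the map sending [H] to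
    [no_jump + jump_op H]. *)
Let psumS g t n : gmeas g -> gnneg g ->
  psum g t n.+1 = (fun v z => no_jump g t v z + jump_op (psum g t n) v z).
Proof.
move=> mg g0; elim: n => [|n ih].
  apply/funext => v; apply/funext => z; rewrite /psum big_nat1.
  rewrite [jump_op _ _ _](_ : _ = 0) ?adde0//.
  apply: integral0_eq => u _; apply: big1 => w _.
  by rewrite big_geq// mule0.
transitivity (fun v z => psum g t n.+1 v z + jump_term g t n.+1 v z).
  by apply/funext => v; apply/funext => z; rewrite /psum big_nat_recr.
rewrite {1}ih; have -> : psum g t n.+1 = fun v z => psum g t n v z + jump_term g t n v z.
  by apply/funext => v; apply/funext => z; rewrite /psum big_nat_recr.
rewrite jump_opD//.
- apply/funext => v; apply/funext => z; exact/esym/addeA.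
- exact: measurable_psum.
- exact: psum_ge0.
- exact: measurable_jump_term.
- exact: jump_term_ge0.
Qed.

(** Comparison principle: [jump_op] is monotone, so a nonnegative supersolution dominates every
    Picard iterate by induction, hence their limit. *)
Lemma jump_sum_le (B : set Z) g t H : gmeas g -> gnneg g -> flow_stable B ->
  meas H -> nneg H ->
  (forall v z, B z -> no_jump g t v z + jump_op H v z <= H v z) ->
  forall v z, B z -> jump_sum g t v z <= H v z.
Proof.
move=> mg g0 Bst mH H0 HH v z Bz; apply: lime_le.
  by apply: is_cvg_nneseries => n _ _; exact: jump_term_ge0.
apply: nearW => n; rewrite -/(psum g t n v z); elim: n v z Bz => [|n ih] v z Bz.
  by rewrite /psum big_geq.
rewrite psumS//; apply: le_trans (HH _ _ Bz); apply: leeD2l.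
apply: (@le_jump_op B) => //; [exact: measurable_psum|exact: psum_ge0].
Qed.

(** Time homogeneity: [no_jump] sees only the remaining time, and [jump_op] only adds to the time of
    the last jump. *)
Lemma jump_term_shift g t n v T a y :
  jump_term g t n v ((T + a)%R, y) = jump_term g (t - a)%R n v (T, y).
Proof.
elim: n v T y => [|n ih] v T y.
  by rewrite /= /no_jump/= lerBrDr opprD addrA addrAC.
rewrite !jump_termS; apply: eq_integral => u _.
by apply: eq_bigr => w _; congr (_ * _); rewrite [X in (X, _)]addrAC ih.
Qed.

Lemma jump_sum_shift g t v T a y :
  jump_sum g t v ((T + a)%R, y) = jump_sum g (t - a)%R v (T, y).
Proof. by apply: eq_eseriesr => n _; rewrite jump_term_shift. Qed.

Let alive (t : R) (v : velocity) (z : Z) : \bar R := (z.1 <= t)%R%:R%:E.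

Let measurable_alive t : meas (alive t).
Proof.
move=> v; rewrite [alive t v](_ : _ = fun z => if (z.1 <= t)%R then 1 else 0).
  apply: measurable_fun_ifT => //=.
  by apply: measurable_fun_ler => //; apply: measurable_fst.
by apply/funext => z; rewrite /alive; case: ifP.
Qed.

Let alive_ge0 t : nneg (alive t).
Proof. by move=> v z; rewrite lee_fin. Qed.

Let jump_int_alive t v z u :
  jump_int (alive t) v z u = (\1_(`]-oo, (t - z.1)%R]) u)%:E.
Proof.
rewrite /jump_int indicE mem_setE in_itv/= lerBrDl /alive/=.
rewrite -ge0_sume_distrl; last by move=> w _; rewrite lee_fin.
by rewrite sumEFin p1 mul1e.
Qed.

Let jump_op_alive t v z : jump_op (alive t) v z =
  if (z.1 <= t)%R then (1 - expR (- lam%:num * (t - z.1)))%:E else 0.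
Proof.
rewrite /jump_op.
under eq_integral do rewrite jump_int_alive.
case: ifPn => [zt|]; last first.
  rewrite -ltNge => tz; apply: integral0_eq => u /=; rewrite in_itv/= andbT => u0.
  rewrite indicE mem_setE in_itv/= leNgt (lt_le_trans _ u0)// subr_lt0//.
rewrite integral_indic//= -expo_itv0c ?subr_ge0//.
congr (expo lam _); apply/seteqP; split => u /=; rewrite !in_itv/= ?andbT.
  by move=> [-> ->].
by move=> /andP[-> ->].
Qed.

(** [alive] solves the renewal equation for the constant [1] exactly; what remains is to show that
    it is the minimal solution, that is, that jumps do not accumulate. *)
Let alive_split t v z :
  no_jump (fun _ _ => 1) t v z + jump_op (alive t) v z = alive t v z.
Proof.
rewrite jump_op_alive /no_jump /alive; case: ifPn => _; last by rewrite add0e.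
by rewrite mule1 -EFinD addrC subrK.
Qed.

Let m1 : gmeas (fun _ _ => 1). Proof. by move=> v. Qed.
Let ge1 : gnneg (fun _ _ => 1). Proof. by []. Qed.

(** Unfolding [alive_split] [n] times leaves [iter n jump_op (alive t)], the probability of at least
    [n] further jumps up to time [t]. *)
Let alive_psum t n v z :
  psum (fun _ _ => 1) t n v z + iter n jump_op (alive t) v z = alive t v z.
Proof.
have iter_meas k : meas (iter k jump_op (alive t)) /\ nneg (iter k jump_op (alive t)).
  elim: k => [|k [mk k0]]; first by split; [exact: measurable_alive|exact: alive_ge0].
  by split; [exact: measurable_jump_op|exact: jump_op_ge0].
elim: n v z => [|n ih] v z; first by rewrite /psum big_geq// add0e.
rewrite psumS// -[in RHS]alive_split -addeA; congr (_ + _).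
have -> : alive t = fun v z => psum (fun=> cst 1) t n v z + iter n jump_op (alive t) v z.
  by apply/funext => v'; apply/funext => z'; rewrite ih.
have [mk k0] := iter_meas n.
rewrite jump_opD//; [|exact: measurable_psum|exact: psum_ge0].
rewrite (_ : (fun v z => psum (fun=> cst 1) t n v z + iter n jump_op (alive t) v z) = alive t)//.
by apply/funext => v'; apply/funext => z'; rewrite ih.
Qed.

(** From a nonnegative time, each further jump falls before [t] with probability at most
    [1 - expR (- lam * t)], so [n] of them cost a geometric factor. *)
Let iter_alive_le t n v z : (0 <= t)%R -> (0 <= z.1)%R ->
  iter n jump_op (alive t) v z <=
  ((1 - expR (- lam%:num * t)) ^+ n)%:E * alive t v z.
Proof.
set th := (1 - _)%R => t0; have th0 : (0 <= th)%R.
  by rewrite subr_ge0 -expR0 ler_expR mulNr oppr_le0 mulr_ge0.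
elim: n v z => [|n ih] v z z0; first by rewrite mul1e.
apply: (@le_trans _ _ (jump_op (fun v z => (th ^+ n)%:E * alive t v z) v z)).
  apply: (@le_jump_op [set z | (0 <= z.1)%R]) => //.
  - by move=> ? u [T y] u0 /= T0; rewrite addr_ge0.
  - elim: (n) => [|k mk]; first exact: measurable_alive.
    apply: measurable_jump_op => //.
    by elim: (k) => [|m im]; [exact: alive_ge0|exact: jump_op_ge0].
  - by elim: (n) => [|m im]; [exact: alive_ge0|exact: jump_op_ge0].
  - by move=> w; apply: emeasurable_funM => //; exact: measurable_alive.
rewrite (jump_opZ (@measurable_alive t) (@alive_ge0 t) (exprn_ge0 n th0)).
rewrite exprSr EFinM -muleA lee_wpmul2l ?lee_fin ?exprn_ge0//.
rewrite jump_op_alive /alive; case: ifPn => zt; last by rewrite mule0.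
rewrite mule1 lee_fin lerD2l lerN2 ler_expR !mulNr lerN2 ler_pM2l//.
by rewrite gerBl.
Qed.

(** The upper bound is comparison with [alive]; the lower bound holds because the remainder in
    [alive_psum] tends to [0]. This is non-explosion, and later shows that almost surely [t] lies
    between two jump times. *)
Lemma jump_sum1 t v z : (0 <= z.1 <= t)%R ->
  jump_sum (fun _ _ => 1) t v z = 1.
Proof.
move=> /andP[z0 zt]; have t0 := le_trans z0 zt.
apply/eqP; rewrite eq_le; apply/andP; split.
  rewrite (@le_trans _ _ (alive t v z))//; last by rewrite /alive zt.
  apply: (@jump_sum_le setT) => //.
  by move=> ? ? _; rewrite alive_split.
apply/lee_addgt0Pr => e e0.
set th : R := (1 - expR (- lam%:num * t))%R.
have /cvgrPdist_lt /(_ e e0) [n _ /(_ n (leqnn n))] : (GRing.exp th : R^nat) @ \oo --> (0%R : R).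
  apply: cvg_expr; rewrite ger0_norm ?gtrBl ?expR_gt0//.
  by rewrite subr_ge0 -expR0 ler_expR mulNr oppr_le0 mulr_ge0.
rewrite sub0r normrN => /(le_lt_trans (ler_norm _))/ltW then_.
apply: (@le_trans _ _ (psum (fun _ _ => 1) t n v z + iter n jump_op (alive t) v z)).
  by rewrite alive_psum /alive zt.
apply: leeD.
  by apply: nneseries_lim_ge => k _ _; exact: jump_term_ge0.
apply: le_trans (iter_alive_le n v t0 z0) _.
by rewrite /alive zt mule1 lee_fin.
Qed.

Lemma measurable_super_int (h : R -> velocity -> S -> \bar R) a v y :
  (forall v, measurable_fun setT (fun z : Z => h z.1 v z.2)) ->
  measurable_fun setT ((fun u => (lam%:num * expR (- lam%:num * u))%:E *
    \sum_w (p v w)%:E * h (a - u)%R w (Phi v u y)) : measurableTypeR R -> \bar R).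
Proof.
move=> mh; apply: emeasurable_funM.
  apply/measurable_EFinP; apply: measurable_funM => //.
  by apply: measurableT_comp => //; exact: measurable_funM.
apply: emeasurable_sum => w; apply: emeasurable_funM => //.
apply: (measurableT_comp (mh w)
  (g := fun u : measurableTypeR R => ((a - u)%R : measurableTypeR R, Phi v u y))).
apply: measurable_fun_pair; first exact: measurable_funB.
exact: (measurableT_comp (mPhi v) (pair2_measurable y)).
Qed.

(** The comparison principle in terms of the remaining time [a], the form in which explicit
    supersolutions are checked. A jump later than [a] contributes nothing, so the integral stops at
    [a]. *)
Lemma semigroup_le_super (B : set S) g (h : R -> velocity -> S -> \bar R) t v y :
  gmeas g -> gnneg g ->
  (forall v u y, (0 <= u)%R -> B y -> B (Phi v u y)) ->
  (forall v, measurable_fun setT (fun z : Z => h z.1 v z.2)) ->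
  (forall a v y, 0 <= h a v y) ->
  (forall a v y, (0 <= a)%R -> B y ->
    (expR (- lam%:num * a))%:E * g v (Phi v a y) +
    \int[lebesgue_measure]_(u in `[0%R, a]) ((lam%:num * expR (- lam%:num * u))%:E *
      \sum_w (p v w)%:E * h (a - u)%R w (Phi v u y)) <= h a v y) ->
  (0 <= t)%R -> B y -> semigroup g t v y <= h t v y.
Proof.
move=> mg g0 Bst mh h0 hh t0 By.
pose H v (z : Z) := if (z.1 <= t)%R then h (t - z.1)%R v z.2 else 0.
have mH : meas H.
  move=> w; apply: measurable_fun_ifT => //=.
    by apply: measurable_fun_ler => //; apply: measurable_fst.
  apply: (measurableT_comp (mh w) (g := fun z : Z => ((t - z.1)%R : measurableTypeR R, z.2))).
  apply: measurable_fun_pair; last exact: measurable_snd.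
  by apply: measurable_funB => //; apply: measurable_fst.
have H0 : nneg H by move=> w z; rewrite /H; case: ifP.
have -> : h t v y = H v (0%R, y) by rewrite /H/= t0 subr0.
apply: (@jump_sum_le [set z | B z.2]) => //.
  by move=> w u z u0 /= Bz; exact: Bst.
move=> w [T x] /= Bx; rewrite {2}/H /no_jump/=; case: ifPn => [Tt|]; last first.
  rewrite -ltNge => tT; rewrite add0e /jump_op integral0_eq// => u /=.
  rewrite in_itv/= andbT => u0; apply: big1 => w' _; rewrite /H/=.
  by rewrite leNgt (lt_le_trans tT) ?lerDl ?mule0.
have a0 : (0 <= t - T)%R by rewrite subr_ge0.
apply: le_trans (hh _ _ _ a0 Bx); apply: leeD2l.
rewrite /jump_op (@itv_bndbnd_setU _ _ (BLeft 0%R) (BRight (t - T)%R)) ?bnd_simp//.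
rewrite ge0_integral_setU//=; last 3 first.
- by apply: measurable_funTS; exact: measurable_jump_int.
- by move=> u _; exact: jump_int_ge0.
- exact: disjoint_adjacent_itv.
rewrite [X in _ + X]integral0_eq ?adde0; last first.
  move=> u /=; rewrite in_itv/= andbT => ua; apply: big1 => w' _.
  by rewrite /H/= -lerBrDl leNgt ua mule0.
rewrite integral_expo//; last 3 first.
- by move=> u /=; rewrite !in_itv/= => /andP[->].
- by apply: measurable_funTS; exact: measurable_jump_int.
- by move=> u _; exact: jump_int_ge0.
apply: eq_leW.
apply: eq_integral => u; rewrite inE/= in_itv/= => /andP[u0 ua].
congr (_ * _); apply: eq_bigr => w' _; congr (_ * _).
by rewrite /H/= -lerBrDl ua opprD addrA.
Qed.

Variable A : set S.
Hypothesis Ast : forall v u y, (0 <= u)%R -> A y -> A (Phi v u y).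
Hypothesis PhiD : forall v u s y, (0 <= u)%R -> (0 <= s)%R -> A y ->
  Phi v s (Phi v u y) = Phi v (u + s)%R y.

Lemma measurable_semigroup g t : gmeas g -> gnneg g -> gmeas (semigroup g t).
Proof.
move=> mg g0 v; exact: (measurableT_comp (measurable_jump_sum t mg g0 v)
  (pair1_measurable (0%R : measurableTypeR R))).
Qed.

Lemma semigroup_ge0 g t : gnneg g -> gnneg (semigroup g t).
Proof. by move=> g0 v y; exact: jump_sum_ge0. Qed.

(** The solution [U] for the horizon [t + s], cut to [0] after time [t], satisfies the renewal
    equation with terminal value [P_s g] at time [t]; the minimal solution of that equation lies
    below it. *)
Lemma semigroup_le g t s v y : gmeas g -> gnneg g ->
  (0 <= t)%R -> (0 <= s)%R -> A y ->
  semigroup (semigroup g s) t v y <= semigroup g (t + s)%R v y.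
Proof.
move=> mg g0 t0 s0 Ay.
pose U := jump_sum g (t + s)%R.
pose H v (z : Z) := if (z.1 <= t)%R then U v z else 0.
have mU : meas U by exact: measurable_jump_sum.
have U0 : nneg U by exact: jump_sum_ge0.
have mH : meas H.
  move=> w; apply: measurable_fun_ifT => //=.
  by apply: measurable_fun_ler => //; apply: measurable_fst.
have H0 : nneg H by move=> w z; rewrite /H; case: ifP.
have -> : semigroup g (t + s)%R v y = H v (0%R, y) by rewrite /H/= t0.
apply: (@jump_sum_le [set z | A z.2]) => //.
- exact: measurable_semigroup.
- exact: semigroup_ge0.
- by move=> w u z u0 /= Az; exact: Ast.
move=> w [T x] /= Ax; rewrite /no_jump /H/=; case: ifPn => [Tt|]; last first.
  rewrite -ltNge => tT; rewrite add0e /jump_op integral0_eq// => u /=.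
  rewrite in_itv/= andbT => u0; apply: big1 => w' _ /=.
  by rewrite leNgt (lt_le_trans tT) ?lerDl ?mule0.
set a := (t - T)%R; have a0 : (0 <= a)%R by rewrite subr_ge0.
have -> : semigroup g s w (Phi w a x) = U w (t, Phi w a x).
  by rewrite /U -[X in (X, _)]add0r jump_sum_shift [(t + s)%R]addrC addrK.
rewrite {1}/U jump_sumE// -/U ge0_muleDr; last 2 first.
- exact: no_jump_ge0.
- exact: jump_op_ge0.
rewrite {3}/U jump_sumE// -/U -addeA; apply: leeD.
  rewrite /no_jump/= lerDl s0 [(t + s - t)%R]addrC addKr.
  rewrite (le_trans Tt) ?lerDl// muleA -EFinM -expRD PhiD// -mulrDr.
  by rewrite (_ : a + s = t + s - T)%R// /a addrAC.
have mJ := measurable_jump_int w (T, x) mU.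
have J0 u : 0 <= jump_int U w (T, x) u by exact: jump_int_ge0.
(* By memorylessness, restarting from the flowed state at time [t] amounts to drawing a first jump
   later than [a] from the original state. *)
have -> : (expR (- lam%:num * a))%:E * jump_op U w (t, Phi w a x) =
    \int[expo lam]_(u in `]a, +oo[) jump_int U w (T, x) u.
  rewrite expo_memoryless//; congr (_ * _).
  apply: eq_integral => u; rewrite inE/= in_itv/= andbT => u0.
  apply: eq_bigr => w' _; congr (_ * U _ (_, _)) => /=; last exact: PhiD.
  by rewrite /a addrA addrC subrKC addrC.
have -> : jump_op H w (T, x) = \int[expo lam]_(u in `[0%R, a]) jump_int U w (T, x) u.
  rewrite /jump_op (@itv_bndbnd_setU _ _ _ (BRight a)) ?bnd_simp//.
  rewrite ge0_integral_setU//=.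
  - rewrite [X in _ + X]integral0_eq ?adde0.
      apply: eq_integral => u; rewrite inE/= in_itv/= => /andP[u0 ua].
      apply: eq_bigr => w' _; congr (_ * _); rewrite /H/=.
      by rewrite -lerBrDl ua.
    move=> u /=; rewrite in_itv/= andbT => ua; apply: big1 => w' _.
    by rewrite /H/= -lerBrDl leNgt ua mule0.
  - apply: measurable_funTS; exact: measurable_jump_int.
  - by move=> u _; exact: jump_int_ge0.
  - exact: disjoint_adjacent_itv.
rewrite /jump_op (@itv_bndbnd_setU _ _ (BLeft 0%R) (BRight a) +oo%O) ?bnd_simp//.
rewrite ge0_integral_setU//=.
- by rewrite addeC.
- exact: measurable_funTS.
- exact: disjoint_adjacent_itv.
Qed.

End jump_kernel.

(** * The jump process solves the renewal equation *)

Section jump_process_law.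
Local Open Scope ereal_scope.
Context {R : realType} d (Omega : measurableType d) (P : probability Omega R).
Variables (T : nat -> Omega -> R) (V : nat -> Omega -> velocity).
Variables (q : velocity -> velocity -> R) (v0 : velocity) (lam : {posnum R}).
Hypothesis jp : is_jump_process q v0 P T V.
Hypothesis q0 : forall v w, (0 <= q v w)%R.
Hypothesis q_exit : forall v, exit_rate q v = lam%:num.
Context dS (S : measurableType dS).
Variable Phi : velocity -> R -> S -> S.
Hypothesis mPhi : forall v,
  measurable_fun setT (fun z : measurableTypeR R * S => Phi v z.1 z.2).
Variable y0 : S.

Notation p := (jump_prob q).
Notation Z := (measurableTypeR R * S)%type.

Let p0 v w : (0 <= p v w)%R.
Proof. by rewrite /jump_prob divr_ge0// q_exit. Qed.

(** Generic form of [position_at_jump], so that one computation of the law serves a single position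
    and a coupled pair. *)
Fixpoint path_state (n : nat) (om : Omega) : S :=
  if n is m.+1
  then Phi (V m om) (T m.+1 om - T m om)%R (path_state m om) else y0.

Let tau n om : measurableTypeR R := (T n.+1 om - T n om)%R.
Let Zn n om : Z := (T n om, path_state n om).

Let measurable_tau n : measurable_fun setT (tau n).
Proof. by apply: measurable_funB; exact: (jump_time_measurable jp). Qed.

Let measurable_V n v : measurable (V n @^-1` [set v]).
Proof. by rewrite -[X in measurable X]setTI; exact: (jump_value_measurable jp). Qed.

Lemma measurable_velocity_fun n d' (T' : measurableType d')
    (F : velocity -> Omega -> T') :
  (forall v, measurable_fun setT (F v)) ->
  measurable_fun setT (fun om => F (V n om) om).
Proof.
move=> mF _ Y mY; rewrite setTI.
have -> : (fun om => F (V n om) om) @^-1` Y =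
    \bigcup_(v in [set: velocity]) (V n @^-1` [set v] `&` F v @^-1` Y).
  apply/seteqP; split => om /=; first by exists (V n om).
  by move=> [v _ []] /= <-.
apply: fin_bigcup_measurable => [|v _]; first exact: finite_finset.
apply: measurableI; first exact: measurable_V.
by rewrite -[X in measurable X]setTI; exact: mF.
Qed.

Lemma measurable_path_state n : measurable_fun setT (path_state n).
Proof.
elim: n => [|n ih] /=; first exact: measurable_cst.
apply: (@measurable_velocity_fun n _ _ (fun v om => Phi v (tau n om) (path_state n om))).
move=> v; apply: (measurableT_comp (mPhi v) (g := fun om => (tau n om, path_state n om))).
exact: (measurable_fun_pair (measurable_tau n) ih).
Qed.

Let measurable_Zn n : measurable_fun setT (Zn n).
Proof.
apply/measurable_fun_pairP; split; last exact: measurable_path_state.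
exact: (jump_time_measurable jp).
Qed.

Let tail n m (s : nat -> velocity) (B : nat -> set R) : set Omega :=
  [set om | (forall i, (n <= i <= m)%N -> V i om = s i) /\
            (forall i, (n <= i < m)%N -> B i (tau i om))].

Let measurable_tail n m s B : (forall i, measurable (B i)) ->
  measurable (tail n m s B).
Proof.
move=> mB; have -> : tail n m s B =
    (\bigcap_(i in [set i | (n <= i <= m)%N]) V i @^-1` [set s i]) `&`
    (\bigcap_(i in [set i | (n <= i < m)%N]) tau i @^-1` B i).
  by apply/seteqP; split => om /= [h1 h2]; split => i /= hi;
    [exact: h1|exact: h2|exact: h1|exact: h2].
apply: measurableI; apply: bigcap_measurableType => i _; first exact: measurable_V.
by rewrite -[X in measurable X]setTI; exact: (measurable_tau i measurableT (mB i)).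
Qed.

Let weight n m (s : nat -> velocity) (B : nat -> set R) : R :=
  (\prod_(n <= i < m) (p (s i) (s i.+1) * fine (expo lam (B i))))%R.

Let weight_ge0 n m s B : (0 <= weight n m s B)%R.
Proof.
apply: prodr_ge0 => i _; apply: mulr_ge0; first exact: p0.
exact/fine_ge0/measure_ge0.
Qed.

(** Markov property at the [n]-th jump: given [V n], the later velocities and holding times do not
    depend on the jump time and the state reached, and [weight] is their conditional probability. *)
Let indep n := forall m s B (A : set Z), (n <= m)%N ->
  (forall i, measurable (B i)) -> measurable A ->
  P (Zn n @^-1` A `&` tail n m s B) =
  (weight n m s B)%:E * P (Zn n @^-1` A `&` V n @^-1` [set s n]).

Let indep0 : indep 0.
Proof.
have law m s B : (forall i, measurable (B i)) ->
    P (tail 0 m s B) = ((s 0%N == v0)%:R * weight 0 m s B)%:E.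
  move=> mB; rewrite /weight big_mkord.
  rewrite (eq_bigr (fun i : 'I_m => p (s i) (s i.+1) *
    fine (exponential_prob (exit_rate q (s i)) (B i)))%R); last first.
    by move=> i _; rewrite q_exit expoE.
  rewrite -(jump_law jp m s mB).
  by congr (P _); apply/seteqP; split => om /=.
move=> m s B A _ mB mA.
have -> : Zn 0 @^-1` A = [set om | A (0%R, y0)].
  by apply/seteqP; split => om /=; rewrite /Zn /= (jump_time0 jp).
have [Ay|Ay] := pselect (A (0%R, y0)); last first.
  by rewrite (_ : [set _ | _] = set0) ?set0I ?measure0 ?mule0//; apply/seteqP; split.
rewrite (_ : [set _ | _] = setT) ?setTI; last by apply/seteqP; split.
have -> : V 0 @^-1` [set s 0%N] = tail 0 0 s (fun=> setT).
  apply/seteqP; split => om /=; last by move=> [VE _]; exact: VE.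
  by move=> V0; split => // i; rewrite leqn0 => /eqP ->.
have w0 : weight 0 0 s (fun=> setT) = 1%R by rewrite /weight big_geq.
by rewrite !law// w0 mulr1 -EFinM mulrC.
Qed.

(** Leaving the [n]-th holding time free ([B n = setT]) allows a function of it to be integrated.
    Both sides are integrals of [f] against measures that agree on rectangles, a generating class
    closed under intersection. *)
Let indep_int n : indep n -> forall m s B (f : Z * measurableTypeR R -> \bar R),
  (n < m)%N -> (forall i, measurable (B i)) -> B n = setT ->
  measurable_fun setT f -> (forall x, 0 <= f x) ->
  \int[P]_(om in tail n m s B) f (Zn n om, tau n om) =
  (weight n m s B)%:E *
  \int[P]_(om in V n @^-1` [set s n]) \int[expo lam]_u f (Zn n om, u).
Proof.
move=> ind m s B f nm mB Bn mf f0.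
have mphi : measurable_fun setT (fun om => (Zn n om, tau n om)).
  exact: (measurable_fun_pair (measurable_Zn n) (measurable_tau n)).
have mpsi : measurable_fun setT
    (fun x : Omega * measurableTypeR R => (Zn n x.1, x.2)).
  apply/measurable_fun_pairP; split => /=; last exact: measurable_snd.
  exact: (measurableT_comp (measurable_Zn n) measurable_fst).
have mE := measurable_tail n m s mB.
have mV : measurable (V n @^-1` [set s n] `*` [set: measurableTypeR R]).
  exact: measurableX.
pose m1 := pushm (mrestr P mE) mphi.
pose m2 := mscale (NngNum (weight_ge0 n m s B))
  (pushm (mrestr (P \x expo lam) mV) mpsi).
have m12 X : measurable X -> m1 X = m2 X.
  apply: (measure_unique [set A `*` B | A in measurable & B in measurable] (fun=> setT)).
  - exact: measurable_prod_measurableType.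
  - move=> _ _ [A1 mA1 [B1 mB1 <-]] [A2 mA2 [B2 mB2 <-]].
    exists (A1 `&` A2); first exact: measurableI.
    by exists (B1 `&` B2); [exact: measurableI|rewrite setXI].
  - by move=> _; exists setT => //; exists setT => //; rewrite setXTT.
  - by rewrite bigcup_const//; exists 0%N.
  - move=> _ [A mA [B1 mB1 <-]].
    (* On a rectangle, the condition that [tau n] lies in [B1] fills the free slot, so the event is
       again a [tail] and [ind] applies; [expo lam B1] appears in the [n]-th factor of its
       weight. *)
    pose B' (i : nat) : set R := if (i == n)%N then B1 else B i.
    have mB' i : measurable (B' i).
      by rewrite /B'; case: ifP => _; [exact: mB1|exact: mB].
    have m1E : m1 (A `*` B1) =
      P ((fun om => (Zn n om, tau n om)) @^-1` (A `*` B1) `&` tail n m s B) by [].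
    have m2E : m2 (A `*` B1) = (weight n m s B)%:E * (P \x expo lam)
      ((fun x : Omega * measurableTypeR R => (Zn n x.1, x.2)) @^-1` (A `*` B1)
         `&` (V n @^-1` [set s n] `*` setT)) by [].
    apply: (etrans m1E); apply: etrans (esym m2E).
    have -> : (fun om => (Zn n om, tau n om)) @^-1` (A `*` B1) `&` tail n m s B =
        Zn n @^-1` A `&` tail n m s B'.
      apply/seteqP; split => om /=; rewrite /tail/=.
        move=> [[Az Bt] [VE BE]]; split=> //; split=> // i im.
        by rewrite /B'; case: eqP => [->//|_]; exact: BE.
      move=> [Az [VE BE]]; split; [split=> //|split=> // i im].
        by have := BE n; rewrite leqnn nm /B' eqxx; apply.
      by have := BE i im; rewrite /B'; case: eqP => [->|//]; rewrite Bn.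
    rewrite ind//; last exact: ltnW.
    have -> : (fun x : Omega * measurableTypeR R => (Zn n x.1, x.2)) @^-1` (A `*` B1)
        `&` (V n @^-1` [set s n] `*` setT) =
        (Zn n @^-1` A `&` V n @^-1` [set s n]) `*` B1.
      apply/seteqP; split => -[om u] /=; first by move=> [[? ?] [? _]].
      by move=> [[? ?] ?].
    rewrite product_measure1E//; last first.
      by apply: measurableI => //; rewrite -[X in measurable X]setTI; exact: measurable_Zn.
    rewrite muleCA [RHS]muleC -[X in _ * X * _]fineK; last first.
      by rewrite fin_num_measure.
    congr (_ * _); rewrite -EFinM; congr EFin.
    rewrite /weight (big_ltn nm) [in RHS](big_ltn nm).
    rewrite {1}/B' eqxx Bn probability_setT mulr1 [RHS]mulrAC; congr (_ * _)%R.
    apply: eq_big_nat => i /andP[ni _]; rewrite /B'.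
    by case: eqP ni => // ->; rewrite ltnn.
  - move=> _; have -> : m1 setT = P (tail n m s B) by rewrite /m1/= /pushforward preimage_setT
    /mrestr setTI.
    by rewrite (le_lt_trans (probability_le1 _ mE)) ?ltry.
transitivity (\int[m1]_x f x).
  by rewrite ge0_integral_pushm// ge0_integral_mrestr//; exact: measurableT_comp.
transitivity (\int[m2]_x f x).
  by apply: eq_measure_integral => A mA _; exact: m12.
rewrite ge0_integral_mscale// ge0_integral_pushm//; congr (_ * _).
rewrite ge0_integral_mrestr//; last exact: measurableT_comp.
rewrite integral_mkcond fubini_tonelli1/=; last 2 first.
  by apply/(measurable_restrictT _ _).1 => //; apply: measurable_funTS; exact: measurableT_comp.
  by move=> x; exact: erestrict_ge0.
rewrite [RHS]integral_mkcond; apply: eq_integral => om _.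
rewrite /fubini_F patchE; case: ifPn => omV.
  apply: eq_integral => u _; rewrite patchE mem_set//=; split => //.
  by rewrite inE in omV.
move: omV; rewrite notin_setE => omV.
by apply: integral0_eq => u _; rewrite patchE memNset// => -[/omV].
Qed.

Let integral_V n (D : set Omega) (f : Omega -> \bar R) : measurable D ->
  measurable_fun setT f -> (forall om, 0 <= f om) ->
  \int[P]_(om in D) f om = \sum_v \int[P]_(om in D `&` V n @^-1` [set v]) f om.
Proof.
move=> mD mf f0; have mDV v : measurable (D `&` V n @^-1` [set v]).
  exact: measurableI.
under eq_bigr do rewrite integral_mkcond.
rewrite -ge0_integral_sum//; last 2 first.
  by move=> v; apply/(measurable_restrictT _ _).1 => //; exact: measurable_funTS.
  by move=> v om _; exact: erestrict_ge0.
rewrite [LHS]integral_mkcond; apply: eq_integral => om _.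
rewrite (bigD1 (V n om))//= big1 ?adde0; last first.
  move=> v /eqP vV; rewrite patchE memNset// => -[_ /= /esym].
  exact: vV.
rewrite !patchE; congr (if _ then _ else _).
by apply/idP/idP; rewrite !inE//= => -[].
Qed.

Let step v (z : Z) u : Z := ((z.1 + u)%R, Phi v u z.2).

Let measurable_step v :
  measurable_fun setT (fun zu : Z * measurableTypeR R => step v zu.1 zu.2).
Proof.
apply/measurable_fun_pairP; split => /=.
  apply: measurable_funD; last by apply: measurable_snd.
  by apply: (measurableT_comp measurable_fst measurable_fst).
apply: (measurableT_comp (mPhi v) (g := fun zu : Z * measurableTypeR R => (zu.2, zu.1.2))).
apply/measurable_fun_pairP; split => /=; first by apply: measurable_snd.
by apply: (measurableT_comp measurable_snd measurable_fst).
Qed.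

(** Slicing by [V n] turns a tail from [n.+1] into tails from [n] whose first holding time is free,
    while [Zn n.+1] is the image of [Zn n] and [tau n] under [step]; [indep_int] then applies. *)
Let tailS_int n : indep n -> forall m s B (h : Z -> \bar R),
  (n < m)%N -> (forall i, measurable (B i)) ->
  measurable_fun setT h -> (forall x, 0 <= h x) ->
  \int[P]_(om in tail n.+1 m s B) h (Zn n.+1 om) =
  (weight n.+1 m s B)%:E * \sum_v ((p v (s n.+1))%:E *
    \int[P]_(om in V n @^-1` [set v]) \int[expo lam]_u h (step v (Zn n om) u)).
Proof.
move=> ind m s B h nm mB mh h0.
rewrite (@integral_V n); last 3 first.
- exact: measurable_tail.
- exact: measurableT_comp.
- by [].
rewrite ge0_sume_distrr; last first.
  move=> v _; rewrite mule_ge0 ?lee_fin//; apply: integral_ge0 => om _.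
  exact: integral_ge0.
apply: eq_bigr => v _.
pose s' i := if (i == n)%N then v else s i.
pose B' i : set R := if (i == n)%N then setT else B i.
have mB' i : measurable (B' i) by rewrite /B'; case: ifP => _; [exact: measurableT|exact: mB].
have sE i : (n < i)%N -> s' i = s i by rewrite /s'; case: eqP => // ->; rewrite ltnn.
have BE i : (n < i)%N -> B' i = B i by rewrite /B'; case: eqP => // ->; rewrite ltnn.
have s'n : s' n = v by rewrite /s' eqxx.
have -> : tail n.+1 m s B `&` V n @^-1` [set v] = tail n m s' B'.
  apply/seteqP; split => om /=; rewrite /tail/=.
    move=> [[VE TE] Vn]; split => i /andP[]; rewrite leq_eqVlt => /orP[/eqP <- _|ni im].
    - by rewrite s'n.
    - by rewrite sE// VE// ni.
    - by rewrite /B' eqxx.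
    - by rewrite BE//; apply: TE; rewrite ni.
  move=> [VE TE]; split; last by rewrite -s'n; apply: VE; rewrite leqnn ltnW.
  by split => i /andP[ni im]; [rewrite -sE// VE// im ltnW|rewrite -BE//; apply: TE;
    rewrite im ltnW].
transitivity (\int[P]_(om in tail n m s' B') h (step v (Zn n om) (tau n om))).
  apply: eq_integral => om; rewrite inE => -[/(_ n)]; rewrite leqnn ltnW// => /(_ isT) VE _.
  by rewrite /Zn /step /tau/= VE s'n subrKC.
rewrite (@indep_int n ind m s' B' (fun zu => h (step v zu.1 zu.2)))//; last 2 first.
- by rewrite /B' eqxx.
- exact: (measurableT_comp mh (measurable_step v)).
rewrite s'n muleA -EFinM; congr (_%:E * _).
rewrite /weight (big_ltn nm) s'n sE// {1}/B' eqxx probability_setT mulr1 mulrC.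
congr (_ * _)%R; apply: eq_big_nat => i /andP[ni _].
by rewrite !sE ?BE// ltnW.
Qed.

Let tail1 n s B : tail n n s B = V n @^-1` [set s n].
Proof.
apply/seteqP; split => om /=; first by move=> [VE _]; apply: VE; rewrite leqnn.
move=> Vn; split => i; first by rewrite -eqn_leq => /eqP <-.
by move=> /andP[ni /(leq_ltn_trans ni)]; rewrite ltnn.
Qed.

(** In the induction step [tailS_int] evaluates both sides with the same sum over [V n]; on the
    right the tail consists of a single index and has weight [1]. *)
Let indep_all n : indep n.
Proof.
elim: n => [|n ind]; first exact: indep0.
move=> m s B A nm mB mA.
have mZA : measurable (Zn n.+1 @^-1` A).
  by rewrite -[X in measurable X]setTI; exact: measurable_Zn.
have h m' s' B' : (forall i, measurable (B' i)) ->
    P (Zn n.+1 @^-1` A `&` tail n.+1 m' s' B') =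
    \int[P]_(om in tail n.+1 m' s' B') (\1_A (Zn n.+1 om))%:E.
  by move=> mB'; rewrite -integral_indic//; exact: measurable_tail.
have hm : measurable_fun setT (fun z : Z => (\1_A z : R)%:E).
  by apply/measurable_EFinP; exact: measurable_indic.
rewrite h// (@tailS_int n ind _ _ _ (fun z => (\1_A z : R)%:E))//.
congr (_ * _); rewrite -(tail1 _ s (fun=> setT)) h//.
rewrite (@tailS_int n ind _ _ _ (fun z => (\1_A z : R)%:E))//.
by rewrite /weight big_geq// mul1e.
Qed.

Let measurable_HZ n (H : velocity -> Z -> \bar R) : meas H ->
  measurable_fun setT (fun om => H (V n om) (Zn n om)).
Proof.
move=> mH; apply: (@measurable_velocity_fun n _ _ (fun v om => H v (Zn n om))) => v.
exact: (measurableT_comp (mH v) (measurable_Zn n)).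
Qed.

Let expect_step n (H : velocity -> Z -> \bar R) : meas H -> nneg H ->
  \int[P]_om H (V n.+1 om) (Zn n.+1 om) =
  \int[P]_om jump_op lam p Phi H (V n om) (Zn n om).
Proof.
move=> mH H0.
have mJ := @measurable_jump_op _ _ _ lam _ _ p0 mPhi _ mH H0.
have J0 : nneg (jump_op lam p Phi H) by exact: jump_op_ge0.
rewrite (@integral_V n.+1)//; last exact: measurable_HZ.
rewrite [RHS](@integral_V n)//; last exact: (@measurable_HZ n (jump_op lam p Phi H)).
pose I v w z := \int[expo lam]_u H w (step v z u).
have mI v w : measurable_fun setT (I v w).
  apply: (@measurable_fun_fubini_tonelli_F _ _ _ _ _ (expo lam) (fun zu =>
    H w (step v zu.1 zu.2))) => //.
  exact: (measurableT_comp (mH w) (measurable_step v)).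
have I0 v w z : 0 <= I v w z by apply: integral_ge0.
transitivity (\sum_w \sum_v ((p v w)%:E *
    \int[P]_(om in V n @^-1` [set v]) I v w (Zn n om))).
  apply: eq_bigr => w _; rewrite setTI.
  transitivity (\int[P]_(om in tail n.+1 n.+1 (fun=> w) (fun=> setT)) H w (Zn n.+1 om)).
    by rewrite tail1; apply: eq_integral => om; rewrite inE/= => ->.
  rewrite (tailS_int (@indep_all n))//.
  by rewrite /weight big_geq// mul1e.
rewrite exchange_big/=; apply: eq_bigr => v _; rewrite setTI.
transitivity (\int[P]_(om in V n @^-1` [set v]) \sum_w (p v w)%:E * I v w (Zn n om)).
  rewrite ge0_integral_sum//; last 2 first.
  - move=> w; apply: emeasurable_funM => //; apply: measurable_funTS.
    exact: (measurableT_comp (mI v w) (measurable_Zn n)).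
  - by move=> w om _; rewrite mule_ge0 ?lee_fin.
  apply: eq_bigr => w _; rewrite ge0_integralZl_EFin//.
  by apply: measurable_funTS; exact: (measurableT_comp (mI v w) (measurable_Zn n)).
apply: eq_integral => om; rewrite inE/= => ->.
rewrite /jump_op integral_expo_nneg//; last 2 first.
- exact: measurable_jump_int.
- by move=> u; exact: jump_int_ge0.
have mHs w : measurable_fun setT (fun u : measurableTypeR R => H w (step v (Zn n om) u)).
  exact: (measurableT_comp (measurableT_comp (mH w) (measurable_step v)) (pair1_measurable (Zn n
    om))).
rewrite /jump_int ge0_integral_sum//; last 2 first.
- by move=> w; apply: emeasurable_funM => //; exact: mHs.
- by move=> w u _; rewrite mule_ge0 ?lee_fin.
by apply: eq_bigr => w _; rewrite ge0_integralZl_EFin//; exact: mHs.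
Qed.

Let expect_tau n (F : velocity -> Z * measurableTypeR R -> \bar R) :
  (forall v, measurable_fun setT (F v)) -> (forall v x, 0 <= F v x) ->
  \int[P]_om F (V n om) (Zn n om, tau n om) =
  \int[P]_om \int[expo lam]_u F (V n om) (Zn n om, u).
Proof.
move=> mF F0.
have mFZ v : measurable_fun setT (fun om => F v (Zn n om, tau n om)).
  exact: (measurableT_comp (mF v) (measurable_fun_pair (measurable_Zn n) (measurable_tau n))).
pose I v z := \int[expo lam]_u F v (z, u).
have mI v : measurable_fun setT (I v).
  exact: measurable_fun_fubini_tonelli_F.
have I0 v z : 0 <= I v z by apply: integral_ge0.
rewrite (@integral_V n)//; last by apply: (@measurable_velocity_fun n _ _ (fun v om =>
  F v (Zn n om, tau n om))).
rewrite [RHS](@integral_V n)//; last 2 first.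
- exact: (@measurable_HZ n I).
- by move=> om; apply: integral_ge0.
apply: eq_bigr => v _; rewrite setTI.
transitivity (\int[P]_(om in V n @^-1` [set v]) F v (Zn n om, tau n om)).
  by apply: eq_integral => om; rewrite inE/= => ->.
(* [indep_int] needs a tail that reaches past index [n], so the next velocity is fixed as well; it
   is summed out at the end because the rows of [p] add up to [1]. *)
rewrite (@integral_V n.+1)//.
transitivity (\sum_w ((p v w)%:E * \int[P]_(om in V n @^-1` [set v]) I v (Zn n om))).
  apply: eq_bigr => w _.
  pose s i := if (i == n)%N then v else w.
  have sn : s n = v by rewrite /s eqxx.
  have sn1 : s n.+1 = w by rewrite /s -[X in _ == X]addn0 -addn1 eqn_add2l.
  have -> : V n @^-1` [set v] `&` V n.+1 @^-1` [set w] = tail n n.+1 s (fun=> setT).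
    apply/seteqP; split => om /=.
      move=> [Vn Vn1]; split => // i /andP[ni]; rewrite leq_eqVlt => /orP[/eqP ->|].
        by rewrite sn1.
      rewrite ltnS => iN; have -> : i = n by apply/eqP; rewrite eqn_leq iN ni.
      by rewrite Vn sn.
    move=> [VE _]; rewrite -[in X in X /\ _]sn -[in X in _ /\ X]sn1.
    by split; apply: VE; rewrite leqnn ?leqnSn.
  rewrite (indep_int (@indep_all n))// /weight big_nat1 sn sn1.
  by rewrite probability_setT mulr1.
rewrite -ge0_sume_distrl; last by move=> w _; rewrite lee_fin.
rewrite sumEFin; have -> : (\sum_w p v w = 1)%R.
  by rewrite /jump_prob -mulr_suml -[X in (X / _)%R]/(exit_rate q v) q_exit divff.
by rewrite mul1e; apply: eq_integral => om; rewrite inE/= => ->.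
Qed.

Let dwell t n : set Omega := [set om | (T n om <= t < T n.+1 om)%R].

Let measurable_dwell t n : measurable (dwell t n).
Proof.
have mT k := jump_time_measurable jp k.
rewrite /dwell [X in measurable X](_ : _ =
    (fun om => (T n om <= t)%R && (t < T n.+1 om)%R) @^-1` [set true]) //.
rewrite -[X in measurable X]setTI.
apply: measurable_and => //.
  exact: measurable_fun_ler.
exact: measurable_fun_ltr.
Qed.

Let T_mono om n m : (n <= m)%N -> (T n om <= T m om)%R.
Proof.
move=> /subnK <-; elim: (m - n)%N => [|k ih]; first by rewrite add0n.
by rewrite addSn (le_trans ih)// ltW// (jump_time_lt jp).
Qed.

Let T_ge0 om n : (0 <= T n om)%R.
Proof. by rewrite -(jump_time0 jp om) T_mono. Qed.

Let dwell_inj t n m om : dwell t n om -> dwell t m om -> n = m.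
Proof.
move=> /andP[n1 n2] /andP[m1 m2]; apply/eqP; rewrite eqn_leq.
apply/andP; split; rewrite leqNgt; apply/negP => /(T_mono om) h.
  by have := lt_le_trans m2 (le_trans h n1); rewrite ltxx.
by have := lt_le_trans n2 (le_trans h m1); rewrite ltxx.
Qed.

Let jump_indexE t n om : dwell t n om -> jump_index T t om = n.
Proof. by move=> Dn; apply: xget_unique => // m Dm; exact: (dwell_inj Dm Dn). Qed.

Lemma measurable_jump_index_fun t d' (T' : measurableType d')
    (F : nat -> Omega -> T') : (forall n, measurable_fun setT (F n)) ->
  measurable_fun setT (fun om => F (jump_index T t om) om).
Proof.
move=> mF _ Y mY; rewrite setTI.
have mI n : measurable (F n @^-1` Y) by rewrite -[X in measurable X]setTI; exact: mF.
(* Outside all dwell intervals [jump_index] takes its default value [0], which calls for a separate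
   measurable piece. *)
have -> : (fun om => F (jump_index T t om) om) @^-1` Y =
    \bigcup_n (dwell t n `&` F n @^-1` Y) `|`
    ((~` \bigcup_n dwell t n) `&` F 0%N @^-1` Y).
  apply/seteqP; split => om /=.
    have [[n _ Dn]|nD] := pselect ((\bigcup_n dwell t n) om).
      by rewrite (jump_indexE Dn) => FY; left; exists n.
    rewrite /jump_index xgetPN => [FY|n Dn]; first by right.
    by apply: nD; exists n.
  move=> [[n _ [Dn FY]]|[nD]]; first by rewrite (jump_indexE Dn).
  rewrite /jump_index xgetPN// => n Dn; by apply: nD; exists n.
apply: measurableU; first by apply: bigcupT_measurable => n; exact: measurableI.
apply: measurableI => //; apply: measurableC.
exact: bigcupT_measurable.
Qed.

Definition state_at t om : S :=
  let n := jump_index T t om in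
  Phi (V n om) (t - T n om)%R (path_state n om).

Lemma measurable_state_at_fun t d' (T' : measurableType d')
    (g : velocity -> S -> T') : (forall v, measurable_fun setT (g v)) ->
  measurable_fun setT (fun om => g (rtp_velocity T V t om) (state_at t om)).
Proof.
move=> mg; apply: (@measurable_jump_index_fun t _ _
  (fun n om => g (V n om) (Phi (V n om) (t - T n om)%R (path_state n om)))) => n.
apply: (@measurable_velocity_fun n _ _
  (fun v om => g v (Phi v (t - T n om)%R (path_state n om)))) => v.
apply: (measurableT_comp (mg v)).
apply: (measurableT_comp (mPhi v) (g := fun om => ((t - T n om)%R, path_state n om))).
apply: measurable_fun_pair; last exact: measurable_path_state.
by apply: measurable_funB => //; exact: (jump_time_measurable jp).
Qed.

(** Averaging over the last holding time, which must exceed [t - T n], produces the survival factor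
    of [no_jump]; [n] uses of [expect_step] then bring the expectation back to the starting
    point. *)
Let expect_dwell t g n : gmeas g -> gnneg g ->
  \int[P]_(om in dwell t n) g (rtp_velocity T V t om) (state_at t om) =
  jump_term lam p Phi g t n v0 (0%R, y0).
Proof.
move=> mg g0.
pose F v (zu : Z * measurableTypeR R) : \bar R :=
  if (zu.1.1 <= t < zu.1.1 + zu.2)%R then g v (Phi v (t - zu.1.1)%R zu.1.2) else 0.
have F0 v x : 0 <= F v x by rewrite /F; case: ifP.
have mF v : measurable_fun setT (F v).
  have m11 : measurable_fun setT (fun zu : Z * measurableTypeR R => zu.1.1 : R).
    by apply: (measurableT_comp measurable_fst measurable_fst).
  apply: measurable_fun_ifT => //.
    apply: measurable_and; first exact: measurable_fun_ler.
    by apply: measurable_fun_ltr => //; apply: measurable_funD.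
  apply: (measurableT_comp (mg v)).
  apply: (measurableT_comp (mPhi v)
    (g := fun zu : Z * measurableTypeR R => ((t - zu.1.1)%R, zu.1.2))).
  apply: measurable_fun_pair; first exact: measurable_funB.
  by apply: (measurableT_comp measurable_snd measurable_fst).
transitivity (\int[P]_om F (V n om) (Zn n om, tau n om)).
  rewrite integral_mkcond; apply: eq_integral => om _.
  rewrite patchE /F /Zn /tau/= subrKC.
  have -> : (om \in dwell t n) = (T n om <= t < T n.+1 om)%R.
    by apply/idP/idP; rewrite inE.
  case: ifPn => // Dn.
  by rewrite /state_at /rtp_velocity (@jump_indexE t n om Dn).
rewrite expect_tau//.
transitivity (\int[P]_om no_jump lam Phi g t (V n om) (Zn n om)).
  apply: eq_integral => om _; rewrite /no_jump /F/=.
  case: ifPn => [Tt|_] /=; last exact: integral0.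
  set c := g _ _; set a := (t - T n om)%R.
  have a0 : (0 <= a)%R by rewrite subr_ge0.
  transitivity (\int[expo lam]_(u in `]a, +oo[) cst c u).
    rewrite [RHS]integral_mkcond; apply: eq_integral => u _.
    by rewrite patchE mem_setE in_itv/= andbT ltrBlDl.
  rewrite expo_memoryless//; last by move=> u; exact: g0.
  have c0 (u : R) : 0 <= cst c u by exact: g0.
  have cE : \int[expo lam]_u cst c u = c.
    by rewrite integral_cst// -[RHS]mule1 -(probability_setT (expo lam)).
  rewrite -[in RHS]cE; congr (_ * _).
  exact: (@integral_expo_nneg _ lam (cst c) (measurable_cst _) c0).
rewrite /jump_term.
have := no_jump_ge0 lam Phi t g0; have := measurable_no_jump lam mPhi t mg.
(* The induction runs over an arbitrary [H], because each step replaces it by [jump_op H]. *)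
elim: n (no_jump lam Phi g t) {F F0 mF} => [|n ih] H mH H0.
  rewrite (@integral_V 0)//; last exact: measurable_HZ.
  transitivity (\sum_v ((v == v0)%:R%:E * H v (0%R, y0))); last first.
    rewrite (bigD1 v0)//= eqxx mul1e big1 ?adde0// => v /negbTE ->.
    by rewrite mul0e.
  apply: eq_bigr => v _; rewrite setTI.
  transitivity (\int[P]_(om in V 0 @^-1` [set v]) cst (H v (0%R, y0)) om).
    by apply: eq_integral => om; rewrite inE/= /Zn/= (jump_time0 jp) => ->.
  rewrite integral_cst// muleC; congr (_ * _).
  have := jump_law jp 0%N (fun=> v) (fun i : nat => @measurableT _ R).
  rewrite big_ord0 mulr1 => <-; congr (P _); apply/seteqP.
  by split => om /=; [move=> Vv; split => // i; rewrite leqn0 => /eqP ->|move=> [Vv _];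
    exact: Vv].
rewrite expect_step// ih ?iterSr//; [exact: measurable_jump_op|exact: jump_op_ge0].
Qed.

(** The dwell events are disjoint and [expect_dwell] gives the terms of the series. Their union has
    probability [1], by the same formula for [g = 1] combined with [jump_sum1]. *)
Theorem expectation_state_at t g : (0 <= t)%R -> gmeas g -> gnneg g ->
  \int[P]_om g (rtp_velocity T V t om) (state_at t om) =
  semigroup lam p Phi g t v0 y0.
Proof.
move=> t0 mg g0.
have mD : measurable (\bigcup_n dwell t n) by exact: bigcupT_measurable.
have tD : trivIset setT (dwell t).
  by apply/trivIsetP => n m _ _ /eqP nm; apply/seteqP; split => // om [/dwell_inj h /h].
have bigcupE h : gmeas h -> gnneg h ->
    \int[P]_(om in \bigcup_n dwell t n) h (rtp_velocity T V t om) (state_at t om) =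
    semigroup lam p Phi h t v0 y0.
  move=> mh h0; rewrite ge0_integral_bigcup//.
    by apply: eq_eseriesr => n _; exact: expect_dwell.
  by apply: measurable_funTS; exact: measurable_state_at_fun.
rewrite (@ge0_negligible_integral _ _ _ _ _ (~` \bigcup_n dwell t n))//.
- by rewrite setDE setCK setTI bigcupE.
- exact: measurableC.
- exact: measurable_state_at_fun.
have PD : P (\bigcup_n dwell t n) = 1.
  have := @bigcupE (fun _ _ => 1) (fun=> measurable_cst _) (fun _ _ => lee01).
  rewrite /semigroup jump_sum1//; last 2 first.
  - move=> v; rewrite /jump_prob -mulr_suml.
    by rewrite -[X in (X / _)%R]/(exit_rate q v) q_exit divff.
  - by rewrite /= lexx.
  by have := integral_cst P mD 1; rewrite mul1e => <-.
by have := probability_setC P mD; rewrite PD subee.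
Qed.

End jump_process_law.

(** * Merging of coupled positions *)

Section velocities.
Context {R : realType}.

Lemma big_velocity (T : Type) (idx : T) (op : Monoid.com_law idx)
    (F : velocity -> T) :
  \big[op/idx]_w F w = op (F Neg2) (op (F Zero) (F Pos2)).
Proof.
rewrite (bigD1 Neg2)//= (bigD1 Zero)//= (bigD1 Pos2)//= big1 ?Monoid.mulm1//.
by case.
Qed.

Lemma rtp_rate_ge0 (omega : R) u w : 0 <= omega -> 0 <= rtp_rate omega u w.
Proof. by move=> o0; case: u; case: w => //=; rewrite mulr_ge0. Qed.

Lemma exit_rate_rtp (omega : R) u : exit_rate (rtp_rate omega) u = 2 * omega.
Proof.
by rewrite /exit_rate big_velocity; case: u => /=; rewrite ?addr0 ?add0r// mulrDl !mul1r.
Qed.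

(** The embedded jump chain; it is free of [omega], which enters only through the common exit
    rate. *)
Definition rtp_prob (u w : velocity) : R :=
  match u, w with
  | Pos2, Zero | Neg2, Zero => 1
  | Zero, Pos2 | Zero, Neg2 => 2^-1
  | _, _ => 0
  end.

Lemma jump_prob_rtp (omega : R) : 0 < omega ->
  jump_prob (rtp_rate omega) = rtp_prob.
Proof.
move=> o0; apply/funext => u; apply/funext => w.
rewrite /jump_prob exit_rate_rtp; have o1 : omega != 0 by rewrite gt_eqF.
by case: u; case: w => /=; rewrite ?mul0r//; field.
Qed.

Lemma rtp_prob_ge0 u w : 0 <= rtp_prob u w.
Proof. by case: u; case: w => /=; rewrite ?invr_ge0 ?ler01. Qed.

Lemma sum_rtp_prob u : \sum_w rtp_prob u w = 1.
Proof. by rewrite big_velocity; case: u => /=; rewrite ?addr0 ?add0r//; lra. Qed.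

End velocities.

Section flow.
Context {R : realType} (L : R).
Hypothesis L0 : 0 <= L.
Notation plane := (measurableTypeR R * measurableTypeR R)%type.

Definition rtp_flow (v : velocity) (u x : R) : R := clip L (x + speed v * u).

Lemma clip_itv x : 0 <= clip L x <= L.
Proof. by rewrite /clip le_max lexx/= ge_max L0 ge_min lexx. Qed.

Lemma clip_id x : 0 <= x <= L -> clip L x = x.
Proof. by move=> /andP[x0 xL]; rewrite /clip min_r// max_r. Qed.

Lemma clip_ge x : L <= x -> clip L x = L.
Proof. by move=> Lx; rewrite /clip min_l// max_r. Qed.

Lemma clip_le x : x <= 0 -> clip L x = 0.
Proof. by move=> x0; rewrite /clip max_l// ge_min x0 orbT. Qed.

Lemma le_clip x y : x <= y -> clip L x <= clip L y.
Proof.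
move=> xy; rewrite /clip ge_max le_max lexx/= le_max; apply/orP; right.
by rewrite le_min !ge_min lexx xy orbT.
Qed.

Lemma rtp_flow_itv v u x : 0 <= rtp_flow v u x <= L.
Proof. exact: clip_itv. Qed.

Lemma le_rtp_flow v u x y : x <= y -> rtp_flow v u x <= rtp_flow v u y.
Proof. by move=> xy; apply: le_clip; rewrite lerD2r. Qed.

(** At constant velocity a particle that reaches a wall stays there, so clipping midway and clipping
    once at the end agree. *)
Lemma rtp_flowD v u s x : 0 <= u -> 0 <= s -> 0 <= x <= L ->
  rtp_flow v s (rtp_flow v u x) = rtp_flow v (u + s) x.
Proof.
move=> u0 s0 /andP[x0 xL]; rewrite /rtp_flow mulrDr addrA.
case: v => /=; last 1 first.
- have [Lx|/ltW xuL] := leP L (x + 2 * u).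
    by rewrite (clip_ge Lx) (@clip_ge (L + _)) 1?(@clip_ge (_ + _ + _))//; lra.
  by rewrite (@clip_id (x + 2 * u))// xuL andbT addr_ge0// mulr_ge0.
- have [xu0|/ltW xu0] := leP (x + - 2 * u) 0.
    by rewrite (clip_le xu0) (@clip_le (0 + _)) 1?(@clip_le (_ + _ + _))//; lra.
  by rewrite (@clip_id (x + - 2 * u))// xu0/=; lra.
by rewrite !mul0r !addr0 !clip_id// x0.
Qed.

Lemma measurable_rtp_flow v : measurable_fun setT
  (fun z : plane => rtp_flow v z.1 z.2 : measurableTypeR R).
Proof.
apply: measurable_maxr => //; apply: measurable_minr => //.
apply: measurable_funD; first by apply: measurable_snd.
by apply: measurable_funM => //; apply: measurable_fst.
Qed.

Definition pair_flow (v : velocity) (u : R) (x : R * R) : R * R :=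
  (rtp_flow v u x.1, rtp_flow v u x.2).

Lemma measurable_pair_flow v : measurable_fun setT
  (fun z : measurableTypeR R * plane =>
    pair_flow v z.1 z.2 : plane).
Proof.
apply: measurable_fun_pair.
  apply: (measurableT_comp (measurable_rtp_flow v)
    (g := fun z : measurableTypeR R * plane => (z.1, z.2.1))).
  apply: measurable_fun_pair => //.
  exact: (measurableT_comp measurable_fst measurable_snd).
apply: (measurableT_comp (measurable_rtp_flow v)
  (g := fun z : measurableTypeR R * plane => (z.1, z.2.2))).
apply: measurable_fun_pair => //.
exact: (measurableT_comp measurable_snd measurable_snd).
Qed.

End flow.

(** * Integrals of exponentials times polynomials *)

Section exponential_integrals.
Local Open Scope ereal_scope.
Context {R : realType}.
Notation leb := (@lebesgue_measure R).

Lemma integral_is_derive (F f : R -> R) (a b : R) : (a <= b)%R ->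
  (forall x, is_derive x (1%R : R) F (f x)) -> continuous f ->
  \int[leb]_(x in `[a, b]) (f x)%:E = (F b - F a)%:E.
Proof.
rewrite le_eqVlt => /predU1P[<- _ _|ab dF cf].
  by rewrite set_itv1 integral_set1 subrr.
rewrite EFinB; apply: continuous_FTC2 => //.
- exact: continuous_subspaceT.
- split.
  + by move=> x _; have [] := dF x.
  + apply: cvg_at_right_filter; apply: differentiable_continuous.
    by apply/derivable1_diffP; have [] := dF a.
  + apply: cvg_at_left_filter; apply: differentiable_continuous.
    by apply/derivable1_diffP; have [] := dF b.
- by move=> x _; rewrite derive1E; have [] := dF x.
Qed.

Lemma is_derive_expRM (k x : R) :
  is_derive x (1%R : R) (fun u => expR (k * u))%R (k * expR (k * x))%R.
Proof.
rewrite mulrC; apply: (@is_derive1_comp R expR ( *%R k)).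
have -> : ( *%R k : R -> R) = (k \*: (@id R))%R by apply/funext.
by apply: is_derive_eq; rewrite /GRing.scale/= mulr1.
Qed.

(** The integrand is the derivative of [- (expR (- k * u) * p.[u])], so an inequality on
    [k * p - p'] along a free flight integrates to a difference of end values. *)
Lemma integral_expR_poly (k : R) (p : {poly R}) (a b : R) : (a <= b)%R ->
  \int[leb]_(u in `[a, b]) (expR (- k * u) * (k * p.[u] - p^`().[u]))%:E =
  (expR (- k * a) * p.[a] - expR (- k * b) * p.[b])%:E.
Proof.
move=> ab; pose F u : R := (- (expR (- k * u) * p.[u]))%R.
pose f u : R := (expR (- k * u) * (k * p.[u] - p^`().[u]))%R.
have dF x : is_derive x (1%R : R) F (f x).
  have -> : f x = (- (expR (- k * x) * p^`().[x] + p.[x] * (- k * expR (- k * x))))%R by rewrite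
    /f; ring.
  apply: (@is_deriveN _ _ _ (fun u => expR (- k * u) * p.[u])%R).
  apply: (@is_deriveM _ _ (fun u => expR (- k * u))%R (fun u => p.[u])%R).
  - exact: is_derive_expRM.
  - exact: is_derive_poly.
have cE : continuous (fun u : R => expR (- k * u) : R).
  by move=> x; apply: continuous_comp; [exact: mulrl_continuous|exact: continuous_expR].
have cp : continuous (fun u : R => k * p.[u] - p^`().[u] : R)%R.
  move=> x; apply: cvgB; last exact: continuous_horner.
  by apply: cvgM; [exact: cvg_cst|exact: continuous_horner].
have cf : continuous f by move=> x; apply: cvgM; [exact: cE|exact: cp].
rewrite (integral_is_derive ab dF cf); congr EFin; rewrite /F; ring.
Qed.

End exponential_integrals.

(** * A Lyapunov function for the larger of two coupled positions *)

Section merging.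
Local Open Scope ereal_scope.
Context {R : realType} (omega L : {posnum R}).
Notation w := (omega%:num).
Notation l := (L%:num).
Notation leb := (@lebesgue_measure R).
Notation plane := (measurableTypeR R * measurableTypeR R)%type.

Definition jump_rate : {posnum R} := (2 * omega%:num)%:pos%R.

(** [merge_const] bounds [lyap] on the interval, and [merge_rate] is tuned so that their product is
    [w / 2], the weakest decrease of [lyap] under the generator. *)
Definition merge_rate : R := (w / (10 * (1 + (w * l) ^+ 2)))%R.
Definition merge_const : R := (5 * (1 + (w * l) ^+ 2))%R.

Notation r := merge_rate.
Notation lam := jump_rate.

(* A supersolution of [r h + G h <= 0], where [G] is the generator of the
   process killed when it first hits [0] with velocity [-2]. *)
Definition lyap_poly (v : velocity) : {poly R} :=
  match v with
  | Zero => (w * l + 5 / 2)%:P + (w ^+ 2 * l + w) *: 'X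
  | Pos2 => (2 * w * l + 7 / 2)%:P + (w ^+ 2 * l) *: 'X
  | Neg2 => 1%:P + (w ^+ 2 * l + 2 * w) *: 'X
  end - (w ^+ 2 / 2) *: 'X^2.

Definition lyap v x := (lyap_poly v).[x].

Lemma lyap_polyE v x : lyap v x =
  (match v with
  | Zero => (w * l + 5 / 2) + (w ^+ 2 * l + w) * x
  | Pos2 => (2 * w * l + 7 / 2) + (w ^+ 2 * l) * x
  | Neg2 => 1 + (w ^+ 2 * l + 2 * w) * x
  end - (w ^+ 2 / 2) * x ^+ 2)%R.
Proof. by rewrite /lyap /lyap_poly; case: v; rewrite !hornerE. Qed.

Lemma lyap_derivE v x : (lyap_poly v)^`().[x] =
  (match v with
  | Zero => w ^+ 2 * l + w
  | Pos2 => w ^+ 2 * l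
  | Neg2 => w ^+ 2 * l + 2 * w
  end - w ^+ 2 * x)%R.
Proof.
rewrite /lyap_poly; case: v; rewrite !(derivB, derivD, derivC, derivZ, derivX, derivXn)/=
  ?hornerE;
  by field.
Qed.

Let mono_ge0 x : (0 <= x <= l -> 0 <= w ^+ 2 * l * x - w ^+ 2 / 2 * x ^+ 2)%R.
Proof.
move=> /andP[x0 xl].
have -> : (w ^+ 2 * l * x - w ^+ 2 / 2 * x ^+ 2 = w ^+ 2 / 2 * (x * (l + (l - x))))%R by field.
apply: mulr_ge0; first by rewrite divr_ge0// sqr_ge0.
by rewrite mulr_ge0// addr_ge0// subr_ge0.
Qed.

Lemma lyap_ge1 v x : (0 <= x <= l -> 1 <= lyap v x)%R.
Proof.
move=> xl; have := mono_ge0 xl; have /andP[x0 _] := xl.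
have w0 : (0 < w)%R by []. have l0 : (0 < l)%R by [].
have wl0 : (0 < w * l)%R by rewrite mulr_gt0.
have wx0 : (0 <= w * x)%R by rewrite mulr_ge0.
by rewrite lyap_polyE; case: v; lra.
Qed.

Lemma lyap_le v x : (0 <= x <= l -> lyap v x <= merge_const)%R.
Proof.
move=> xl; have /andP[x0 xL] := xl.
have w0 : (0 < w)%R by []. have l0 : (0 < l)%R by [].
have wl0 : (0 < w * l)%R by rewrite mulr_gt0.
have wxl : (w * x <= w * l)%R by rewrite ler_pM2l.
have m0 : (w ^+ 2 * l * x - w ^+ 2 / 2 * x ^+ 2 <= (w * l) ^+ 2 / 2)%R.
  have : (0 <= (w * (l - x)) ^+ 2)%R by rewrite sqr_ge0.
  rewrite !expr2; nra.
(* The terms linear in [w * l] are absorbed through [2 * (w * l) <= 1 + (w * l) ^+ 2]. *)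
have sq : (0 <= (w * l - 1) ^+ 2)%R by rewrite sqr_ge0.
by rewrite lyap_polyE /merge_const; case: v; nra.
Qed.

Lemma merge_rate_gt0 : (0 < r)%R.
Proof. by rewrite /merge_rate divr_gt0// mulr_gt0// ltr_pwDl// sqr_ge0. Qed.

Lemma merge_const_gt0 : (0 < merge_const)%R.
Proof. by rewrite mulr_gt0// ltr_pwDl// sqr_ge0. Qed.

Let r_const : (r * merge_const = w / 2)%R.
Proof.
rewrite /merge_rate /merge_const; have : (0 < 1 + (w * l) ^+ 2)%R by rewrite ltr_pwDl// sqr_ge0.
by move=> D0; field; rewrite gt_eqF.
Qed.

Let r_lyap v x : (0 <= x <= l -> r * lyap v x <= w / 2)%R.
Proof.
by move=> xl; rewrite -r_const; apply: ler_wpM2l; [exact/ltW/merge_rate_gt0|exact: lyap_le].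
Qed.

(** Jumps at rate [2 * w], set against the factor [expR (r * u)] from the remaining time, leave the
    net exponent [k]. *)
Let k : R := (2 * w - r)%R.

Let r_le : (r <= w / 10)%R.
Proof.
rewrite /merge_rate ler_pM2l// lef_pV2 ?posrE ?mulr_gt0 ?ltr_pwDl ?sqr_ge0//.
by rewrite ler_peMr// lerDl sqr_ge0.
Qed.

Let k_gt0 : (0 < k)%R.
Proof. by have := r_le; have w0 : (0 < w)%R by []; rewrite /k; lra. Qed.

Let Q v x : R := \sum_u rtp_prob v u * lyap u x.

Let QE v x : Q v x = match v with
  | Zero => (2^-1 * lyap Neg2 x + 2^-1 * lyap Pos2 x)%R
  | _ => lyap Zero x
  end.
Proof.
by rewrite /Q big_velocity; case: v => /=; rewrite ?(mul0r, mul1r, add0r, addr0).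
Qed.

Let Q_ge0 v x : (0 <= x <= l -> 0 <= Q v x)%R.
Proof.
move=> xl; apply: sumr_ge0 => u _; rewrite mulr_ge0 ?rtp_prob_ge0//.
exact: le_trans (lyap_ge1 u xl).
Qed.

(** For [Neg2], [Zero] and [Pos2] the drift [speed v * h' + 2 * w * (Q - h)] of [h = lyap] is [- w],
    [- w / 2] and [- 2 * w]: the coefficients are chosen so that all terms in [x] and [l] cancel. As
    [r * h <= w / 2], the drift is at most [- r * h]. *)
Let generator v x : (0 <= x <= l ->
  2 * w * Q v x <= k * lyap v x - speed v * (lyap_poly v)^`().[x])%R.
Proof.
move=> xl; have := r_lyap v xl; have w0 : (0 < w)%R by [].
by rewrite QE /k mulrBl lyap_derivE !lyap_polyE; case: v => /=; nra.
Qed.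

(** A particle pressed against the wall [l] has no transport term; there the jump part alone equals
    [- 2 * w]. *)
Let generator_wall : (2 * w * Q Pos2 l <= k * lyap Pos2 l)%R.
Proof.
have ll : (0 <= l <= l)%R by rewrite lexx ltW.
have := r_lyap Pos2 ll; have w0 : (0 < w)%R by [].
by rewrite QE /k mulrBl !lyap_polyE; nra.
Qed.

(** The jump density times [expR (- r * (a - u))] equals [2 * w * expR (- r * a) * expR (- k * u)],
    so the hypothesis on [p] bounds the integrand by an exact derivative. *)
Let piece (p : {poly R}) (f : R -> R) a b c : (b <= c)%R ->
  measurable_fun setT f -> (forall u, b <= u <= c -> 0 <= f u)%R ->
  (forall u, b <= u <= c -> 2 * w * f u <= k * p.[u] - p^`().[u])%R ->
  \int[leb]_(u in `[b, c]) ((lam%:num * expR (- lam%:num * u))%:E *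
    (expR (- r * (a - u)) * f u)%:E) <=
  (expR (- r * a) * (expR (- k * b) * p.[b] - expR (- k * c) * p.[c]))%:E.
Proof.
move=> bc mf f0 fp.
have dens0 u : (0 <= lam%:num * expR (- lam%:num * u))%R by rewrite mulr_ge0// expR_ge0.
have me (s t : R) : measurable_fun setT (fun u : R => expR (s * (t - u))%R : R).
  by apply: measurableT_comp => //; apply: measurable_funM => //; exact: measurable_funB.
have me0 (s : R) : measurable_fun setT (fun u : R => expR (s * u)%R : R).
  by apply: measurableT_comp => //; exact: measurable_funM.
have mp (s : {poly R}) : measurable_fun setT (fun u : R => s.[u]).
  by apply: continuous_measurable_fun; exact: continuous_horner.
have mb : measurable_fun setT
    (fun u : R => (expR (- k * u) * (k * p.[u] - p^`().[u]))%R : R).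
  by apply: measurable_funM => //; apply: measurable_funB => //; exact: measurable_funM.
have md : measurable_fun setT (fun u : R => (lam%:num * expR (- lam%:num * u))%R : R).
  exact: measurable_funM.
have mrf : measurable_fun setT (fun u : R => (expR (- r * (a - u)) * f u)%R : R).
  by apply: measurable_funM => //; exact: me.
have eE u : (lam%:num * expR (- lam%:num * u) * (expR (- r * (a - u)) * f u) =
    expR (- r * a) * (expR (- k * u) * (2 * w * f u)))%R.
  have -> : (- k * u = - lam%:num * u + r * u)%R by rewrite /k/=; ring.
  have -> : (- r * (a - u) = - r * a + r * u)%R by ring.
  by rewrite !expRD /=; ring.
have b0 u : (b <= u <= c -> 0 <= expR (- k * u) * (k * p.[u] - p^`().[u]))%R.
  move=> bu; rewrite mulr_ge0 ?expR_ge0// (le_trans _ (fp _ bu))//.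
  by rewrite !mulr_ge0// f0.
rewrite EFinM -integral_expR_poly// -ge0_integralZl_EFin ?expR_ge0//; last first.
  by apply: measurable_funTS; exact/measurable_EFinP.
apply: ge0_le_integral => //.
- move=> u /=; rewrite in_itv/= => bu; rewrite -EFinM lee_fin mulr_ge0//.
  by rewrite mulr_ge0 ?expR_ge0 ?f0.
- apply: measurable_funTS; apply: emeasurable_funM; apply/measurable_EFinP.
    exact: md.
  exact: mrf.
- apply: measurable_funTS; apply: emeasurable_funM; apply/measurable_EFinP => //.
- move=> u /=; rewrite in_itv/= => bu; rewrite -!EFinM lee_fin eE.
  by rewrite ler_wpM2l ?expR_ge0// ler_wpM2l ?expR_ge0// fp.
Qed.

Definition unmerged (_ : velocity) (y : plane) : \bar R :=
  if y.1 == y.2 then 0 else 1.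

(** Only the second position, the larger one in use, enters; it is clipped to make [super]
    nonnegative on the whole plane. Merged pairs get [0] because they never separate. *)
Let super (a : R) (v : velocity) (y : plane) : \bar R :=
  if y.1 == y.2 then 0 else (expR (- r * a) * lyap v (clip l y.2))%:E.

Let l0 : (0 <= l)%R. Proof. by []. Qed.

Let measurable_lyap_clip v : measurable_fun setT (fun x : R => lyap v (clip l x)).
Proof.
apply: (measurableT_comp (f := fun x : R => lyap v x)).
  by apply: continuous_measurable_fun; exact: continuous_horner.
by apply: measurable_maxr => //; exact: measurable_minr.
Qed.

Lemma measurable_unmerged v : measurable_fun setT (unmerged v).
Proof. by apply: measurable_fun_ifT => //; exact: measurable_fun_eqr. Qed.

Let measurable_super v : measurable_fun setT
  (fun z : measurableTypeR R * plane => super z.1 v z.2).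
Proof.
have m21 : measurable_fun setT
    (fun z : measurableTypeR R * plane => z.2.1 : R).
  by apply: (measurableT_comp measurable_fst measurable_snd).
have m22 : measurable_fun setT
    (fun z : measurableTypeR R * plane => z.2.2 : R).
  by apply: (measurableT_comp measurable_snd measurable_snd).
apply: measurable_fun_ifT => //; first exact: measurable_fun_eqr.
apply/measurable_EFinP; apply: measurable_funM.
  apply: measurableT_comp => //; apply: measurable_funM => //.
exact: (measurableT_comp (measurable_lyap_clip v) m22).
Qed.

Let super_ge0 a v y : 0 <= super a v y.
Proof.
rewrite /super; case: ifP => // _; rewrite lee_fin mulr_ge0 ?expR_ge0//.
by apply: le_trans (lyap_ge1 _ _); rewrite ?clip_itv.
Qed.

Theorem unmerged_le t v x x' : (0 <= t)%R -> (0 <= x)%R -> (x <= x')%R -> (x' <= l)%R ->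
  semigroup lam rtp_prob (pair_flow l) unmerged t v (x, x') <=
  (merge_const * expR (- r * t))%:E.
Proof.
move=> t0 x0 xx' x'l.
apply: (@le_trans _ _ (super t v (x, x'))); last first.
  rewrite /super/=; case: ifP => _;
    first by rewrite lee_fin mulr_ge0 ?expR_ge0// ltW// merge_const_gt0.
  by rewrite lee_fin mulrC ler_wpM2r ?expR_ge0// lyap_le// clip_itv.
pose B (y : plane) := (0 <= y.1 /\ y.1 <= y.2 /\ y.2 <= l)%R.
apply: (@semigroup_le_super _ _ _ lam rtp_prob (pair_flow l) _ _ B) => //.
- exact: rtp_prob_ge0.
- exact: measurable_pair_flow.
- exact: measurable_unmerged.
- by move=> ? ?; rewrite /unmerged; case: ifP.
- move=> {}v u [z z'] u0 [z0 [zz' z'l]] /=; split; [|split] => /=.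
  + by have /andP[] := rtp_flow_itv l0 v u z.
  + exact: le_rtp_flow.
  + by have /andP[] := rtp_flow_itv l0 v u z'.
move=> {t0 x0 xx' x'l x x' t v} a v [x x'] a0 [/= x0 [xx' x'l]].
have [<-{x' xx' x'l}|xNx'] := eqVneq x x'.
  rewrite /unmerged /super/= !eqxx mule0 add0e integral0_eq// => u _.
  by rewrite big1 ?mule0// => w' _; rewrite eqxx mule0.
have x'0 : (0 <= x')%R by exact: le_trans xx'.
rewrite {2}/super/= (negbTE xNx') clip_id ?x'0//.
set F := fun u : R => (lam%:num * expR (- lam%:num * u))%:E *
  \sum_w0 (rtp_prob v w0)%:E * super (a - u)%R w0 (pair_flow l v u (x, x')).
have mF : measurable_fun setT F.
  exact: (measurable_super_int lam _ (@measurable_pair_flow R l) a v (x, x') measurable_super).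
have dens0 u : (0 <= lam%:num * expR (- lam%:num * u))%R by rewrite mulr_ge0// expR_ge0.
have F0 u : 0 <= F u.
  rewrite /F mule_ge0 ?lee_fin// sume_ge0// => w' _.
  by rewrite mule_ge0 ?lee_fin ?rtp_prob_ge0.
pose I b c := \int[leb]_(u in `[b, c]) F u.
have splitI b : (0 <= b <= a)%R -> I 0%R a <= I 0%R b + I b a.
  move=> /andP[b0 ba]; rewrite /I (@itv_bndbnd_setU _ _ (BLeft 0%R) (BRight b) (BRight a))
    ?bnd_simp//.
  rewrite ge0_integral_setU//=; last 2 first.
  - exact: measurable_funTS.
  - exact: disjoint_adjacent_itv.
  apply: leeD2l; apply: ge0_subset_integral => //; first exact: measurable_funTS.
  by move=> u /=; rewrite !in_itv/= => /andP[/ltW-> ->].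
(* After the jump the pair is treated as if still unmerged, which only increases the bound. *)
have leF u : (0 <= u)%R -> F u <= (lam%:num * expR (- lam%:num * u))%:E *
    (expR (- r * (a - u)) * Q v (rtp_flow l v u x'))%:E.
  move=> u0; rewrite /F lee_wpmul2l ?lee_fin//.
  rewrite /Q mulr_sumr -sumEFin; apply: lee_sum => w' _.
  rewrite mulrCA EFinM lee_wpmul2l ?lee_fin ?rtp_prob_ge0//.
  rewrite /super/=; case: ifP => _; rewrite lee_fin.
    by rewrite mulr_ge0 ?expR_ge0// (le_trans _ (lyap_ge1 _ _))// rtp_flow_itv.
  by rewrite clip_id ?rtp_flow_itv.
have mQ : measurable_fun setT (fun u : R => Q v (rtp_flow l v u x')).
  apply: measurable_sum => w'; apply: measurable_funM => //.
  apply: (measurableT_comp (measurable_lyap_clip w')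
    (g := fun u : R => (x' + speed v * u)%R)).
  by apply: measurable_funD => //; exact: measurable_funM.
have leI (p : {poly R}) b c : (0 <= b)%R -> (b <= c)%R ->
    (forall u, b <= u <= c -> 2 * w * Q v (rtp_flow l v u x') <= k * p.[u] - p^`().[u])%R ->
    I b c <= (expR (- r * a) * (expR (- k * b) * p.[b] - expR (- k * c) * p.[c]))%:E.
  move=> b0 bc Qp; apply: le_trans (piece a bc mQ _ Qp); last first.
    by move=> u _; rewrite Q_ge0// rtp_flow_itv.
  apply: ge0_le_integral => //.
  - exact: measurable_funTS.
  - apply: measurable_funTS; apply: emeasurable_funM; apply/measurable_EFinP.
      by apply: measurable_funM => //; apply: measurableT_comp => //; exact: measurable_funM.
    apply: measurable_funM => //; apply: measurableT_comp => //.
    by apply: measurable_funM => //; exact: measurable_funB.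
  - by move=> u /=; rewrite in_itv/= => /andP[bu _]; apply: leF; exact: le_trans bu.
(* During a free flight the polynomial is [lyap v] composed with the straight path of the larger
   position, so [generator] supplies the hypothesis of [leI]. *)
have transport b c : (0 <= b)%R -> (b <= c)%R ->
    (forall u, b <= u <= c -> 0 <= x' + speed v * u <= l)%R ->
    I b c <= (expR (- r * a) * (expR (- k * b) * lyap v (x' + speed v * b) -
                                expR (- k * c) * lyap v (x' + speed v * c)))%:E.
  move=> b0 bc inl; pose q : {poly R} := (x'%:P + speed v *: 'X)%R.
  have qE u : q.[u] = (x' + speed v * u)%R by rewrite !hornerE.
  have := leI (lyap_poly v \Po q) b c b0 bc; rewrite !horner_comp !qE; apply => u bu.
  rewrite deriv_comp hornerM !horner_comp qE.
  have -> : q^`().[u] = speed v.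
    by rewrite derivD derivC derivZ derivX add0r !hornerE.
  rewrite {1}/rtp_flow clip_id ?inl// [X in (_ <= _ - X)%R]mulrC; apply: generator.
  exact: inl.
have k0 : (0 <= k)%R by exact: ltW k_gt0.
have eD : (expR (- (2 * w) * a) = expR (- r * a) * expR (- k * a))%R.
  by rewrite -expRD; congr expR; rewrite /k; ring.
have ek1 : (expR (- k * a) <= 1)%R by rewrite expR_le1 mulNr oppr_le0 mulr_ge0.
have nj : unmerged v (pair_flow l v a (x, x')) <= 1 by rewrite /unmerged; case: ifP.
(* The path without a jump has probability [expR (- r * a) * expR (- k * a)]; the end value left by
   the integration, with [Y >= 1], absorbs it. *)
have close (Y : R) : (1 <= Y)%R ->
    I 0%R a <= (expR (- r * a) * (lyap v x' - expR (- k * a) * Y))%:E ->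
    (expR (- (2 * w) * a))%:E * unmerged v (pair_flow l v a (x, x')) + I 0%R a <=
    (expR (- r * a) * lyap v x')%:E.
  move=> Y1 IY; apply: (@le_trans _ _ ((expR (- (2 * w) * a))%:E + (expR (- r * a) * (lyap v x' -
    expR (- k * a) * Y))%:E)).
    by apply: leeD => //; rewrite -[leRHS]mule1 lee_wpmul2l// lee_fin expR_ge0.
  rewrite -EFinD lee_fin eD mulrBr addrCA gerDl subr_le0.
  by rewrite ler_wpM2l ?expR_ge0// ler_peMr// expR_ge0.
have inside : (forall u, 0 <= u <= a -> 0 <= x' + speed v * u <= l)%R ->
    (expR (- (2 * w) * a))%:E * unmerged v (pair_flow l v a (x, x')) + I 0%R a <=
    (expR (- r * a) * lyap v x')%:E.
  move=> inl; apply: (close (lyap v (x' + speed v * a))).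
    by apply: lyap_ge1; apply: inl; rewrite lexx a0.
  by have := transport 0%R a (lexx _) a0 inl; rewrite !mulr0 expR0 mul1r addr0.
have [/inside//|] := pselect (forall u, 0 <= u <= a -> 0 <= x' + speed v * u <= l)%R.
move=> wall; destruct v; rewrite /= in wall; rewrite -/(I 0%R a).
(* The larger position meets [0] at time [b]; the smaller one, squeezed below it, is there too, so
   the pair has merged and nothing remains after [b]. *)
- pose b : R := (x' / 2)%R; have b0 : (0 <= b)%R by rewrite divr_ge0.
  have ba : (b <= a)%R.
    rewrite leNgt; apply/negP => ab; apply: wall => u /andP[u0 ua].
    by move: ab; rewrite /b => ab; apply/andP; split; lra.
  have flow0 u : (b <= u)%R -> pair_flow l Neg2 u (x, x') = (0, 0)%R.
    by rewrite /b => bu; congr pair; rewrite /rtp_flow/= clip_le//; lra.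
  rewrite flow0// /unmerged/= eqxx mule0 add0e.
  have Iba0 : I b a = 0.
    rewrite /I; apply: integral0_eq => u /=; rewrite in_itv/= => /andP[bu _].
    rewrite /F big1 ?mule0// => w' _.
    by rewrite flow0// /super/= eqxx mule0.
  apply: (le_trans (splitI b _)); first by rewrite b0.
  rewrite Iba0 adde0; apply: (le_trans (transport 0%R b (lexx _) b0 _)).
    by move=> u /andP[u0]; rewrite /b/= => ub; apply/andP; split; lra.
  rewrite lee_fin ler_wpM2l ?expR_ge0// !mulr0 expR0 mul1r addr0 gerBl.
  rewrite mulr_ge0 ?expR_ge0// (le_trans _ (lyap_ge1 _ _))// /b/=.
  by apply/andP; split; lra.
- by exfalso; apply: wall => u _; rewrite mul0r addr0 x'0.
(* Reaching [l] need not merge the pair. After [b] the larger position rests at the wall, and a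
   constant polynomial with [generator_wall] replaces the free flight. *)
- pose b : R := ((l - x') / 2)%R; have b0 : (0 <= b)%R by rewrite divr_ge0// subr_ge0.
  have ba : (b <= a)%R.
    rewrite leNgt; apply/negP => ab; apply: wall => u /andP[u0 ua].
    by move: ab; rewrite /b => ab; apply/andP; split; lra.
  have flowl u : (b <= u)%R -> rtp_flow l Pos2 u x' = l.
    by rewrite /b => bu; rewrite /rtp_flow/= clip_ge//; lra.
  have ll : (0 <= l <= l)%R by rewrite lexx andbT.
  apply: (close (lyap Pos2 l)); first exact: lyap_ge1.
  apply: (le_trans (splitI b _)); first by rewrite b0.
  have -> : (expR (- r * a) * (lyap Pos2 x' - expR (- k * a) * lyap Pos2 l) =
     expR (- r * a) * (lyap Pos2 x' - expR (- k * b) * lyap Pos2 l) +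
     expR (- r * a) * (expR (- k * b) * lyap Pos2 l - expR (- k * a) * lyap Pos2 l))%R by ring.
  rewrite EFinD; apply: leeD.
    have := transport 0%R b (lexx _) b0; rewrite /= !mulr0 expR0 mul1r addr0.
    have -> : (x' + 2 * b = l)%R by rewrite /b; field.
    by apply => u /andP[u0]; rewrite /b/= => ub; apply/andP; split; lra.
  have := leI (lyap Pos2 l)%:P%R b a b0 ba; rewrite !hornerC; apply => u /andP[bu _].
  by rewrite flowl// derivC !hornerC subr0; exact: generator_wall.
Qed.

End merging.

(** * Relaxation of the velocity *)

Section velocity_decay.
Local Open Scope ereal_scope.
Context {R : realType} dS (S : measurableType dS) (lam : {posnum R}).
Variable Phi : velocity -> R -> S -> S.
Hypothesis mPhi : forall v,
  measurable_fun setT (fun z : measurableTypeR R * S => Phi v z.1 z.2).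
Notation leb := (@lebesgue_measure R).

(* Eigenfunctions of the generator of the velocity process, for the
   eigenvalues [- lam] and [- 2 lam]. *)
Definition odd_mode (v : velocity) : R :=
  match v with Neg2 => -1 | Zero => 0 | Pos2 => 1 end.
Definition even_mode (v : velocity) : R :=
  match v with Zero => -1 | _ => 1 end.

Variables (m a b : R).

Definition velocity_mean (t : R) (v : velocity) : R :=
  m + a * expR (- lam%:num * t) * odd_mode v
    + b * expR (- (2 * lam%:num) * t) * even_mode v.

Let abs_odd v : (`|odd_mode v| <= 1)%R.
Proof. by case: v; rewrite /= ?normrN ?normr0 ?normr1. Qed.

Let abs_even v : (`|even_mode v| <= 1)%R.
Proof. by case: v; rewrite /= ?normrN ?normr1. Qed.

(** One jump averages [odd_mode] to [0] and reverses the sign of [even_mode]. *)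
Let sum_mean t v : \sum_w (rtp_prob v w)%:E * (velocity_mean t w)%:E =
  (m - b * expR (- (2 * lam%:num) * t) * even_mode v)%:E.
Proof.
under eq_bigr do rewrite -EFinM; rewrite sumEFin big_velocity; congr EFin.
by rewrite /velocity_mean; case: v => /=; field.
Qed.

Hypothesis m_ge : (`|a| + `|b| <= m)%R.

Let mean_ge0 t v : (0 <= t)%R -> (0 <= velocity_mean t v)%R.
Proof.
move=> t0; have e1 (k : R) : (0 < k)%R -> (`|expR (- k * t)| <= 1)%R.
  by move=> k0; rewrite ger0_norm ?expR_ge0// expR_le1 mulNr oppr_le0 mulr_ge0// ltW.
have h (c k : R) (s : R) : (0 < k)%R -> (`|s| <= 1)%R -> (- `|c| <= c * expR (- k * t) * s)%R.
  move=> k0 s1; rewrite lerNl (le_trans (ler_norm _))// normrN -mulrA normrM ler_piMr//.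
  by rewrite normrM mulr_ile1// e1.
have := h a lam%:num (odd_mode v); have := h b (2 * lam%:num)%R (even_mode v).
rewrite /velocity_mean; move: m_ge => + /(_ _ (abs_even v)) h1 /(_ _ (abs_odd v)) h2.
have la0 : (0 < lam%:num)%R by []. by have := h1 (mulr_gt0 (ltr0Sn _ 1) la0); have := h2 la0; lra.
Qed.

(** [velocity_mean] solves the renewal equation exactly, and comparison turns this into one
    inequality. The constant [m] supplies the nonnegativity that comparison requires; the reverse
    bound comes later from changing the sign of the modes. *)
Lemma semigroup_velocity_mean t v y : (0 <= t)%R ->
  semigroup lam rtp_prob Phi (fun w _ => (velocity_mean 0 w)%:E) t v y <=
  (velocity_mean t v)%:E.
Proof.
move=> t0.
(* Comparison asks for nonnegativity at all real times, hence the replacement of negative ones by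
   [0]. *)
pose h (s : R) (w : velocity) (_ : S) := (velocity_mean (Num.max 0%R s) w)%:E.
have -> : (velocity_mean t v)%:E = h t v y by rewrite /h max_r.
have me (k : R) : measurable_fun setT (fun u : R => expR (k * u)%R : R).
  by apply: measurableT_comp => //; exact: measurable_funM.
apply: (@semigroup_le_super _ _ _ lam rtp_prob Phi _ _ setT) => //.
- exact: rtp_prob_ge0.
- by move=> w z; rewrite lee_fin mean_ge0.
- move=> w; apply/measurable_EFinP.
  have mmax : measurable_fun setT (fun z : measurableTypeR R * S => Num.max 0%R z.1 : R).
    by apply: measurable_maxr => //; apply: measurable_fst.
  apply: measurable_funD; [apply: measurable_funD => //|];
    apply: measurable_funM => //; apply: measurable_funM => //;
    exact: (measurableT_comp (me _) mmax).
- by move=> s w z; rewrite lee_fin mean_ge0// le_max lexx.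
move=> {t0 t y v} t v y t0 _; rewrite /h max_r//.
pose K : R := (b * even_mode v)%R; pose la := lam%:num.
(* Antiderivative of the jump density times [sum_mean] at time [t - u], where the two exponentials
   in [u] combine to a single [expR (la * u)]. *)
pose F (u : R) : R := (- (m * expR (- la * u)) - K * expR (- (2 * la) * t) * expR (la * u))%R.
pose f (u : R) : R := (la * m * expR (- la * u) - K * expR (- (2 * la) * t) * (la * expR (la *
  u)))%R.
have dF x : is_derive x (1%R : R) F (f x).
  have d1 := is_derive_expRM (- la) x; have d2 := is_derive_expRM la x.
  have fE : f x = (- (m *: (- la * expR (- la * x))) -
      (K * expR (- (2 * la) * t)) *: (la * expR (la * x)))%R.
    by rewrite /f /GRing.scale/=; ring.
  rewrite fE; exact: is_deriveB (is_deriveN (is_deriveZ m d1)) (is_deriveZ (K * expR (- (2 * la)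
    * t)) d2).
have cE (k : R) : continuous (fun u : R => expR (k * u) : R).
  by move=> x; apply: continuous_comp; [exact: mulrl_continuous|exact: continuous_expR].
have cf : continuous f.
  move=> x; apply: cvgB; apply: cvgM; [exact: cvg_cst|exact: cE|exact: cvg_cst|].
  by apply: cvgM; [exact: cvg_cst|exact: cE].
rewrite (_ : \int[leb]_(u in `[0%R, t]) _ = (F t - F 0)%:E); last first.
  rewrite -(integral_is_derive t0 dF cf); apply: eq_integral => u.
  rewrite inE/= in_itv/= => /andP[u0 ut]; rewrite max_r ?subr_ge0// sum_mean -EFinM; congr EFin.
  rewrite /f /K -/la (_ : - (2 * la) * (t - u) = - (2 * la) * t + (la * u + la * u))%R;
    last by ring.
  rewrite !expRD mulrBr; congr (_ - _)%R; first by ring.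
  have e : (expR (- la * u) * expR (la * u) = 1)%R by rewrite -expRD mulNr addNr expR0.
  have -> : (la * expR (- la * u) *
     (b * (expR (- (2 * la) * t) * (expR (la * u) * expR (la * u))) * even_mode v) =
     (expR (- la * u) * expR (la * u)) * (b * even_mode v * expR (- (2 * la) * t) * (la * expR
       (la * u))))%R by ring.
  by rewrite e mul1r.
rewrite -EFinM -EFinD lee_fin /F /velocity_mean -/la !mulr0 expR0 !mulr1.
have e : (expR (- (2 * la) * t) * expR (la * t) = expR (- la * t))%R by rewrite -expRD;
  congr expR; ring.
rewrite -[X in (_ - X)%R]mulrA e; apply: eq_leW; rewrite /K; ring.
Qed.

End velocity_decay.

(** * Invariance of the stationary measure *)

Section layers.
Local Open Scope ereal_scope.
Context {R : realType}.
Notation leb := (@lebesgue_measure R).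

Lemma ge0_integral_line (L : R) (d0 a dL : {nonneg R}) (g : measurableTypeR R -> \bar R) :
  measurable_fun setT g -> (forall x, 0 <= g x) ->
  \int[line_measure L d0 a dL]_x g x = d0%:num%:E * g 0%R +
    (a%:num%:E * \int[leb]_(x in `[0%R, L]) g x + dL%:num%:E * g L).
Proof.
move=> mg g0; rewrite ge0_integral_measure_add//.
rewrite ge0_integral_measure_add//.
rewrite !ge0_integral_mscale//= ge0_integral_mrestr//.
by rewrite !integral_dirac// !diracT !mul1e.
Qed.

Lemma ge0_integral_slice (nu : {measure set (measurableTypeR R) -> \bar R}) (v : velocity)
    (g : state R -> \bar R) : measurable_fun setT g -> (forall z, 0 <= g z) ->
  \int[nu \x \d_v]_z g z = \int[nu]_x g (x, v).
Proof.
move=> mg g0.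
rewrite -(@ge0_integral_pushm _ _ _ _ _ nu (fun x => (x, v)) (pair2_measurable v))//.
apply: eq_measure_integral => A mA _.
have mB : measurable ((fun x : measurableTypeR R => (x, v)) @^-1` A).
  by rewrite -[X in measurable X]setTI; exact: pair2_measurable.
rewrite pushmE -[_ @^-1` A]setIT -integral_indic//.
apply: eq_integral => x _; rewrite /= diracE indicE; congr ((nat_of_bool _)%:R%:E).
by apply/idP/idP; rewrite !inE /xsection/= ?inE.
Qed.

Context (omega L : {posnum R}).
Notation w := (omega%:num).
Notation l := (L%:num).

Definition layer_atom0 (v : velocity) : {nonneg R} :=
  match v with Pos2 => 0%:nng | _ => 2^-1%:nng end%R.
Definition layer_density (v : velocity) : {nonneg R} :=
  match v with Zero => (w / 2)%:nng | _ => (w / 4)%:nng end%R.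
Definition layer_atomL (v : velocity) : {nonneg R} :=
  match v with Neg2 => 0%:nng | _ => 2^-1%:nng end%R.

Definition layer_measure (v : velocity) :=
  line_measure l (layer_atom0 v) (layer_density v) (layer_atomL v).

(** The masses stand in the ratio [1 : 2 : 1], the stationary law of the velocity alone. *)
Definition layer_mass (v : velocity) : R :=
  match v with Zero => 2 + w * l | _ => (2 + w * l) / 2 end / 2.

Lemma ge0_integral_layer v (g : measurableTypeR R -> \bar R) :
  measurable_fun setT g -> (forall x, 0 <= g x) ->
  \int[layer_measure v]_x g x = (layer_atom0 v)%:num%:E * g 0%R +
    ((layer_density v)%:num%:E * \int[leb]_(x in `[0%R, l]) g x + (layer_atomL v)%:num%:E * g l).
Proof. exact: ge0_integral_line. Qed.

Lemma layer_measureT v : layer_measure v setT = (layer_mass v)%:E.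
Proof.
have := @ge0_integral_layer v (cst 1) (measurable_cst _) (fun=> lee01).
rewrite integral_cst// mul1e => ->;
  rewrite integral_cst// mul1e /= lebesgue_measure_itv/= lte_fin.
have -> : (0 < l)%R by [].
rewrite !mule1 sube0 -!EFinM -!EFinD; congr EFin.
by rewrite /layer_mass; case: v => /=; field.
Qed.

Lemma layer_mass_gt0 v : (0 < layer_mass v)%R.
Proof. by rewrite /layer_mass; case: v => /=; rewrite !divr_gt0. Qed.

Lemma ge0_integral_invariant (g : state R -> \bar R) :
  measurable_fun setT g -> (forall z, 0 <= g z) ->
  \int[rtp_invariant omega L]_z g z =
  ((2 + w * l)^-1)%:E * \sum_v \int[layer_measure v]_x g (x, v).
Proof.
move=> mg g0; rewrite big_velocity ge0_integral_mscale//; congr (_ * _).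
rewrite ge0_integral_measure_add//; congr (_ + _).
  by rewrite /rtp_layer ge0_integral_slice.
by rewrite ge0_integral_measure_add//; congr (_ + _); rewrite /rtp_layer ge0_integral_slice.
Qed.

Lemma rtp_invariantT : rtp_invariant omega L setT = 1.
Proof.
have := @ge0_integral_invariant (cst 1) (measurable_cst _) (fun=> lee01).
rewrite integral_cst// mul1e => ->.
under eq_bigr do rewrite integral_cst// mul1e layer_measureT.
rewrite sumEFin big_velocity -EFinM /=; congr EFin; rewrite /layer_mass.
by field; rewrite gt_eqF.
Qed.

End layers.

(** * Line integrals under clipped shifts *)

Section line_integrals.
Local Open Scope ereal_scope.
Context {R : realType}.
Notation leb := (@lebesgue_measure R).
Notation plane := (measurableTypeR R * measurableTypeR R)%type.

(** Tonelli's theorem exchanges the order, so that a bound on the integral over positions, uniform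
    in the jump time [u], can be used. *)
Lemma ge0_iterated_integral_ge (D E : set R) (k : plane -> \bar R) (c : \bar R) :
  measurable D -> measurable E -> measurable_fun setT k -> (forall z, 0 <= k z) -> 0 <= c ->
  (forall u, E u -> c <= \int[leb]_(x in D) k (x, u)) ->
  c * leb E <= \int[leb]_(x in D) \int[leb]_(u in E) k (x, u).
Proof.
move=> mD mE mk k0 c0 ck; pose f : plane -> \bar R := k \_ (D `*` E).
have mf : measurable_fun setT f.
  by apply/(measurable_restrictT _ _).1; [exact: measurableX|exact: measurable_funTS].
have f0 z : 0 <= f z by exact: erestrict_ge0.
have fE (x u : R) : f (x, u) = ((fun x => k (x, u)) \_ D) x * (u \in E)%:R%:E.
  rewrite /f !patchE; have -> : ((x, u) \in D `*` E) = (x \in D) && (u \in E).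
    by apply/idP/andP; rewrite !inE => -[].
  by case: (x \in D); case: (u \in E); rewrite /= ?mule1 ?mule0 ?mul0e.
have -> : \int[leb]_(x in D) \int[leb]_(u in E) k (x, u) =
    \int[leb]_x fubini_F leb f x.
  rewrite integral_mkcond; apply: eq_integral => x _; rewrite patchE /fubini_F.
  case: ifPn => xD; [rewrite [LHS]integral_mkcond; apply: eq_integral => u _|].
    by rewrite patchE fE patchE xD; case: ifPn; rewrite ?mule1 ?mule0.
  by rewrite integral0_eq// => u _; rewrite fE patchE (negbTE xD) mul0e.
rewrite -(@fubini_tonelli1 _ _ _ _ R leb leb f mf f0) (@fubini_tonelli2 _ _ _ _ R leb leb f mf
  f0).
rewrite -integral_cst// integral_mkcond; apply: ge0_le_integral => //.
- by move=> u _; apply: erestrict_ge0.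
- by apply/(measurable_restrictT _ _).1.
- exact: measurable_fun_fubini_tonelli_G.
- move=> u _; rewrite patchE; case: ifPn => uE; last exact: integral_ge0.
  apply: le_trans (ck u _) _; first by rewrite inE in uE.
  rewrite integral_mkcond; apply: eq_leW; apply: eq_integral => x _.
  by rewrite fE uE mule1.
Qed.

Context (l : R).
Hypothesis l0 : (0 <= l)%R.
Variable k : measurableTypeR R -> \bar R.
Hypotheses (mk : measurable_fun setT k) (k0 : forall x, 0 <= k x).

Let mclip (d : R) : measurable_fun setT (fun x : measurableTypeR R => k (clip l (x + d)%R)).
Proof.
apply: (measurableT_comp mk); apply: measurable_maxr => //; apply: measurable_minr => //.
exact: measurable_funD.
Qed.

Let affine (a b x y : R) (f : measurableTypeR R -> \bar R) : (0 < a)%R ->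
  measurable_fun setT f -> (forall x, 0 <= f x) ->
  \int[leb]_(z in `[(a * x + b)%R, (a * y + b)%R]) f z = a%:E * \int[leb]_(z in `[x, y]) f (a * z
    + b)%R.
Proof.
move=> a0 mf f0; rewrite integral_mkcond (ge0_integral_affine b a0).
- congr (_ * _); rewrite [RHS]integral_mkcond; apply: eq_integral => z _; rewrite !patchE.
  congr (if _ then _ else _); apply/idP/idP; rewrite !inE/= !in_itv/= !lerD2r !ler_pM2l//.
- by apply/(measurable_restrictT _ _).1 => //; exact: measurable_funTS.
- by move=> z; apply: erestrict_ge0.
Qed.

(** The shift carries [[0, l - d]] onto [[d, l]] and piles the last stretch, of length [d], up at
    the wall. *)
Lemma integral_clip_right (d : R) : (0 <= d <= l)%R ->
  \int[leb]_(x in `[d, l]) k x + d%:E * k l <= \int[leb]_(x in `[0%R, l]) k (clip l (x + d)%R).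
Proof.
move=> /andP[d0 dl].
rewrite (@itv_bndbnd_setU _ _ (BLeft 0%R) (BLeft (l - d)%R) (BRight l)) ?bnd_simp ?subr_ge0
  ?gerBl//.
rewrite ge0_integral_setU//=; last 2 first.
- by apply: measurable_funTS; exact: mclip.
- exact: disjoint_adjacent_itv.
apply: leeD.
  have -> : \int[leb]_(x in `[d, l]) k x = \int[leb]_(x in `[(1 * 0 + d)%R, (1 * (l - d) + d)%R])
    k x.
    by rewrite mulr0 add0r mul1r subrK.
  rewrite affine// mul1e -integral_itv_bndo_bndc; last first.
    apply: measurable_funTS; apply: (measurableT_comp mk); exact: measurable_funD.
  apply: eq_leW; apply: eq_integral => x.
  rewrite inE/= in_itv/= => /andP[x0 xl]; rewrite mul1r clip_id// addr_ge0//=.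
  by rewrite -lerBrDr ltW.
rewrite (eq_integral (cst (k l))); last first.
  by move=> x; rewrite inE/= in_itv/= => /andP[xl _]; rewrite clip_ge// -lerBlDr.
rewrite integral_cst//= lebesgue_measure_itv/= lte_fin.
have -> : (if (l - d < l)%R then l%:E - (l - d)%:E else 0) = d%:E.
  case: ifPn => [_|]; first by rewrite -EFinB; congr EFin; ring.
  rewrite -leNgt => d1; have -> // : d = 0%R.
  by apply/eqP; rewrite eq_le d0 andbT; lra.
by rewrite muleC.
Qed.

Lemma integral_clip_left (d : R) : (0 <= d <= l)%R ->
  \int[leb]_(x in `[0%R, (l - d)%R]) k x + d%:E * k 0%R <= \int[leb]_(x in `[0%R, l]) k (clip l
    (x - d)%R).
Proof.
move=> /andP[d0 dl]; rewrite addeC.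
rewrite (@itv_bndbnd_setU _ _ (BLeft 0%R) (BRight d) (BRight l)) ?bnd_simp//.
rewrite ge0_integral_setU//=; last 2 first.
- by apply: measurable_funTS; exact: mclip.
- exact: disjoint_adjacent_itv.
apply: leeD.
  rewrite (eq_integral (cst (k 0%R))); last first.
    by move=> x; rewrite inE/= in_itv/= => /andP[_ xl]; rewrite clip_le// subr_le0.
  rewrite integral_cst//= lebesgue_measure_itv/= lte_fin sube0.
  by case: ltgtP d0 => // [_ _|<- _]; rewrite muleC.
have -> : \int[leb]_(x in `[0%R, (l - d)%R]) k x = \int[leb]_(x in `[(1 * d - d)%R, (1 * l -
  d)%R]) k x.
  by rewrite !mul1r subrr.
rewrite affine// mul1e -integral_itv_obnd_cbnd; last first.
  apply: measurable_funTS; apply: (measurableT_comp mk); exact: measurable_funD.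
apply: eq_leW; apply: eq_integral => x.
rewrite inE/= in_itv/= => /andP[dx xl]; rewrite mul1r clip_id// subr_ge0 ltW//=.
by rewrite lerBlDr (le_trans xl)// lerDl.
Qed.

Lemma integral_double (e : R) : (0 <= e)%R ->
  \int[leb]_(x in `[0%R, e]) k (2 * x)%R = 2^-1%:E * \int[leb]_(x in `[0%R, (2 * e)%R]) k x.
Proof.
move=> e0; rewrite -[in RHS](mulr0 2%R) -[in RHS](addr0 (2 * 0)%R) -[in RHS](addr0 (2 * e)%R).
rewrite affine// muleA -EFinM mulVf// mul1e.
by apply: eq_integral => x _; rewrite addr0.
Qed.

End line_integrals.

Section semigroup_properties.
Local Open Scope ereal_scope.
Context {R : realType} dS (S : measurableType dS).
Variables (lam : {posnum R}) (p : velocity -> velocity -> R).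
Variable Phi : velocity -> R -> S -> S.
Hypothesis p0 : forall v w, (0 <= p v w)%R.
Hypothesis p1 : forall v, (\sum_w p v w = 1)%R.
Hypothesis mPhi : forall v,
  measurable_fun setT (fun z : measurableTypeR R * S => Phi v z.1 z.2).
Notation leb := (@lebesgue_measure R).
Notation Z := (measurableTypeR R * S)%type.
Implicit Types g : velocity -> S -> \bar R.
Notation pt := (semigroup lam p Phi).

Lemma semigroup_mono g g' t v y : gmeas g -> gnneg g -> gmeas g' -> gnneg g' ->
  (forall w z, g w z <= g' w z) -> pt g t v y <= pt g' t v y.
Proof.
move=> mg g0 mg' g0' gg'.
apply: (@jump_sum_le _ _ _ lam p Phi p0 mPhi setT) => //.
- exact: measurable_jump_sum.
- by move=> w z; exact: jump_sum_ge0.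
- move=> w z _; rewrite [leRHS]jump_sumE//; apply: leeD => //.
  by rewrite /no_jump; case: ifP => // _; rewrite lee_wpmul2l ?lee_fin ?expR_ge0.
Qed.

Lemma semigroup1 t v y : (0 <= t)%R -> pt (fun _ _ => 1) t v y = 1.
Proof. by move=> t0; apply: jump_sum1 => //=; rewrite lexx. Qed.

Lemma semigroupD g g' t v y : gmeas g -> gnneg g -> gmeas g' -> gnneg g' ->
  pt (fun w z => g w z + g' w z) t v y = pt g t v y + pt g' t v y.
Proof.
move=> mg g0 mg' g0'.
have termD n : jump_term lam p Phi (fun w z => g w z + g' w z) t n =
    (fun w z => jump_term lam p Phi g t n w z + jump_term lam p Phi g' t n w z).
  elim: n => [|n ih].
    apply/funext => w; apply/funext => z; rewrite /jump_term/= /no_jump.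
    by case: ifP => _; rewrite ?adde0// ge0_muleDr.
  rewrite jump_termS ih jump_opD//; do ? [exact: measurable_jump_term|exact: jump_term_ge0].
rewrite /semigroup /jump_sum -nneseriesD; last 2 first.
- by move=> n _ _; exact: jump_term_ge0.
- by move=> n _ _; exact: jump_term_ge0.
by apply: eq_eseriesr => n _; rewrite termD.
Qed.

(** Only the terms with no jump and with exactly one jump are kept. In the latter the density at [u]
    and the survival over [t - u] multiply to [lam * expR (- lam * t)], whatever [u] is. *)
Lemma semigroup_first_jump g t v y : gmeas g -> gnneg g -> (0 <= t)%R ->
  (expR (- lam%:num * t))%:E * (g v (Phi v t y) + lam%:num%:E *
     \int[leb]_(u in `[0%R, t]) \sum_w (p v w)%:E * g w (Phi w (t - u)%R (Phi v u y))) <=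
  pt g t v y.
Proof.
move=> mg g0 t0; rewrite /semigroup jump_sumE//.
have mN := measurable_no_jump lam mPhi t mg; have N0 := no_jump_ge0 lam Phi t g0.
have mU := measurable_jump_sum lam p0 mPhi t mg g0;
  have U0 : nneg (jump_sum lam p Phi g t) by exact: jump_sum_ge0.
have f0 u : 0 <= \sum_w (p v w)%:E * g w (Phi w (t - u)%R (Phi v u y)).
  by apply: sume_ge0 => w _; rewrite mule_ge0// lee_fin.
rewrite ge0_muleDr//; last by rewrite mule_ge0// integral_ge0.
apply: leeD; first by rewrite /no_jump/= t0 subr0.
apply: (@le_trans _ _ (jump_op lam p Phi (no_jump lam Phi g t) v (0%R, y))); last first.
  apply: (@le_jump_op _ _ _ lam p Phi p0 mPhi setT) => // w z _.
  by rewrite [leRHS]jump_sumE// leeDl// jump_op_ge0.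
rewrite /jump_op.
apply: (@le_trans _ _ (\int[expo lam]_(u in `[0%R, t]) jump_int p Phi (no_jump lam Phi g t) v
  (0%R, y) u)); last first.
  apply: ge0_subset_integral => //.
  - by apply: measurable_funTS; exact: measurable_jump_int.
  - by move=> u _; exact: jump_int_ge0.
  - by move=> u /=; rewrite !in_itv/= => /andP[->].
rewrite integral_expo//; last 3 first.
- by move=> u /=; rewrite !in_itv/= => /andP[->].
- by apply: measurable_funTS; exact: measurable_jump_int.
- by move=> u _; exact: jump_int_ge0.
rewrite muleA -EFinM -ge0_integralZl//; last first.
- apply: measurable_funTS; apply: emeasurable_sum => w; apply: emeasurable_funM => //.
  have mv : measurable_fun setT (fun u : measurableTypeR R => Phi v u y).
    apply: (measurableT_comp (mPhi v) (g := fun u : measurableTypeR R => (u, y))).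
    exact: pair2_measurable.
  apply: (measurableT_comp (mg w)).
  apply: (measurableT_comp (mPhi w)
    (g := fun u : measurableTypeR R => ((t - u)%R : measurableTypeR R, Phi v u y))).
  by apply: measurable_fun_pair => //; exact: measurable_funB.
apply: eq_leW; apply: eq_integral => u.
rewrite inE/= in_itv/= => /andP[u0 ut]; rewrite /jump_int.
rewrite !ge0_sume_distrr; last 2 first.
- by move=> w _; rewrite mule_ge0 ?lee_fin.
- by move=> w _; rewrite mule_ge0 ?lee_fin.
apply: eq_bigr => w _; rewrite /no_jump/= add0r ut.
rewrite muleCA [RHS]muleCA; congr (_ * _); rewrite muleA; congr (_ * _).
rewrite -EFinM; congr EFin; rewrite mulrC -mulrA -expRD; congr (_ * expR _)%R; ring.
Qed.

End semigroup_properties.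

Lemma sum_rtp_probE {R : realType} v (F : velocity -> \bar R) :
  (\sum_u (rtp_prob v u)%:E * F u =
   if v is Zero then 2^-1%:E * F Neg2 + 2^-1%:E * F Pos2 else F Zero)%E.
Proof.
by rewrite big_velocity; case: v => /=; rewrite ?mul0e ?mul1e ?add0e ?adde0.
Qed.

(* [M] and [S] are the masses of a test function before and after the step;
   [n'], [z'], [z], [p] are the parts of its integrals carried by the layers of
   width [2 e] next to the walls. *)
Lemma one_step_bound {R : realType} (w l e c gN gZ gZl gP n n' z0 z z' p p0 M S : R) :
  0 < w -> 0 <= l -> 0 <= e -> c <= 1 -> 1 - 2 * w * e <= c ->
  0 <= gN <= 1 -> 0 <= gZ <= 1 -> 0 <= gZl <= 1 -> 0 <= gP <= 1 ->
  0 <= n -> 0 <= n' <= 2 * e -> 0 <= z0 <= l -> 0 <= z <= 2 * e -> 0 <= z' <= 2 * e ->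
  0 <= p <= 2 * e -> 0 <= p0 -> n + n' <= l -> p + p0 <= l ->
  M = 2^-1 * (gN + gZ + gZl + gP) + w / 4 * (n + n' + 2 * z0 + (p + p0)) ->
  S = (w / 4 * (n + 2 * e * gN) + 2^-1 * gN + 2 * w * (e * (2^-1 * gZ + w / 4 * (z0 - z')))) +
      (2^-1 * gZ + (w / 2 * z0 + 2^-1 * gZl) +
       2 * w * (2^-1 * (4^-1 * n' + e * (2^-1 * gN + w / 2 * n)) +
                2^-1 * (4^-1 * p + e * (w / 2 * p0 + 2^-1 * gP))) +
      (w / 4 * (p0 + 2 * e * gP) + 2^-1 * gP + 2 * w * (e * (w / 4 * (z0 - z) + 2^-1 * gZl)))) ->
  M <= c * S + 4 * w ^+ 2 * (5 + 2 * w * l) * e ^+ 2.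
Proof.
move=> w0 l0 e0 c1 c2 /andP[gN0 gN1] /andP[gZ0 gZ1] /andP[gZl0 gZl1] /andP[gP0 gP1].
move=> n0 /andP[n'0 n'1] /andP[z00 z01] /andP[z_0 z_1] /andP[z'0 z'1] /andP[p_0 p_1] p00 nl pl ME
  SE.
(* The stationarity balance: with these weights the step multiplies [M] by exactly [1 + 2 * w * e],
   up to the loss [E] from the strips next to the walls. The factor [c >= 1 - 2 * w * e] brings this
   back to [1] up to second order. *)
pose E := w ^+ 2 * e / 2 * (p + n' + z + z').
have {}SE : S = (1 + 2 * w * e) * M - E by rewrite SE ME /E; field.
have M0 : 0 <= M.
  rewrite ME addr_ge0// mulr_ge0 ?invr_ge0 ?divr_ge0 ?(ltW w0) ?addr_ge0 ?mulr_ge0//.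
have Ml : M <= 2 + w * l.
  rewrite ME; apply: lerD; first by clear -gN1 gZ1 gZl1 gP1; lra.
  rewrite (_ : w * l = w / 4 * (4 * l)); last by field.
  by rewrite ler_wpM2l ?divr_ge0 ?(ltW w0)//; clear -nl pl z01; lra.
have E0 : 0 <= E.
  by apply: mulr_ge0; [rewrite divr_ge0// mulr_ge0// sqr_ge0|rewrite !addr_ge0].
have E1 : E <= 4 * w ^+ 2 * e ^+ 2.
  rewrite (_ : 4 * w ^+ 2 * e ^+ 2 = w ^+ 2 * e / 2 * (8 * e)); last by field.
  rewrite /E ler_wpM2l//; first by rewrite divr_ge0// mulr_ge0// sqr_ge0.
  by clear -n'1 z_1 z'1 p_1; lra.
have we0 : 0 <= w * e by rewrite mulr_ge0// ltW.
have wl0 : 0 <= w * l by rewrite mulr_ge0// ltW.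
have cE : c * E <= 4 * w ^+ 2 * e ^+ 2 by apply: le_trans E1; rewrite ler_piMl.
have cM : (1 - 4 * w ^+ 2 * e ^+ 2) * M <= c * ((1 + 2 * w * e) * M).
  rewrite [leRHS]mulrA ler_wpM2r//.
  have -> : 1 - 4 * w ^+ 2 * e ^+ 2 = (1 - 2 * w * e) * (1 + 2 * w * e) by ring.
  by rewrite ler_wpM2r// addr_ge0// -mulrA mulr_ge0.
have h1 : 4 * w ^+ 2 * e ^+ 2 * M <= 4 * w ^+ 2 * e ^+ 2 * (2 + w * l).
  by rewrite ler_wpM2l// mulr_ge0 ?sqr_ge0// mulr_ge0// sqr_ge0.
have h2 : 0 <= w ^+ 2 * e ^+ 2 by rewrite mulr_ge0 ?sqr_ge0.
have h3 : 0 <= w ^+ 2 * e ^+ 2 * (w * l) by rewrite mulr_ge0.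
rewrite SE mulrBr; clear -cE cM h1 h2 h3.
have -> : 4 * w ^+ 2 * (5 + 2 * w * l) * e ^+ 2 =
  20 * (w ^+ 2 * e ^+ 2) + 8 * (w ^+ 2 * e ^+ 2 * (w * l)) by ring.
have h1' : 4 * w ^+ 2 * e ^+ 2 * M <= 8 * (w ^+ 2 * e ^+ 2) + 4 * (w ^+ 2 * e ^+ 2 * (w * l)).
  by apply: (le_trans h1); apply: eq_leW; ring.
have cM' : M - 4 * w ^+ 2 * e ^+ 2 * M <= c * ((1 + 2 * w * e) * M).
  by apply: le_trans cM; rewrite mulrBl mul1r.
have cE' : c * E <= 4 * (w ^+ 2 * e ^+ 2) by rewrite mulrA.
clear cE cM h1; lra.
Qed.

(** * One step and many steps from the stationary measure *)

Section invariance.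
Local Open Scope ereal_scope.
Context {R : realType} (omega L : {posnum R}).
Notation w := (omega%:num).
Notation l := (L%:num).
Notation leb := (@lebesgue_measure R).
Notation lam := (jump_rate omega).
Notation pt := (semigroup lam rtp_prob (rtp_flow l)).
Notation layer := (layer_measure omega L).
Notation plane := (measurableTypeR R * measurableTypeR R)%type.

Let l0 : (0 <= l)%R. Proof. by []. Qed.
Let mflow := @measurable_rtp_flow R l.

Lemma measurable_partial_integral d (T : measurableType d) (E : set R)
    (k : T * measurableTypeR R -> \bar R) : measurable E ->
  measurable_fun setT k -> (forall z, 0 <= k z) ->
  measurable_fun setT (fun x => \int[leb]_(u in E) k (x, u)).
Proof.
move=> mE mk k0; pose f := k \_ (setT `*` E).
have -> : (fun x => \int[leb]_(u in E) k (x, u)) = fubini_F leb f.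
  apply/funext => x; rewrite [LHS]integral_mkcond; apply: eq_integral => u _.
  rewrite /f !patchE; congr (if _ then _ else _).
  by apply/idP/idP; rewrite !inE//= => -[].
apply: measurable_fun_fubini_tonelli_F; last by move=> z; apply: erestrict_ge0.
by apply/(measurable_restrictT _ _).1; [exact: measurableX|exact: measurable_funTS].
Qed.

Lemma le_integral_layer v (f g : measurableTypeR R -> \bar R) :
  measurable_fun setT f -> (forall x, 0 <= f x) ->
  measurable_fun setT g -> (forall x, 0 <= g x) ->
  (forall x, (0 <= x <= l)%R -> f x <= g x) ->
  \int[layer v]_x f x <= \int[layer v]_x g x.
Proof.
move=> mf f0 mg g0 fg; rewrite !ge0_integral_layer//.
apply: leeD; first by rewrite lee_wpmul2l ?lee_fin ?fg ?lexx.
apply: leeD; rewrite lee_wpmul2l ?lee_fin ?fg ?lexx ?l0//.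
by apply: ge0_le_integral => //; do ? exact: measurable_funTS.
Qed.

Lemma integral_reflect (a b c : R) (f : measurableTypeR R -> \bar R) :
  measurable_fun setT f -> (forall x, 0 <= f x) ->
  \int[leb]_(s in `[(c - b)%R, (c - a)%R]) f s = \int[leb]_(s in `[a, b]) f (c - s)%R.
Proof.
move=> mf f0; pose phi : measurableTypeR R -> measurableTypeR R := fun x => (c - x)%R.
have mphi : @measurable_fun _ _ (measurableTypeR R) (measurableTypeR R) setT phi.
  exact: measurable_funB.
have lebE A : measurable A -> leb A = pushm leb mphi A.
  apply: lebesgue_measure_unique => X [[x y] /= xy <-{X}].
  rewrite /pushforward.
  have -> : phi @^-1` [set` `]x, y]%R] = [set` `[(c - y), (c - x)[%R].
    by apply/seteqP; split => z /=; rewrite !in_itv/= /phi => /andP[? ?]; apply/andP; split; lra.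
  rewrite !lebesgue_measure_itv/= !lte_fin ltrD2l ltrN2.
  case: ifPn => // _.
  by rewrite -!EFinD; congr EFin; ring.
rewrite integral_mkcond [RHS]integral_mkcond (eq_measure_integral (pushm leb mphi)); last first.
  by move=> A mA _; exact: lebE.
rewrite (@ge0_integral_pushm _ _ _ _ _ leb phi mphi)//.
- apply: eq_integral => s _; rewrite !patchE; congr (if _ then _ else _).
  by apply/idP/idP; rewrite !inE/= !in_itv/= /phi => /andP[? ?]; apply/andP; split; lra.
- by apply/(measurable_restrictT _ _).1 => //; exact: measurable_funTS.
- by move=> z; apply: erestrict_ge0.
Qed.

Section one_step.
Variables (G : velocity -> measurableTypeR R -> R) (e : R).
Hypothesis mG : forall v, measurable_fun setT (G v).
Hypothesis G0 : forall v x, (0 <= G v x)%R.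
Hypothesis G1 : forall v x, (G v x <= 1)%R.
Hypotheses (e0 : (0 <= e)%R) (el : (2 * e <= l)%R).

Let g v x := (G v x)%:E.
Let mg : gmeas g. Proof. by move=> v; exact/measurable_EFinP. Qed.
Let g0 : gnneg g. Proof. by move=> v x; rewrite lee_fin. Qed.

(** [z.2] is the time of the single jump, from [v] to [u]; the flow with velocity [u] fills the rest
    of the step of length [e]. *)
Let K v u (z : plane) :=
  g u (rtp_flow l u (e - z.2) (rtp_flow l v z.2 z.1)).

Let mK v u : measurable_fun setT (K v u).
Proof.
apply: (measurableT_comp (mg u)).
apply: (measurableT_comp (mflow u)
  (g := fun z : plane =>
    ((e - z.2)%R : measurableTypeR R, rtp_flow l v z.2 z.1 : measurableTypeR R))).
apply: measurable_fun_pair; first by apply: measurable_funB => //; apply: measurable_snd.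
apply: (measurableT_comp (mflow v)
  (g := fun z : plane => (z.2, z.1))).
exact: measurable_swap.
Qed.

Let A v u x := \int[leb]_(s in `[0%R, e]) K v u (x, s).

Let mA v u : measurable_fun setT (A v u).
Proof. by apply: measurable_partial_integral => // z; exact: g0. Qed.

Let A0 v u x : 0 <= A v u x.
Proof. by apply: integral_ge0 => s _; exact: g0. Qed.

Let mD v : measurable_fun setT (fun x : measurableTypeR R => g v (rtp_flow l v e x)).
Proof.
apply: (measurableT_comp (mg v)); apply: (measurableT_comp (mflow v)
  (g := fun x : measurableTypeR R => (e : measurableTypeR R, x))).
exact: pair1_measurable.
Qed.

Let layer_ge v :
  (expR (- lam%:num * e))%:E * (\int[layer v]_x g v (rtp_flow l v e x) +
    lam%:num%:E * \sum_u (rtp_prob v u)%:E * \int[layer v]_x A v u x) <=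
  \int[layer v]_x pt g e v x.
Proof.
have p0 : forall v u, (0 <= rtp_prob v u :> R)%R by exact: rtp_prob_ge0.
have S0 x : 0 <= \sum_u (rtp_prob v u)%:E * A v u x.
  by apply: sume_ge0 => u _; rewrite mule_ge0 ?lee_fin.
have mS : measurable_fun setT (fun x => \sum_u (rtp_prob v u)%:E * A v u x).
  by apply: emeasurable_sum => u; apply: emeasurable_funM.
have -> : \sum_u (rtp_prob v u)%:E * \int[layer v]_x A v u x =
    \int[layer v]_x \sum_u (rtp_prob v u)%:E * A v u x.
  rewrite ge0_integral_sum//; last 2 first.
  - by move=> u; apply: emeasurable_funM.
  - by move=> u x _; rewrite mule_ge0 ?lee_fin.
  by apply: eq_bigr => u _; rewrite ge0_integralZl// lee_fin.
rewrite -ge0_integralZl//.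
rewrite -ge0_integralD//; last 2 first.
- by move=> x _; rewrite mule_ge0.
- exact: emeasurable_funM.
rewrite -ge0_integralZl//; last 2 first.
- by apply: emeasurable_funD => //; exact: emeasurable_funM.
- by move=> x _; rewrite adde_ge0// ?mule_ge0//; exact: g0.
apply: ge0_le_integral => //.
- by move=> x _; rewrite mule_ge0 ?lee_fin ?expR_ge0// adde_ge0// ?mule_ge0//; exact: g0.
- by apply: emeasurable_funM => //; apply: emeasurable_funD => //; exact: emeasurable_funM.
- exact: (measurable_semigroup lam p0 mflow e mg g0 v).
move=> x _; apply: le_trans (semigroup_first_jump lam p0 mflow v x mg g0 e0).
rewrite lee_wpmul2l ?lee_fin ?expR_ge0// leeD2l// lee_wpmul2l//.
rewrite ge0_integral_sum//; last 2 first.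
- move=> u; apply: emeasurable_funM => //; apply: measurable_funTS.
  exact: (measurableT_comp (mK v u) (pair1_measurable x)).
- by move=> u s _; rewrite mule_ge0 ?lee_fin.
apply: lee_sum => u _; rewrite ge0_integralZl// ?lee_fin//; last first.
  by apply: measurable_funTS; exact: (measurableT_comp (mK v u) (pair1_measurable x)).
Qed.

Let I v a b := fine (\int[leb]_(x in `[a, b]) g v x).

Let IE v a b : (a <= b)%R -> \int[leb]_(x in `[a, b]) g v x = (I v a b)%:E.
Proof.
move=> ab; rewrite /I fineK// ge0_fin_numE; last by apply: integral_ge0 => x _; exact: g0.
apply: (@le_lt_trans _ _ (\int[leb]_(x in `[a, b]) cst 1 x)).
  apply: ge0_le_integral => //.
  - exact: measurable_funTS.
  - by move=> x _; rewrite lee_fin.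
rewrite integral_cst// mul1e /= lebesgue_measure_itv/= lte_fin.
by case: ifP => _; rewrite ?ltry// -EFinB ltry.
Qed.

Let I_ge0 v a b : (0 <= I v a b)%R.
Proof. by apply: fine_ge0; apply: integral_ge0 => x _; exact: g0. Qed.

Let I_le v a b : (a <= b)%R -> (I v a b <= b - a)%R.
Proof.
move=> ab; rewrite -lee_fin -IE//.
apply: (@le_trans _ _ (\int[leb]_(x in `[a, b]) cst 1 x)).
  apply: ge0_le_integral => //.
  - exact: measurable_funTS.
  - by move=> x _; rewrite lee_fin.
rewrite integral_cst// mul1e /= lebesgue_measure_itv/= lte_fin.
by case: ifP => _; rewrite -?EFinB// lee_fin subr_ge0.
Qed.

Let I_split v a b c : (a <= b)%R -> (b <= c)%R -> (I v a c = I v a b + I v b c)%R.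
Proof.
move=> ab bc; have ac := le_trans ab bc; apply: EFin_inj; rewrite EFinD -!IE//.
rewrite (@itv_bndbnd_setU _ _ (BLeft a) (BRight b) (BRight c)) ?bnd_simp//.
rewrite ge0_integral_setU//=; last 2 first.
- exact: measurable_funTS.
- exact: disjoint_adjacent_itv.
by congr (_ + _); rewrite integral_itv_obnd_cbnd//; apply: measurable_funTS; exact: mg.
Qed.

Let flow_zero s y : (0 <= y <= l)%R -> rtp_flow l Zero s y = y.
Proof. by move=> yl; rewrite /rtp_flow mul0r addr0 clip_id. Qed.

Let const_int (k : measurableTypeR R -> \bar R) (c : R) :
  (forall s, (0 <= s <= e)%R -> k s = c%:E) -> \int[leb]_(s in `[0%R, e]) k s = (e * c)%:E.
Proof.
move=> kc; rewrite (eq_integral (cst c%:E)); last first.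
  by move=> s; rewrite inE/= in_itv/= => /kc.
rewrite integral_cst//= lebesgue_measure_itv/= lte_fin sube0 mulrC EFinM.
by case: ltgtP e0 => // <-; rewrite mule0.
Qed.

Let iterated (k : plane -> \bar R) (c : R) :
  measurable_fun setT k -> (forall z, 0 <= k z) -> (0 <= c)%R ->
  (forall s, (0 <= s <= e)%R -> c%:E <= \int[leb]_(x in `[0%R, l]) k (x, s)) ->
  (e * c)%:E <= \int[leb]_(x in `[0%R, l]) \int[leb]_(s in `[0%R, e]) k (x, s).
Proof.
move=> mk k0 c0 ck.
have := @ge0_iterated_integral_ge R `[0%R, l] `[0%R, e] k c%:E; move=> /(_ _ _ mk k0) h.
apply: le_trans (h _ _ _ _) => //.
rewrite /= lebesgue_measure_itv/= lte_fin sube0 mulrC EFinM.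
by case: ltgtP e0 => // <-; rewrite mule0.
Qed.

(* In the following bounds the mass carried from the bulk to the walls, which
   only contributes at second order, is discarded. *)
Let D_Pos2 : (w / 4 * (I Pos2 (2 * e) l + 2 * e * G Pos2 l) + 2^-1 * G Pos2 l)%:E <=
  \int[layer Pos2]_x g Pos2 (rtp_flow l Pos2 e x).
Proof.
rewrite ge0_integral_layer//=.
rewrite mul0e add0e EFinD; apply: leeD; last first.
  by rewrite EFinM [rtp_flow _ _ _ _]clip_ge// lerDl mulr_ge0.
rewrite EFinM lee_wpmul2l ?lee_fin//.
have h : (0 <= 2 * e <= l)%R by rewrite el mulr_ge0.
apply: le_trans (integral_clip_right l0 (mg Pos2) (g0 Pos2) h).
by rewrite IE// EFinD EFinM.
Qed.

Let D_Neg2 : (w / 4 * (I Neg2 0 (l - 2 * e) + 2 * e * G Neg2 0) + 2^-1 * G Neg2 0)%:E <=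
  \int[layer Neg2]_x g Neg2 (rtp_flow l Neg2 e x).
Proof.
rewrite ge0_integral_layer//=.
rewrite mul0e adde0 addrC EFinD; apply: leeD.
  by rewrite EFinM [rtp_flow _ _ _ _]clip_le// add0r mulNr oppr_le0 mulr_ge0.
rewrite EFinM lee_wpmul2l ?lee_fin//.
have h : (0 <= 2 * e <= l)%R by rewrite el mulr_ge0.
have := integral_clip_left (mg Neg2) (g0 Neg2) h.
rewrite IE ?subr_ge0// -EFinM -EFinD => /le_trans; apply.
apply: eq_leW; apply: eq_integral => x _.
by rewrite /rtp_flow/= mulNr.
Qed.

Let D_Zero : (2^-1 * G Zero 0 + (w / 2 * I Zero 0 l + 2^-1 * G Zero l))%:E <=
  \int[layer Zero]_x g Zero (rtp_flow l Zero e x).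
Proof.
rewrite ge0_integral_layer//=.
rewrite !flow_zero ?lexx ?l0// !EFinD !EFinM; apply: leeD => //; apply: leeD => //.
rewrite lee_wpmul2l ?lee_fin// -IE//; apply: eq_leW.
by apply: eq_integral => x; rewrite inE/= in_itv/= => xl; rewrite flow_zero.
Qed.

Let J_PZ : (e * (w / 4 * I Zero (2 * e) l + 2^-1 * G Zero l))%:E <=
  \int[layer Pos2]_x A Pos2 Zero x.
Proof.
rewrite ge0_integral_layer//= mul0e add0e mulrDr EFinD; apply: leeD; last first.
  rewrite (_ : A Pos2 Zero l = (e * G Zero l)%:E).
    by rewrite -EFinM lee_fin; apply: eq_leW; ring.
  apply: const_int => s /andP[s0 se]; rewrite /K/= flow_zero ?rtp_flow_itv//.
  by rewrite [rtp_flow _ _ _ _]clip_ge// lerDl mulr_ge0.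
rewrite mulrCA EFinM lee_wpmul2l ?lee_fin//.
apply: iterated => //; first by move=> z; exact: g0.
move=> s /andP[s0 se]; have s2l : (2 * s <= l)%R by have := el; have := se; lra.
have h : (0 <= 2 * s <= l)%R by rewrite s2l mulr_ge0.
apply: (@le_trans _ _ (\int[leb]_(x in `[0%R, l]) g Zero (clip l (x + 2 * s)%R))); last first.
  apply: eq_leW; apply: eq_integral => x _.
  by rewrite /K/= flow_zero// rtp_flow_itv.
apply: le_trans (integral_clip_right l0 (mg Zero) (g0 Zero) h).
rewrite IE// -EFinM -EFinD lee_fin (@I_split Zero (2 * s) (2 * e) l)%R ?ler_pM2l//.
rewrite -addrA addrCA lerDl addr_ge0// mulr_ge0// mulr_ge0//.
Qed.

Let J_NZ : (e * (2^-1 * G Zero 0 + w / 4 * I Zero 0 (l - 2 * e)))%:E <=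
  \int[layer Neg2]_x A Neg2 Zero x.
Proof.
rewrite ge0_integral_layer//= mul0e adde0 mulrDr EFinD; apply: leeD.
  rewrite (_ : A Neg2 Zero 0%R = (e * G Zero 0)%:E).
    by rewrite -EFinM lee_fin; apply: eq_leW; ring.
  apply: const_int => s /andP[s0 se]; rewrite /K/= flow_zero ?rtp_flow_itv//.
  by rewrite [rtp_flow _ _ _ _]clip_le// add0r mulNr oppr_le0 mulr_ge0.
rewrite mulrCA EFinM lee_wpmul2l ?lee_fin//.
apply: iterated => //; first by move=> z; exact: g0.
move=> s /andP[s0 se]; have s2l : (2 * s <= l)%R by have := el; have := se; lra.
have h : (0 <= 2 * s <= l)%R by rewrite s2l mulr_ge0.
apply: (@le_trans _ _ (\int[leb]_(x in `[0%R, l]) g Zero (clip l (x - 2 * s)%R))); last first.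
  apply: eq_leW; apply: eq_integral => x _.
  by rewrite /K/= flow_zero ?rtp_flow_itv// /rtp_flow/= mulNr.
apply: le_trans (integral_clip_left (mg Zero) (g0 Zero) h).
rewrite IE ?subr_ge0// -EFinM -EFinD lee_fin.
rewrite (@I_split Zero 0 (l - 2 * e) (l - 2 * s))%R ?subr_ge0// ?lerD2l ?lerN2 ?ler_pM2l//.
by rewrite -addrA lerDl addr_ge0// mulr_ge0// mulr_ge0.
Qed.

(** A particle that leaves the atom at [0] at time [s] ends at [2 * (e - s)], so averaging over [s]
    spreads mass over [[0, 2 * e]]. Once multiplied by the jump rates, this restores with weight
    [w / 4] the strip missing from [D_Pos2]. *)
Let J_ZP : (4^-1 * I Pos2 0 (2 * e) + e * (w / 2 * I Pos2 (2 * e) l + 2^-1 * G Pos2 l))%:E <=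
  \int[layer Zero]_x A Zero Pos2 x.
Proof.
rewrite ge0_integral_layer//= mulrDr !EFinD; apply: leeD; [|apply: leeD].
- rewrite (_ : A Zero Pos2 0%R = (2^-1 * I Pos2 0 (2 * e))%:E).
    by rewrite -EFinM lee_fin; apply: eq_leW; field.
  rewrite EFinM -IE ?mulr_ge0// -integral_double//.
  rewrite (_ : `[0%R, e]%R = `[(e - e)%R, (e - 0)%R]%R); last by rewrite subrr subr0.
  rewrite integral_reflect//; last first.
    by apply: (measurableT_comp (mg Pos2)); exact: measurable_funM.
  apply: eq_integral => s; rewrite inE/= in_itv/= => /andP[s0 se].
  rewrite /K/= flow_zero ?lexx// /rtp_flow/= add0r clip_id// mulr_ge0 ?subr_ge0//=.
  by have := el; have := s0; lra.
- rewrite mulrCA EFinM lee_wpmul2l ?lee_fin//.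
  apply: iterated => //; first by move=> z; exact: g0.
  move=> s /andP[s0 se]; have s2l : (2 * (e - s) <= l)%R by have := el; have := s0; lra.
  have h : (0 <= 2 * (e - s) <= l)%R by rewrite s2l mulr_ge0// subr_ge0.
  apply: (@le_trans _ _ (\int[leb]_(x in `[0%R, l]) g Pos2 (clip l (x + 2 * (e - s))%R)));
    last first.
    apply: eq_leW; apply: eq_integral => x.
    by rewrite inE/= in_itv/= => xl; rewrite /K/= flow_zero.
  apply: le_trans (integral_clip_right l0 (mg Pos2) (g0 Pos2) h).
  rewrite IE// -EFinM -EFinD lee_fin (@I_split Pos2 (2 * (e - s)) (2 * e) l)%R ?ler_pM2l ?gerBl//.
  by rewrite -addrA addrCA lerDl addr_ge0// mulr_ge0// mulr_ge0// subr_ge0.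
- rewrite (_ : A Zero Pos2 l = (e * G Pos2 l)%:E).
    by rewrite -EFinM lee_fin; apply: eq_leW; ring.
  apply: const_int => s /andP[s0 se]; rewrite /K/= flow_zero ?lexx ?l0//.
  by rewrite [rtp_flow _ _ _ _]clip_ge// lerDl mulr_ge0// subr_ge0.
Qed.

Let J_ZN : (4^-1 * I Neg2 (l - 2 * e) l + e * (2^-1 * G Neg2 0 + w / 2 * I Neg2 0 (l - 2 *
  e)))%:E <=
  \int[layer Zero]_x A Zero Neg2 x.
Proof.
have -> : (4^-1 * I Neg2 (l - 2 * e) l + e * (2^-1 * G Neg2 0 + w / 2 * I Neg2 0 (l - 2 * e)) =
  e * (2^-1 * G Neg2 0) + (e * (w / 2 * I Neg2 0 (l - 2 * e)) + 4^-1 * I Neg2 (l - 2 * e) l))%R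
    by ring.
rewrite ge0_integral_layer//= !EFinD; apply: leeD; [|apply: leeD].
- rewrite (_ : A Zero Neg2 0%R = (e * G Neg2 0)%:E).
    by rewrite -EFinM lee_fin; apply: eq_leW; ring.
  apply: const_int => s /andP[s0 se]; rewrite /K/= flow_zero ?lexx ?l0//.
  by rewrite [rtp_flow _ _ _ _]clip_le// add0r mulNr oppr_le0 mulr_ge0// subr_ge0.
- rewrite mulrCA EFinM lee_wpmul2l ?lee_fin//.
  apply: iterated => //; first by move=> z; exact: g0.
  move=> s /andP[s0 se]; have s2l : (2 * (e - s) <= l)%R by have := el; have := s0; lra.
  have h : (0 <= 2 * (e - s) <= l)%R by rewrite s2l mulr_ge0// subr_ge0.
  apply: (@le_trans _ _ (\int[leb]_(x in `[0%R, l]) g Neg2 (clip l (x - 2 * (e - s))%R)));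
    last first.
    apply: eq_leW; apply: eq_integral => x.
    by rewrite inE/= in_itv/= => xl; rewrite /K/= flow_zero// /rtp_flow/= mulNr.
  apply: le_trans (integral_clip_left (mg Neg2) (g0 Neg2) h).
  rewrite IE ?subr_ge0// -EFinM -EFinD lee_fin.
  rewrite (@I_split Neg2 0 (l - 2 * e) (l - 2 * (e - s)))%R ?subr_ge0// ?lerD2l ?lerN2 ?ler_pM2l
    ?gerBl//.
  by rewrite -addrA lerDl addr_ge0// mulr_ge0// mulr_ge0// subr_ge0.
- rewrite (_ : A Zero Neg2 l = (2^-1 * I Neg2 (l - 2 * e) l)%:E).
    by rewrite -EFinM lee_fin; apply: eq_leW; field.
  rewrite EFinM -IE ?gerBl ?mulr_ge0//.
  have mr : measurable_fun setT (fun s : measurableTypeR R => g Neg2 (l - s)%R).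
    by apply: (measurableT_comp (mg Neg2)); exact: measurable_funB.
  have -> : \int[leb]_(s in `[(l - 2 * e)%R, l]) g Neg2 s =
      \int[leb]_(s in `[0%R, (2 * e)%R]) g Neg2 (l - s)%R.
    by rewrite -integral_reflect// subr0.
  rewrite -(integral_double mr)//.
  rewrite (_ : `[0%R, e]%R = `[(e - e)%R, (e - 0)%R]%R); last by rewrite subrr subr0.
  rewrite integral_reflect//; last first.
    by apply: (measurableT_comp mr); exact: measurable_funM.
  apply: eq_integral => s; rewrite inE/= in_itv/= => /andP[s0 se].
  rewrite /K/= flow_zero ?lexx ?l0// /rtp_flow/= mulNr clip_id// subr_ge0.
  by have := el; have := s0; have := se => *; apply/andP; split; lra.
Qed.
Lemma one_step_invariance : \sum_v \int[layer v]_x g v x <=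
  \sum_v \int[layer v]_x pt g e v x + (4 * w ^+ 2 * (5 + 2 * w * l) * e ^+ 2)%:E.
Proof.
have M v : \int[layer v]_x g v x = ((@layer_atom0 R v)%:num * G v 0 +
   ((layer_density omega v)%:num * I v 0 l + (@layer_atomL R v)%:num * G v l))%:E.
  by rewrite ge0_integral_layer// IE// !EFinD !EFinM.
set c := expR (- lam%:num * e).
have BP : (c * (w / 4 * (I Pos2 (2 * e) l + 2 * e * G Pos2 l) + 2^-1 * G Pos2 l +
    2 * w * (e * (w / 4 * I Zero (2 * e) l + 2^-1 * G Zero l))))%:E <= \int[layer Pos2]_x pt g e
      Pos2 x.
  apply: le_trans (layer_ge Pos2); rewrite EFinM EFinD (EFinM (2 * w)%R).
  apply: lee_wpmul2l; first by rewrite lee_fin expR_ge0.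
  apply: (leeD D_Pos2); apply: lee_wpmul2l; first by rewrite lee_fin.
  by rewrite sum_rtp_probE; exact: J_PZ.
have BN : (c * (w / 4 * (I Neg2 0 (l - 2 * e) + 2 * e * G Neg2 0) + 2^-1 * G Neg2 0 +
    2 * w * (e * (2^-1 * G Zero 0 + w / 4 * I Zero 0 (l - 2 * e)))))%:E <= \int[layer Neg2]_x pt
      g e Neg2 x.
  apply: le_trans (layer_ge Neg2); rewrite EFinM EFinD (EFinM (2 * w)%R).
  apply: lee_wpmul2l; first by rewrite lee_fin expR_ge0.
  apply: (leeD D_Neg2); apply: lee_wpmul2l; first by rewrite lee_fin.
  by rewrite sum_rtp_probE; exact: J_NZ.
have BZ : (c * (2^-1 * G Zero 0 + (w / 2 * I Zero 0 l + 2^-1 * G Zero l) +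
    2 * w * (2^-1 * (4^-1 * I Neg2 (l - 2 * e) l + e * (2^-1 * G Neg2 0 + w / 2 * I Neg2 0 (l - 2
      * e))) +
             2^-1 * (4^-1 * I Pos2 0 (2 * e) + e * (w / 2 * I Pos2 (2 * e) l + 2^-1 * G Pos2
               l)))))%:E
    <= \int[layer Zero]_x pt g e Zero x.
  apply: le_trans (layer_ge Zero); rewrite EFinM EFinD (EFinM (2 * w)%R).
  apply: lee_wpmul2l; first by rewrite lee_fin expR_ge0.
  apply: (leeD D_Zero); apply: lee_wpmul2l; first by rewrite lee_fin.
  rewrite sum_rtp_probE EFinD !(EFinM 2^-1%R); apply: leeD.
    by apply: lee_wpmul2l; [rewrite lee_fin|exact: J_ZN].
  by apply: lee_wpmul2l; [rewrite lee_fin|exact: J_ZP].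
rewrite (eq_bigr _ (fun v _ => M v)) sumEFin !big_velocity.
apply: le_trans (leeD (leeD BN (leeD BZ BP)) (lexx _)).
rewrite -!EFinD lee_fin /=.
have e2 : (0 <= 2 * e)%R by rewrite mulr_ge0.
have el' : (0 <= l - 2 * e)%R by rewrite subr_ge0.
have ell : (l - 2 * e <= l)%R by rewrite gerBl.
have IbE v a b : (a <= b)%R -> (0 <= I v a b <= b - a)%R by move=> ab; rewrite I_ge0 I_le.
have Gb v x : (0 <= G v x <= 1)%R by rewrite G0 G1.
have iZ : (I Zero (2 * e)%R l = I Zero 0 l - I Zero 0 (2 * e))%R by rewrite [I Zero 0%R
  l](I_split Zero e2 el); ring.
have iZ' : (I Zero 0%R (l - 2 * e)%R = I Zero 0 l - I Zero (l - 2 * e) l)%R.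
  by rewrite [I Zero 0%R l](I_split Zero el' ell); ring.
have iP := I_split Pos2 e2 el; have iN := I_split Neg2 el' ell.
rewrite -!mulrDr; apply: (@one_step_bound _ w l e c (G Neg2 0%R) (G Zero 0%R) (G Zero l) (G Pos2
  l)
  (I Neg2 0%R (l - 2 * e)%R) (I Neg2 (l - 2 * e)%R l) (I Zero 0%R l) (I Zero 0%R (2 * e)%R)
  (I Zero (l - 2 * e)%R l) (I Pos2 0%R (2 * e)%R) (I Pos2 (2 * e)%R l)) => //.
- by rewrite expR_le1 mulNr oppr_le0 mulr_ge0.
- by apply: le_trans (expR_ge1Dx _); rewrite mulNr.
- by have := IbE Neg2 _ _ ell; rewrite subKr.
- by have := IbE Zero _ _ l0; rewrite subr0.
- by have := IbE Zero _ _ e2; rewrite subr0.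
- by have := IbE Zero _ _ ell; rewrite subKr.
- by have := IbE Pos2 _ _ e2; rewrite subr0.
- by rewrite -iN; have /andP[_] := IbE Neg2 _ _ l0; rewrite subr0.
- by rewrite -iP; have /andP[_] := IbE Pos2 _ _ l0; rewrite subr0.
- by rewrite iP iN; field.
by rewrite iZ iZ'; ring.
Qed.

End one_step.

Let p0 v u : (0 <= rtp_prob v u :> R)%R. Proof. exact: rtp_prob_ge0. Qed.
Let p1 v : (\sum_u rtp_prob v u = 1 :> R)%R. Proof. exact: sum_rtp_prob. Qed.

Lemma semigroup_le1 g t v x : gmeas g -> gnneg g -> (forall u y, g u y <= 1) ->
  (0 <= t)%R -> pt g t v x <= 1.
Proof.
move=> mg g0 g1 t0; rewrite -(semigroup1 lam p0 p1 mflow v x t0).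
by apply: semigroup_mono => //; move=> u; exact: measurable_cst.
Qed.

Let step_const : R := (4 * w ^+ 2 * (5 + 2 * w * l))%R.

Section many_steps.
Variables (G : velocity -> measurableTypeR R -> R).
Hypothesis mG : forall v, measurable_fun setT (G v).
Hypothesis G0 : forall v x, (0 <= G v x)%R.
Hypothesis G1 : forall v x, (G v x <= 1)%R.

Let g v x := (G v x)%:E.
Let mg : gmeas g. Proof. by move=> v; exact/measurable_EFinP. Qed.
Let g0 : gnneg g. Proof. by move=> v x; rewrite lee_fin. Qed.

(** The function obtained after [n] steps still takes values in [[0, 1]], so the one-step estimate
    applies to it and the errors add up; [semigroup_le] merges the new step with the previous
    ones. *)
Let iterate (e : R) n : (0 <= e)%R -> (2 * e <= l)%R ->
  \sum_v \int[layer v]_x g v x <=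
  \sum_v \int[layer v]_x pt g (n%:R * e)%R v x + (n%:R * (step_const * e ^+ 2))%:E.
Proof.
move=> e0 el; elim: n => [|n ih].
  rewrite !mul0r adde0; apply: lee_sum => v _; apply: le_integral_layer => //.
  - exact: (measurable_semigroup lam p0 mflow _ mg g0 v).
  - by move=> x; exact: semigroup_ge0.
  move=> x xl; apply: le_trans (semigroup_first_jump lam p0 mflow v x mg g0 (lexx _)).
  rewrite mulr0 expR0 mul1e /rtp_flow mulr0 addr0 clip_id// leeDl// mule_ge0// integral_ge0// =>
    u _.
  by apply: sume_ge0 => u' _; rewrite mule_ge0 ?lee_fin.
apply: (le_trans ih) => {ih}; set s := (n%:R * e)%R.
have s0 : (0 <= s)%R by rewrite mulr_ge0.
have mp := measurable_semigroup lam p0 mflow s mg g0.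
have ptg0 : gnneg (pt g s) by move=> v x; exact: semigroup_ge0.
have pt1 v x : pt g s v x <= 1 by apply: semigroup_le1.
have fp v x : (fine (pt g s v x))%:E = pt g s v x.
  by rewrite fineK// ge0_fin_numE// (le_lt_trans (pt1 _ _))// ltry.
have ptE : (fun v x => (fine (pt g s v x))%:E) = pt g s.
  by apply/funext => v; apply/funext => x; rewrite fp.
have h : \sum_v \int[layer v]_x pt g s v x <=
    \sum_v \int[layer v]_x pt (pt g s) e v x + (step_const * e ^+ 2)%:E.
  rewrite -[in leLHS]ptE -[in leRHS]ptE; apply: one_step_invariance => //.
  - by move=> v; apply: measurableT_comp => //; exact: mp.
  - by move=> v x; exact: fine_ge0.
  - by move=> v x; rewrite -lee_fin fp.
apply: (le_trans (leeD h (lexx _))).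
rewrite -addeA -EFinD -[in leRHS]natr1 [in leRHS]mulrDl mul1r (addrC (step_const * _)%R).
rewrite [in leRHS]mulrDl mul1r.
apply: leeD => //; apply: lee_sum => v _; apply: le_integral_layer.
- exact: (measurable_semigroup lam p0 mflow e mp ptg0 v).
- by move=> x; exact: semigroup_ge0.
- exact: (measurable_semigroup lam p0 mflow _ mg g0 v).
- by move=> x; exact: semigroup_ge0.
move=> x xl; rewrite [(s + e)%R]addrC.
apply: (@semigroup_le _ _ _ lam rtp_prob (rtp_flow l) p0 mflow [set y | (0 <= y <= l)%R]) => //.
- by move=> v' u y _ _ /=; exact: rtp_flow_itv.
- by move=> v' u r y u0 r0 /= yl; exact: rtp_flowD.
Qed.

Lemma invariance_ge t : (0 <= t)%R ->
  \sum_v \int[layer v]_x g v x <= \sum_v \int[layer v]_x pt g t v x.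
Proof.
move=> t0; apply/lee_addgt0Pr => eps eps0.
have c0 : (0 <= step_const)%R.
  by rewrite /step_const !mulr_ge0 ?sqr_ge0// addr_ge0// !mulr_ge0.
(* The number [n] of steps must make the step [t / n] at most [l / 2] and the accumulated error
   [step_const * t ^+ 2 / n] at most [eps]. *)
pose b := (2 * t / l + step_const * t ^+ 2 / eps)%R.
have b0 : (0 <= b)%R by rewrite addr_ge0// divr_ge0 ?mulr_ge0 ?sqr_ge0// ltW.
have [n bn] : exists n, (b <= n.+1%:R)%R.
  exists (Num.bound b); rewrite (le_trans (ltW (archi_boundP b0)))// ler_nat.
  exact: leqnSn.
have n0 : (0 < n.+1%:R :> R)%R by rewrite ltr0n.
have h1 : (2 * (t / n.+1%:R) <= l)%R.
  rewrite mulrA ler_pdivrMr// [leRHS]mulrC -ler_pdivrMr//; apply: le_trans bn.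
  by rewrite lerDl divr_ge0 ?mulr_ge0 ?sqr_ge0// ltW.
have e0 : (0 <= t / n.+1%:R)%R by rewrite divr_ge0// ltW.
apply: le_trans (iterate n.+1 e0 h1) _.
rewrite (_ : (n.+1%:R * (t / n.+1%:R))%R = t); last first.
  by rewrite mulrC divfK// gt_eqF.
rewrite leeD2l// lee_fin.
rewrite (_ : (_ * _)%R = (step_const * t ^+ 2 / n.+1%:R)%R); last first.
  by field; rewrite gt_eqF.
rewrite ler_pdivrMr// [leRHS]mulrC -ler_pdivrMr//; apply: le_trans bn.
by rewrite lerDr divr_ge0// mulr_ge0.
Qed.

End many_steps.

(** The integrals of [G] and [1 - G] add up to the total mass both at time [0] and at time [t]; as
    neither can decrease, neither can increase. *)
Theorem invariance_le1 (G : velocity -> measurableTypeR R -> R) t : (0 <= t)%R ->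
  (forall v, measurable_fun setT (G v)) ->
  (forall v x, (0 <= G v x <= 1)%R) ->
  \sum_v \int[layer v]_x pt (fun u y => (G u y)%:E) t v x =
  \sum_v \int[layer v]_x (G v x)%:E.
Proof.
move=> t0 mG G01.
have G0 v x : (0 <= G v x)%R by case/andP: (G01 v x).
have G1 v x : (G v x <= 1)%R by case/andP: (G01 v x).
pose H v x : R := (1 - G v x)%R.
have mH v : measurable_fun setT (H v) by exact: measurable_funB.
have H0 v x : (0 <= H v x)%R by rewrite subr_ge0.
have H1 v x : (H v x <= 1)%R by rewrite gerBl.
have mg : gmeas (fun u y => (G u y)%:E) by move=> v; exact/measurable_EFinP.
have mh : gmeas (fun u y => (H u y)%:E) by move=> v; exact/measurable_EFinP.
have g0 : gnneg (fun u y => (G u y)%:E) by move=> v x; rewrite lee_fin.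
have h0 : gnneg (fun u y => (H u y)%:E) by move=> v x; rewrite lee_fin.
have geG := invariance_ge mG G0 G1 t0.
have geH := invariance_ge mH H0 H1 t0.
have mpg := measurable_semigroup lam p0 mflow t mg g0.
have mph := measurable_semigroup lam p0 mflow t mh h0.
have massE : \sum_v \int[layer v]_x (G v x)%:E + \sum_v \int[layer v]_x (H v x)%:E =
    \sum_v (layer_mass omega L v)%:E.
  rewrite -big_split; apply: eq_bigr => v _ /=; rewrite -ge0_integralD//.
  under eq_integral do rewrite -EFinD addrC subrK.
  by rewrite integral_cst// mul1e layer_measureT.
have massP : \sum_v \int[layer v]_x pt (fun u y => (G u y)%:E) t v x +
    \sum_v \int[layer v]_x pt (fun u y => (H u y)%:E) t v x =
    \sum_v (layer_mass omega L v)%:E.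
  rewrite -big_split; apply: eq_bigr => v _ /=; rewrite -ge0_integralD//; last 4 first.
  - by move=> x _; exact: semigroup_ge0.
  - exact: mpg.
  - by move=> x _; exact: semigroup_ge0.
  - exact: mph.
  rewrite (eq_integral (cst 1)); last first.
    move=> x _; rewrite -semigroupD// -(semigroup1 lam p0 p1 mflow v x t0).
    congr (pt _ t v x); apply/funext => u; apply/funext => y.
    by rewrite -EFinD addrC subrK.
  by rewrite integral_cst// mul1e layer_measureT.
have S0 (F : velocity -> measurableTypeR R -> \bar R) :
  (forall v x, 0 <= F v x) -> 0 <= \sum_v \int[layer v]_x F v x.
  by move=> F0; apply: sume_ge0 => v _; exact: integral_ge0.
have pg0 : gnneg (pt (fun u y => (G u y)%:E) t) by move=> v x; exact: semigroup_ge0.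
have ph0 : gnneg (pt (fun u y => (H u y)%:E) t) by move=> v x; exact: semigroup_ge0.
move: massE massP geG geH.
have := S0 _ pg0; have := S0 _ ph0; have := S0 _ g0; have := S0 _ h0.
rewrite sumEFin.
move: (\sum_v \int[layer v]_x pt (fun u y => (G u y)%:E) t v x)
  (\sum_v \int[layer v]_x pt (fun u y => (H u y)%:E) t v x)
  (\sum_v \int[layer v]_x (G v x)%:E) (\sum_v \int[layer v]_x (H v x)%:E) => a b c d.
move: a b c d => [a||] [b||] [c||] [d||]//=; rewrite -?EFinD ?lee_fin.
by move=> _ _ _ _ [cd] [ab] ca db; congr EFin; lra.
Qed.

End invariance.

(** * Decay in mean square *)

Section real_bounds.
Context {R : realFieldType}.

(** Compares the amplitudes of the two velocity modes with the mean square weighted by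
    [1 : 2 : 1]. *)
Lemma mode_norm_le (p n z : R) :
  (`|(p - n) / 2| + `|z|) ^+ 2 <= n ^+ 2 + 2 * z ^+ 2 + p ^+ 2.
Proof.
have := sqr_ge0 (`|(p - n) / 2| - `|z|); rewrite sqrrB sqrrD !real_normK ?num_real//.
have := sqr_ge0 (p + n); rewrite exprMn sqrrB sqrrD exprVn; lra.
Qed.

Lemma sqrD_le_double (a b x y : R) : a ^+ 2 <= x -> b ^+ 2 <= y -> (a + b) ^+ 2 <= 2 * x + 2 * y.
Proof. by move=> ax bY; have := sqr_ge0 (a - b); rewrite sqrrB sqrrD; lra. Qed.

Lemma combine_bounds (c e x y z : R) : x <= 4 * c * y -> z <= 4 * y * e ->
  2 * x + 2 * z <= (8 * c + 8 * e) * y.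
Proof. lra. Qed.

End real_bounds.

(** * The Cauchy-Schwarz inequality against a constant *)

Section cauchy_schwarz.
Local Open Scope ereal_scope.
Context d (T : measurableType d) {R : realType} (m : {measure set T -> \bar R}).

(** Discriminant argument: [s = r / n] is the optimal choice; when [n = 0], a positive [r] is
    excluded by [s = (B + 1) / r]. *)
Lemma sqr_ge0_linear_bound (r n B : R) : (0 <= r)%R -> (0 <= n)%R ->
  (forall s, 0 <= s -> 2 * s * r <= B + s ^+ 2 * n)%R -> (r ^+ 2 <= n * B)%R.
Proof.
move=> r0 n0 h; have B0 : (0 <= B)%R by have := h 0%R (lexx _);
  rewrite !mulr0 mul0r expr0n mul0r addr0.
have [n00|n0'] := eqVneq n 0%R.
  rewrite n00 mul0r; have [->|rn] := eqVneq r 0%R; first by rewrite expr0n.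
  have rp : (0 < r)%R by rewrite lt_neqAle eq_sym rn.
  have := h ((B + 1) / r)%R; rewrite n00 mulr0 addr0 divr_ge0 ?addr_ge0// => /(_ isT).
  rewrite -mulrA divfK ?gt_eqF// => ?; exfalso; lra.
have np : (0 < n)%R by rewrite lt_neqAle eq_sym n0'.
have := h (r / n)%R; rewrite divr_ge0// => /(_ isT).
have -> : (2 * (r / n) * r = 2 * (r ^+ 2 / n))%R by ring.
have -> : ((r / n) ^+ 2 * n = r ^+ 2 / n)%R by field.
move=> h'; rewrite mulrC -ler_pdivrMr//; lra.
Qed.

(** Integrating [2 * s * |f| <= f ^+ 2 + s ^+ 2] for every [s >= 0] avoids assuming that [f] is
    integrable: [s = 1] shows that it is, and optimising in [s] gives the bound. *)
Lemma integral_norm_le_sqrt (A : set T) (f : T -> R) (n B : R) :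
  measurable A -> measurable_fun A f -> m A <= n%:E ->
  \int[m]_(x in A) (f x ^+ 2)%:E <= B%:E ->
  \int[m]_(x in A) (`|f x|)%:E <= (Num.sqrt (n * B))%:E.
Proof.
move=> mA mf mAn fB; set a := \int[m]_(x in A) _.
have a0 : 0 <= a by exact: integral_ge0.
have n0 : (0 <= n)%R by rewrite -lee_fin; exact: le_trans mAn.
have mn : measurable_fun A (fun x => `|f x|%R) by exact: measurableT_comp.
have ms : measurable_fun A (fun x => f x ^+ 2)%R by exact: measurable_funX.
have key s : (0 <= s)%R -> (2 * s)%:E * a <= (B + s ^+ 2 * n)%:E.
  move=> s0; rewrite -ge0_integralZl//; last 2 first.
  - exact/measurable_EFinP.
  - by rewrite lee_fin mulr_ge0.
  apply: (@le_trans _ _ (\int[m]_(x in A) ((f x ^+ 2)%:E + (s ^+ 2)%:E))).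
    apply: ge0_le_integral => //.
    - by move=> x _; rewrite -EFinM lee_fin !mulr_ge0.
    - by apply: emeasurable_funM => //; exact/measurable_EFinP.
    - by apply: emeasurable_funD => //; exact/measurable_EFinP.
    - move=> x _; rewrite -EFinM -EFinD lee_fin -subr_ge0.
      have -> : (f x ^+ 2 + s ^+ 2 - 2 * s * `|f x| = (`|f x| - s) ^+ 2)%R.
        by rewrite -(real_normK (num_real (f x))); ring.
      exact: sqr_ge0.
  rewrite ge0_integralD//; last 3 first.
  - by move=> x _; rewrite lee_fin sqr_ge0.
  - exact/measurable_EFinP.
  - by move=> x _; rewrite lee_fin sqr_ge0.
  rewrite integral_cst// EFinD (EFinM (s ^+ 2)%R); apply: leeD => //.
  by rewrite lee_wpmul2l// lee_fin sqr_ge0.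
have afin : a \is a fin_num.
  rewrite ge0_fin_numE//; have := key 1%R ler01; rewrite mulr1 => h.
  rewrite -(@lte_pmul2l _ 2%:E)//; apply: (le_lt_trans h).
  by rewrite mulry gtr0_sg// mul1e ltry.
rewrite -(fineK afin) lee_fin; set r := fine a.
have r0 : (0 <= r)%R by exact: fine_ge0.
rewrite -(ger0_norm r0) -sqrtr_sqr ler_wsqrtr// sqr_ge0_linear_bound//.
by move=> s s0; rewrite -lee_fin EFinM /r fineK// key.
Qed.

End cauchy_schwarz.

(** * Means of bounded functions under a finite measure *)

Section bounded_mfun.
Context d (S : measurableType d) {R : realType}.
Implicit Types f g : S -> R.

Definition bounded_mfun (f : S -> R) :=
  measurable_fun setT f /\ exists M, forall x, (`|f x| <= M)%R.

Lemma bounded_mfun_cst (r : R) : bounded_mfun (fun _ : S => r).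
Proof. by split; [exact: measurable_cst|exists `|r|%R]. Qed.

Lemma bounded_mfunD (f g : S -> R) :
  bounded_mfun f -> bounded_mfun g -> bounded_mfun (fun x => f x + g x)%R.
Proof.
move=> [mf [M fM]] [mg [N gN]]; split; first exact: measurable_funD.
by exists (M + N)%R => x; rewrite (le_trans (ler_normD _ _))// lerD.
Qed.

Lemma bounded_mfunDr (r : R) (f : S -> R) :
  bounded_mfun f -> bounded_mfun (fun x => f x + r)%R.
Proof. by move=> bf; apply: bounded_mfunD => //; exact: bounded_mfun_cst. Qed.

Lemma bounded_mfunM (f g : S -> R) :
  bounded_mfun f -> bounded_mfun g -> bounded_mfun (fun x => f x * g x)%R.
Proof.
move=> [mf [M fM]] [mg [N gN]]; split; first exact: measurable_funM.
by exists (M * N)%R => x; rewrite normrM ler_pM.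
Qed.

Lemma bounded_mfunZ (r : R) (f : S -> R) :
  bounded_mfun f -> bounded_mfun (fun x => r * f x)%R.
Proof. by apply: bounded_mfunM; exact: bounded_mfun_cst. Qed.

Lemma bounded_mfunN (f : S -> R) :
  bounded_mfun f -> bounded_mfun (fun x => - f x)%R.
Proof.
move=> /(bounded_mfunZ (-1)); congr bounded_mfun.
by apply/funext => x; rewrite mulN1r.
Qed.

Lemma bounded_mfunB (f g : S -> R) :
  bounded_mfun f -> bounded_mfun g -> bounded_mfun (fun x => f x - g x)%R.
Proof. by move=> bf /bounded_mfunN; exact: bounded_mfunD. Qed.

Lemma bounded_mfun_sqr (f : S -> R) :
  bounded_mfun f -> bounded_mfun (fun x => f x ^+ 2)%R.
Proof. by move=> bf; under eq_fun do rewrite expr2; exact: bounded_mfunM. Qed.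

End bounded_mfun.

Lemma bounded_mfun_comp d d' (S : measurableType d) (S' : measurableType d') {R : realType}
    (f : S -> R) (phi : S' -> S) :
  measurable_fun setT phi -> bounded_mfun f -> bounded_mfun (f \o phi).
Proof. by move=> mphi [mf [M fM]]; split; [exact: measurableT_comp|exists M => x /=]. Qed.

Section finite_mean.
Local Open Scope ereal_scope.
Context d (T : measurableType d) {R : realType} (m : {measure set T -> \bar R}) (c : R).
Hypothesis mc : m setT = c%:E.
Implicit Types f g h : T -> R.

Definition mean f : R := fine (\int[m]_x (f x)%:E).

Lemma bounded_mfun_integrable f : bounded_mfun f -> m.-integrable setT (EFin \o f).
Proof.
move=> [mf [M fM]]; apply: measurable_bounded_integrable => //.
  by rewrite /= mc ltry.
exists M; split; first exact: num_real.
by move=> N MN x _ /=; rewrite (le_trans (fM x))// ltW.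
Qed.

Lemma meanE f : bounded_mfun f -> \int[m]_x (f x)%:E = (mean f)%:E.
Proof.
move=> bf; rewrite /mean fineK//.
exact: (integrable_fin_num measurableT (bounded_mfun_integrable bf)).
Qed.

Lemma meanD f g : bounded_mfun f -> bounded_mfun g ->
  mean (fun x => f x + g x)%R = (mean f + mean g)%R.
Proof.
move=> bf bg; apply: EFin_inj; rewrite EFinD -!meanE//; last exact: bounded_mfunD.
by rewrite -integralD_EFin//; exact: bounded_mfun_integrable.
Qed.

Lemma meanZ r f : bounded_mfun f -> mean (fun x => r * f x)%R = (r * mean f)%R.
Proof.
move=> bf; apply: EFin_inj; rewrite EFinM -!meanE//; last exact: bounded_mfunZ.
by rewrite -integralZl//; exact: bounded_mfun_integrable.
Qed.

Lemma mean_cst r : mean (fun=> r) = (r * c)%R.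
Proof.
by apply: EFin_inj; rewrite -meanE ?integral_cst// ?mc ?EFinM//; exact: bounded_mfun_cst.
Qed.

Lemma meanB f g : bounded_mfun f -> bounded_mfun g ->
  mean (fun x => f x - g x)%R = (mean f - mean g)%R.
Proof.
move=> bf bg; rewrite meanD//; last exact: bounded_mfunN.
rewrite -[(- mean g)%R]mulN1r -meanZ//; congr (_ + mean _)%R.
by apply/funext => x; rewrite mulN1r.
Qed.

Lemma le_mean f g : bounded_mfun f -> bounded_mfun g ->
  (forall x, f x <= g x)%R -> (mean f <= mean g)%R.
Proof.
move=> bf bg fg; rewrite -subr_ge0 -meanB//.
by apply: fine_ge0; apply: integral_ge0 => x _; rewrite lee_fin subr_ge0.
Qed.

Lemma mean_ge0 f : (forall x, 0 <= f x)%R -> (0 <= mean f)%R.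
Proof. by move=> f0; apply: fine_ge0; apply: integral_ge0 => x _; rewrite lee_fin. Qed.

(** Cauchy-Schwarz against the indicator of [A], meant for the event that two coupled positions
    differ, where the gain is the smallness of [n]. *)
Lemma mean_sqr_le_set (A : set T) (n : R) f : bounded_mfun f -> measurable A ->
  m A <= n%:E -> (forall x, ~ A x -> f x = 0%R) ->
  (mean f ^+ 2 <= n * mean (fun x => f x ^+ 2))%R.
Proof.
move=> bf mA mAn fA; have n0 : (0 <= n)%R by rewrite -lee_fin; exact: le_trans mAn.
have B0 : (0 <= mean (fun x => f x ^+ 2))%R by apply: mean_ge0 => x; exact: sqr_ge0.
have mf : measurable_fun setT f by case: bf.
have h : (`|mean f| <= Num.sqrt (n * mean (fun x => f x ^+ 2)))%R.
  rewrite -lee_fin.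
  apply: (@le_trans _ _ (\int[m]_x (`|f x|)%:E)).
    rewrite -[leLHS]/(`|(mean f)%:E|) -meanE//.
    by apply: le_abse_integral => //; exact/measurable_EFinP.
  have <- : \int[m]_(x in A) (`|f x|)%:E = \int[m]_x (`|f x|)%:E.
    rewrite integral_mkcond; apply: eq_integral => x _; rewrite patchE.
    by case: ifPn => //; rewrite notin_setE => /fA ->; rewrite normr0.
  apply: integral_norm_le_sqrt => //; first exact: measurable_funTS.
  rewrite -meanE; last exact: bounded_mfun_sqr.
  apply: ge0_subset_integral => //.
  - by apply/measurable_EFinP; exact: measurable_funX.
  - by move=> x _; rewrite lee_fin sqr_ge0.
rewrite -(real_normK (num_real (mean f))) -[leRHS]sqr_sqrtr ?mulr_ge0//.
by rewrite ler_pXn2r// nnegrE// sqrtr_ge0.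
Qed.

Lemma mean_sqr_le f : bounded_mfun f -> (mean f ^+ 2 <= c * mean (fun x => f x ^+ 2))%R.
Proof. by move=> bf; apply: (@mean_sqr_le_set setT) => //; [rewrite mc|move=> x /(_ I)]. Qed.

(** The deviation of [h x] from its average is the average over [y] of [h x - h y]. Cauchy-Schwarz
    moves the square inside, and averaging [q x + q y] counts [mean q] twice. *)
Lemma variance_le (h q : T -> R) (K : R) : (0 < c)%R -> (0 <= K)%R ->
  bounded_mfun h -> bounded_mfun q ->
  (forall x y, (h x - h y) ^+ 2 <= K * (q x + q y))%R ->
  (mean (fun x => (h x - c^-1 * mean h) ^+ 2) <= 2 * K * mean q)%R.
Proof.
move=> c0 K0 bh bq hq.
have pointwise x : ((h x - c^-1 * mean h) ^+ 2 <= K * q x + K * c^-1 * mean q)%R.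
  have bhx : bounded_mfun (fun y => h x - h y)%R by apply: bounded_mfunB => //;
    exact: bounded_mfun_cst.
  have -> : (h x - c^-1 * mean h = c^-1 * mean (fun y => h x - h y))%R.
    rewrite meanB//; last exact: bounded_mfun_cst.
    by rewrite mean_cst; field; rewrite gt_eqF.
  have qc : bounded_mfun (fun y => K * (q x + q y))%R.
    by apply: bounded_mfunZ; apply: bounded_mfunD => //; exact: bounded_mfun_cst.
  have h1 := mean_sqr_le bhx; have h2 := le_mean (bounded_mfun_sqr bhx) qc (hq x).
  rewrite exprMn; apply: (@le_trans _ _ (c^-1 ^+ 2 * (c * (K * (q x * c + mean q))))%R).
    rewrite ler_wpM2l ?sqr_ge0// (le_trans h1)// ler_wpM2l ?(ltW c0)//.
    apply: (le_trans h2); rewrite meanZ ?meanD ?mean_cst//; first exact: bounded_mfun_cst.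
    by apply: bounded_mfunD => //; exact: bounded_mfun_cst.
  by apply: eq_leW; field; rewrite gt_eqF.
have bl : bounded_mfun (fun x => (h x - c^-1 * mean h) ^+ 2)%R.
  by apply: bounded_mfun_sqr; apply: bounded_mfunB => //; exact: bounded_mfun_cst.
have br : bounded_mfun (fun x => K * q x + K * c^-1 * mean q)%R.
  by apply: bounded_mfunD; [exact: bounded_mfunZ|exact: bounded_mfun_cst].
apply: le_trans (le_mean bl br pointwise) _.
rewrite (meanD (bounded_mfunZ K bq) (bounded_mfun_cst T _)) (meanZ K bq) mean_cst.
by apply: eq_leW; field; rewrite gt_eqF.
Qed.

End finite_mean.

(** * Approximation by bounded centred functions *)

Section bounded_approximation.
Local Open Scope ereal_scope.
Context d (T : measurableType d) {R : realType} (m : {measure set T -> \bar R}).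
Hypothesis m1 : m setT = 1%:E.

(** Truncations converge in mean square, the errors being dominated by [f ^+ 2]; subtracting the
    mean of the truncation restores centring. *)
Lemma bounded_approximation (f : T -> R) (eps : R) : (0 < eps)%R ->
  measurable_fun setT f -> \int[m]_x (f x ^+ 2)%:E < +oo -> \int[m]_x (f x)%:E = 0 ->
  exists g, [/\ bounded_mfun g, mean m g = 0%R &
    \int[m]_x ((f x - g x) ^+ 2)%:E <= eps%:E].
Proof.
move=> eps0 mf f2 f0.
pose tr (n : nat) x : R := Num.max (- n%:R)%R (Num.min (f x) n%:R%R).
have mtr n : measurable_fun setT (tr n).
  by apply: measurable_maxr => //; exact: measurable_minr.
have btr n : bounded_mfun (tr n).
  split => //; exists n%:R => x;
    rewrite ler_norml /tr le_max lexx/= ge_max ge_min lexx orbT andbT.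
  by rewrite (le_trans _ (ler0n _ n))// oppr_le0.
have dtr n x : ((f x - tr n x) ^+ 2 <= f x ^+ 2)%R.
  have n0 : (0 <= n%:R :> R)%R by [].
  rewrite -[leRHS]real_normK ?num_real// -[leLHS]real_normK ?num_real//.
  rewrite ler_pXn2r ?nnegrE//.
  rewrite /tr /Num.max /Num.min; case: (ltP (f x)) => h1; case: (ltP (- n%:R)%R) => h2;
    rewrite ?subrr ?normr0//.
  - by rewrite opprK !ler0_norm; lra.
  - by rewrite !ger0_norm; lra.
  - have e : (- n%:R = 0 :> R)%R by lra.
    by rewrite e subr0.
have m2 n : measurable_fun setT (fun x => ((f x - tr n x) ^+ 2)%:E).
  by apply/measurable_EFinP; apply: measurable_funX; exact: measurable_funB.
have i2 : m.-integrable setT (fun x => (f x ^+ 2)%:E).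
  apply/integrableP; split; first by apply/measurable_EFinP; exact: measurable_funX.
  by under eq_integral do rewrite gee0_abs ?lee_fin ?sqr_ge0//.
have cv0 : \int[m]_x ((f x - tr n x) ^+ 2)%:E @[n --> \oo] --> \int[m]_x (cst 0 x).
  apply: (@dominated_cvg _ _ _ m setT measurableT _ _ (fun x => (f x ^+ 2)%:E)) => //.
  - move=> x _; apply: cvg_near_cst; near=> n.
    have fn : (`|f x| <= n%:R)%R.
      near: n; exists (Num.bound `|f x|) => // n /= bn.
      by rewrite (le_trans (ltW (archi_boundP (normr_ge0 _))))// ler_nat.
    move: fn; rewrite ler_norml => /andP[h1 h2].
    by rewrite /tr min_l// max_r// subrr expr0n.
  - by move=> n x _; rewrite gee0_abs lee_fin ?sqr_ge0.
have [n en] : exists n, \int[m]_x ((f x - tr n x) ^+ 2)%:E <= (eps / 4)%:E.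
  have e4 : (0 < eps / 4)%R by rewrite divr_gt0.
  move: cv0; rewrite integral0 => /fine_cvgP[[N1 _ fin]] /cvgrPdist_lt /(_ _ e4)[N2 _ h].
  exists (maxn N1 N2); have fin' := fin (maxn N1 N2) (leq_maxl _ _).
  have := h (maxn N1 N2) (leq_maxr _ _); rewrite /= sub0r normrN => h'.
  by rewrite -(fineK fin') lee_fin (le_trans (ler_norm _))// ltW.
set e := \int[m]_x _ in en.
pose r := mean m (tr n); have bn := btr n.
(* As [f] is centred, [r] is up to sign the mean of the truncation error, and Cauchy-Schwarz bounds
   its square by the same [eps / 4]. *)
have r2 : (r ^+ 2 <= eps / 4)%R.
  have iN : m.-integrable setT (EFin \o f).
    apply/integrableP; split; first exact/measurable_EFinP.
    have fin2 : \int[m]_x (f x ^+ 2)%:E \is a fin_num.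
      by rewrite ge0_fin_numE//; apply: integral_ge0 => x _; rewrite lee_fin sqr_ge0.
    apply: (@le_lt_trans _ _ (Num.sqrt (1 * fine (\int[m]_x (f x ^+ 2)%:E)))%:E);
      last exact: ltry.
    by apply: integral_norm_le_sqrt => //; rewrite ?m1// fineK.
  have iT := bounded_mfun_integrable m1 bn.
  have h : (`|r| <= Num.sqrt (1 * (eps / 4)))%R.
    rewrite -lee_fin -[leLHS]/(`|r%:E|).
    have -> : r%:E = \int[m]_x ((tr n x)%:E - (f x)%:E).
      by rewrite integralB_EFin// f0 sube0 (meanE m1 bn).
    apply: (@le_trans _ _ (\int[m]_x (`|f x - tr n x|)%:E)).
      apply: (le_trans (le_abse_integral m measurableT _)).
        by apply: emeasurable_funB; apply/measurable_EFinP.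
      apply: eq_leW; apply: eq_integral => x _.
      by rewrite -EFinB abse_EFin distrC.
    apply: integral_norm_le_sqrt => //; last by rewrite m1.
    exact: measurable_funB.
  rewrite -(real_normK (num_real r)) -[leRHS](@sqr_sqrtr _ (eps / 4)) ?divr_ge0 ?(ltW eps0)//.
  by rewrite ler_pXn2r ?nnegrE ?sqrtr_ge0//; move: h; rewrite mul1r.
exists (fun x => tr n x - r)%R; split.
- by apply: bounded_mfunB => //; exact: bounded_mfun_cst.
- by rewrite (meanB m1 bn (bounded_mfun_cst _ _)) (mean_cst m1) mulr1 subrr.
apply: (@le_trans _ _ (\int[m]_x (2%:E * ((f x - tr n x) ^+ 2)%:E + (2 * r ^+ 2)%:E))).
  apply: ge0_le_integral => //.
  - by move=> x _; rewrite lee_fin sqr_ge0.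
  - apply/measurable_EFinP; apply: measurable_funX; apply: measurable_funB => //.
    exact: measurable_funB.
  - by apply: emeasurable_funD => //; exact: emeasurable_funM.
  - move=> x _; rewrite -EFinM -EFinD lee_fin.
    have -> : (f x - (tr n x - r) = (f x - tr n x) + r)%R by ring.
    exact: sqrD_le_double.
rewrite ge0_integralD//; last 3 first.
- by move=> x _; rewrite mule_ge0// lee_fin sqr_ge0.
- exact: emeasurable_funM.
- by move=> x _; rewrite lee_fin mulr_ge0// sqr_ge0.
rewrite ge0_integralZl//; last by move=> x _; rewrite lee_fin sqr_ge0.
rewrite integral_cst// m1 mule1.
apply: (@le_trans _ _ (2%:E * (eps / 4)%:E + (2 * r ^+ 2)%:E)).
  by apply: leeD => //; apply: lee_wpmul2l.
rewrite -EFinM -EFinD lee_fin; lra.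
Unshelve. all: by end_near. Qed.

End bounded_approximation.

Lemma measurable_slices d1 d2 (T1 : measurableType d1) (T2 : measurableType d2)
    (f : T1 * velocity -> T2) :
  (forall v, measurable_fun setT (fun x => f (x, v))) -> measurable_fun setT f.
Proof.
move=> mf _ Y mY; rewrite setTI.
have -> : f @^-1` Y =
    \bigcup_(v in [set: velocity]) (((fun x => f (x, v)) @^-1` Y) `*` [set v]).
  apply/seteqP; split => [[x v] /= Yf|[x v] [u _ /= [Yf ->]]//].
  by exists v.
apply: fin_bigcup_measurable => [|v _]; first exact: finite_finset.
apply: measurableX => //; first by rewrite -[X in measurable X]setTI; exact: mf.
Qed.

(** * Coupling, invariance and decay for the jamming process *)

Section jamming_process.
Local Open Scope ereal_scope.
Context {R : realType} (omega L : {posnum R}).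
Context d (Omega : measurableType d) (P : velocity -> probability Omega R).
Context (T : nat -> Omega -> R) (V : nat -> Omega -> velocity).
Notation w := (omega%:num).
Notation l := (L%:num).
Notation mu := (rtp_invariant omega L).
Notation lam := (jump_rate omega).
Notation pt := (semigroup lam rtp_prob (rtp_flow l)).
Notation layer := (layer_measure omega L).
Notation pos := (rtp_position l T V).
Hypothesis jp : forall v, is_jump_process (rtp_rate w) v (P v) T V.

Let l0 : (0 <= l)%R. Proof. by []. Qed.
Let mflow := @measurable_rtp_flow R l.
Let p0 v u : (0 <= rtp_prob v u :> R)%R. Proof. exact: rtp_prob_ge0. Qed.
Let p1 v : (\sum_u rtp_prob v u = 1 :> R)%R. Proof. exact: sum_rtp_prob. Qed.
Let w0 : (0 < w)%R. Proof. by []. Qed.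
Let q0 u u' : (0 <= rtp_rate w u u')%R. Proof. by rewrite rtp_rate_ge0. Qed.
Let exitE u : exit_rate (rtp_rate w) u = lam%:num. Proof. by rewrite exit_rate_rtp. Qed.

Definition rtp_state (x t : R) (om : Omega) : state R :=
  (pos x t om, rtp_velocity T V t om).

Let positionE x n om : position_at_jump l T V x n om = path_state T V (rtp_flow l) x n om.
Proof. by elim: n => //= n ->. Qed.

Let rtp_positionE x t om : pos x t om = state_at T V (rtp_flow l) x t om.
Proof. by rewrite /rtp_position positionE. Qed.

(** The law [P v] depends on the initial velocity only, so following the positions from [x] and [x']
    along the same [om] is already the coupling. *)
Let pair_path x x' n om : path_state T V (pair_flow l) (x, x') n om =
  (path_state T V (rtp_flow l) x n om, path_state T V (rtp_flow l) x' n om).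
Proof. by elim: n => //= n ->. Qed.

Let pair_state_at x x' t om : state_at T V (pair_flow l) (x, x') t om =
  (pos x t om, pos x' t om).
Proof. by rewrite !rtp_positionE /state_at pair_path. Qed.

Lemma measurable_rtp_state x t : measurable_fun setT (rtp_state x t).
Proof.
have := @measurable_state_at_fun _ _ _ _ _ _ _ _ (jp Zero) _ _ (rtp_flow l) mflow x t
  _ (state R) (fun v y => (y, v)).
rewrite (_ : (fun om => _) = rtp_state x t); last first.
  by apply/funext => om; rewrite /rtp_state rtp_positionE.
by apply => v; exact: pair2_measurable.
Qed.

Definition rtp_mean (t : R) (k : state R -> \bar R) (z : state R) : \bar R :=
  \int[P z.2]_om k (rtp_state z.1 t om).

Definition slice (k : state R -> \bar R) (u : velocity) (y : measurableTypeR R) := k (y, u).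

Let gmeas_slice k : measurable_fun setT k -> gmeas (slice k).
Proof. by move=> mk u; exact: (measurableT_comp mk (pair2_measurable u)). Qed.

Lemma rtp_meanE t k x v : (0 <= t)%R -> measurable_fun setT k -> (forall z, 0 <= k z) ->
  rtp_mean t k (x, v) = pt (slice k) t v x.
Proof.
move=> t0 mk k0; rewrite -(jump_prob_rtp w0).
have := expectation_state_at (jp v) q0 exitE mflow x t0 (gmeas_slice mk) (fun u y => k0 (y, u)).
move=> h; apply: etrans h; rewrite /rtp_mean; apply: eq_integral => om _;
  by rewrite /rtp_state rtp_positionE.
Qed.

Lemma measurable_rtp_mean t k : (0 <= t)%R -> measurable_fun setT k -> (forall z, 0 <= k z) ->
  measurable_fun setT (rtp_mean t k).
Proof.
move=> t0 mk k0; apply: measurable_slices => v.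
have := measurable_semigroup lam p0 mflow t (gmeas_slice mk) (fun u y => k0 (y, u)) v.
by apply: eq_measurable_fun => x _; rewrite rtp_meanE.
Qed.

Let measurable_unmerged_set x x' t :
  measurable [set om | pos x t om != pos x' t om].
Proof.
have -> : [set om | pos x t om != pos x' t om] =
    (fun om => pos x t om == pos x' t om) @^-1` [set false].
  by apply/seteqP; split => om /=; [move/negbTE|move=> ->].
rewrite -[X in measurable X]setTI.
apply: (@measurable_fun_eqr _ _ _ _ _ _ _ _ measurableT [set false]) => //.
  exact: (measurableT_comp measurable_fst (measurable_rtp_state x t)).
exact: (measurableT_comp measurable_fst (measurable_rtp_state x' t)).
Qed.

Lemma unmerged_prob_le v x x' t : (0 <= t)%R -> (0 <= x <= l)%R -> (0 <= x' <= l)%R ->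
  P v [set om | pos x t om != pos x' t om] <=
  (merge_const omega L * expR (- merge_rate omega L * t))%:E.
Proof.
move=> t0; wlog xx' : x x' / (x <= x')%R => [wlg xl x'l|].
  have [/wlg|/ltW /wlg] := leP x x'; first exact.
  by move=> /(_ x'l xl); under eq_fun do rewrite eq_sym.
move=> /andP[x0 xl] /andP[x'0 x'l].
apply: (le_trans _ (@unmerged_le R omega L t v x x' t0 x0 xx' x'l)).
have mpf := @measurable_pair_flow R l.
rewrite -(jump_prob_rtp w0).
have u0 : gnneg (@unmerged R) by move=> ? ?; rewrite /unmerged; case: ifP.
have h := expectation_state_at (jp v) q0 exitE mpf (x, x') t0 (@measurable_unmerged R) u0.
rewrite [leRHS](_ : _ = \int[P v]_om unmerged (rtp_velocity T V t om)
  (state_at T V (pair_flow l) (x, x') t om)); last exact: esym h.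
have mE := measurable_unmerged_set x x' t.
rewrite -[X in P v X]setIT -integral_indic//.
apply: eq_leW; apply: eq_integral => om _.
rewrite pair_state_at /unmerged/= indicE.
have -> : (om \in [set om | pos x t om != pos x' t om]) =
    (pos x t om != pos x' t om) by apply/idP/idP; rewrite inE.
by case: eqP.
Qed.

Let slice_ge0 k : (forall z, 0 <= k z) -> gnneg (slice k).
Proof. by move=> k0 u y; exact: k0. Qed.

Lemma integral_rtp_mean t k : (0 <= t)%R -> measurable_fun setT k -> (forall z, 0 <= k z) ->
  \int[mu]_z rtp_mean t k z =
  ((2 + w * l)^-1)%:E * \sum_v \int[layer v]_x pt (slice k) t v x.
Proof.
move=> t0 mk k0; rewrite ge0_integral_invariant; last 2 first.
- exact: measurable_rtp_mean.
- by move=> z; apply: integral_ge0 => om _.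
congr (_ * _); apply: eq_bigr => v _; apply: eq_integral => x _; exact: rtp_meanE.
Qed.

Let rtp_meanZ t (c : R) k z : (0 <= c)%R -> measurable_fun setT k -> (forall z, 0 <= k z) ->
  rtp_mean t (fun y => c%:E * k y) z = c%:E * rtp_mean t k z.
Proof.
move=> c0 mk k0; rewrite /rtp_mean ge0_integralZl//.
exact: (measurableT_comp mk (measurable_rtp_state z.1 t)).
Qed.

Lemma invariant_bounded t (G : state R -> R) (M : R) : (0 <= t)%R -> (0 < M)%R ->
  measurable_fun setT G -> (forall z, 0 <= G z <= M)%R ->
  \int[mu]_z rtp_mean t (EFin \o G) z = \int[mu]_z (G z)%:E.
Proof.
move=> t0 M0 mG GM; pose H z := (M^-1 * G z)%R.
have mH : measurable_fun setT H by exact: measurable_funM.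
have H01 z : (0 <= H z <= 1)%R.
  have /andP[G0 G1] := GM z; rewrite mulr_ge0 ?invr_ge0 ?(ltW M0)//=.
  by rewrite ler_pdivrMl// mulr1.
have mHe : measurable_fun setT (EFin \o H) by exact/measurable_EFinP.
have H0 z : 0 <= (EFin \o H) z by have /andP[] := H01 z.
have GE : EFin \o G = fun z => M%:E * (EFin \o H) z.
  by apply/funext => z /=; rewrite /H -EFinM mulVKf// gt_eqF.
have inv : \int[mu]_z rtp_mean t (EFin \o H) z = \int[mu]_z (H z)%:E.
  rewrite integral_rtp_mean// ge0_integral_invariant//; congr (_ * _).
  apply: (@invariance_le1 R omega L (fun u y => H (y, u))) => // v.
  exact: (measurableT_comp mH (pair2_measurable v)).
rewrite -[RHS]/(\int[mu]_z (EFin \o G) z) GE.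
rewrite ge0_integralZl//; last by rewrite lee_fin ltW.
rewrite [LHS](eq_integral (fun z => M%:E * rtp_mean t (EFin \o H) z)); last first.
  by move=> z _; apply: rtp_meanZ => //; exact: ltW.
rewrite ge0_integralZl//; last 3 first.
- exact: measurable_rtp_mean.
- by move=> z _; apply: integral_ge0.
- by rewrite lee_fin ltW.
by rewrite inv.
Qed.

(** [invariant_bounded] applies to the truncations of [G], and monotone convergence is used twice,
    inside the expectation and over [mu]. *)
Lemma invariant_le t (G : state R -> R) : (0 <= t)%R ->
  measurable_fun setT G -> (forall z, 0 <= G z)%R ->
  \int[mu]_z rtp_mean t (EFin \o G) z <= \int[mu]_z (G z)%:E.
Proof.
move=> t0 mG G0; pose H (n : nat) z := Num.min (G z) n.+1%:R.
have mH n : measurable_fun setT (H n) by exact: measurable_minr.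
have mHe n : measurable_fun setT (EFin \o H n) by exact/measurable_EFinP.
have H0 n z : (0 <= H n z)%R by rewrite le_min G0/=.
have ndH z : nondecreasing_seq (fun n => (H n z)%:E).
  by move=> m n mn; rewrite lee_fin le_min !ge_min lexx/= ler_nat ltnS mn orbT.
have limH z : limn (fun n => (H n z)%:E) = (G z)%:E.
  apply: cvg_lim => //; apply: cvg_near_cst; near=> n.
  rewrite /H min_l//; near: n; exists (Num.bound (G z)) => // n /= bn.
  rewrite (le_trans (ltW (archi_boundP (G0 z))))// ler_nat.
  exact: leq_trans bn (leqnSn n).
have -> : \int[mu]_z rtp_mean t (EFin \o G) z =
    \int[mu]_z limn (fun n => rtp_mean t (EFin \o H n) z).
  apply: eq_integral => z _; rewrite /rtp_mean -monotone_convergence//.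
  - by apply: eq_integral => om _; rewrite limH.
  - by move=> n; exact: (measurableT_comp (mHe n) (measurable_rtp_state z.1 t)).
  - by move=> n om _; rewrite lee_fin.
  - by move=> om _; exact: ndH.
rewrite monotone_convergence//; last 3 first.
- by move=> n; apply: measurable_rtp_mean => // z; rewrite lee_fin.
- by move=> n z _; apply: integral_ge0 => om _; rewrite lee_fin.
- move=> z _ m n mn; apply: ge0_le_integral => //.
  + by move=> om _; rewrite lee_fin.
  + exact: (measurableT_comp (mHe m) (measurable_rtp_state z.1 t)).
  + exact: (measurableT_comp (mHe n) (measurable_rtp_state z.1 t)).
  + by move=> om _; exact: ndH.
apply: lime_le.
  apply: ereal_nondecreasing_is_cvgn => m n mn; apply: ge0_le_integral => //.
  - by move=> z _; apply: integral_ge0 => om _; rewrite lee_fin.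
  - by apply: measurable_rtp_mean => // z; rewrite lee_fin.
  - by apply: measurable_rtp_mean => // z; rewrite lee_fin.
  move=> z _; apply: ge0_le_integral => //.
  + by move=> om _; rewrite lee_fin.
  + exact: (measurableT_comp (mHe m) (measurable_rtp_state z.1 t)).
  + exact: (measurableT_comp (mHe n) (measurable_rtp_state z.1 t)).
  + by move=> om _; exact: ndH.
apply: nearW => n; rewrite (@invariant_bounded t (H n) n.+1%:R)//.
- apply: ge0_le_integral => //.
  + by move=> z _; rewrite lee_fin.
  + exact/measurable_EFinP.
  + exact/measurable_EFinP.
  + by move=> z _; rewrite lee_fin ge_min lexx.
- by move=> z; rewrite H0 ge_min lexx orbT.
Unshelve. all: by end_near. Qed.

Definition real_mean (t : R) (f : state R -> R) (z : state R) : R :=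
  mean (P z.2) (f \o rtp_state z.1 t).

Let mass1 v : P v setT = 1%:E. Proof. exact: probability_setT. Qed.
Let mu1 : mu setT = 1%:E. Proof. exact: rtp_invariantT. Qed.

Let bounded_path (f : state R -> R) (z : state R) t : bounded_mfun f ->
  bounded_mfun (f \o rtp_state z.1 t).
Proof. by apply: bounded_mfun_comp; exact: measurable_rtp_state. Qed.

Lemma rtp_mean_real (f : state R -> R) z t : bounded_mfun f ->
  rtp_mean t (EFin \o f) z = (real_mean t f z)%:E.
Proof. by move=> bf; rewrite /real_mean -(meanE (mass1 z.2) (bounded_path z t bf)). Qed.

Lemma real_meanD t f g z : bounded_mfun f -> bounded_mfun g ->
  real_mean t (fun y => f y + g y)%R z = (real_mean t f z + real_mean t g z)%R.
Proof.
by move=> bf bg; rewrite /real_mean -(meanD (mass1 z.2) (bounded_path z t bf) (bounded_path z t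
  bg)).
Qed.

Lemma real_meanZ t r f z : bounded_mfun f ->
  real_mean t (fun y => r * f y)%R z = (r * real_mean t f z)%R.
Proof. by move=> bf; rewrite /real_mean -(meanZ (mass1 z.2) r (bounded_path z t bf)). Qed.

Lemma real_mean_cst t r z : real_mean t (fun=> r) z = r.
Proof.
transitivity (mean (P z.2) (fun=> r)); first by [].
by rewrite (mean_cst (mass1 z.2)) mulr1.
Qed.

Lemma real_meanDr t r f z : bounded_mfun f ->
  real_mean t (fun y => f y + r)%R z = (real_mean t f z + r)%R.
Proof. by move=> bf; rewrite real_meanD ?real_mean_cst//; exact: bounded_mfun_cst. Qed.

Lemma le_real_mean t f g z : bounded_mfun f -> bounded_mfun g ->
  (forall y, f y <= g y)%R -> (real_mean t f z <= real_mean t g z)%R.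
Proof.
by move=> bf bg fg; apply: (le_mean (mass1 z.2)) => [||om /=]; [exact: bounded_path..|exact: fg].
Qed.

Lemma real_mean_sqr t f z : bounded_mfun f ->
  (real_mean t f z ^+ 2 <= real_mean t (fun y => f y ^+ 2) z)%R.
Proof.
by move=> bf; have := mean_sqr_le (mass1 z.2) (bounded_path z t bf); rewrite mul1r.
Qed.

Lemma bounded_real_mean t f : (0 <= t)%R -> bounded_mfun f -> bounded_mfun (real_mean t f).
Proof.
move=> t0 bf; have [mf [M fM]] := bf; split; last first.
  exists M => z; rewrite ler_norml; apply/andP; split.
    rewrite -(real_mean_cst t (- M)%R z); apply: le_real_mean => //;
      first exact: bounded_mfun_cst.
    by move=> y; have := fM y; rewrite ler_norml => /andP[].
  rewrite -[leRHS](real_mean_cst t M z); apply: le_real_mean => //; first exact: bounded_mfun_cst.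
  by move=> y; have := fM y; rewrite ler_norml => /andP[].
have bs : bounded_mfun (fun y => f y + M)%R by exact: bounded_mfunDr.
have -> : real_mean t f = (fun z => fine (rtp_mean t (EFin \o (fun y => f y + M)%R) z) - M)%R.
  by apply/funext => z; rewrite rtp_mean_real// real_meanDr//= addrK.
apply: measurable_funB => //; apply: measurableT_comp => //.
apply: measurable_rtp_mean => //; first by apply/measurable_EFinP; case: bs.
by move=> z; rewrite lee_fin -lerBlDr sub0r; have := fM z; rewrite ler_norml => /andP[].
Qed.

(** Adding the constant [N] makes the function nonnegative, so that [invariant_bounded] applies; the
    constant cancels on both sides. *)
Lemma mean_invariant t f : (0 <= t)%R -> bounded_mfun f ->
  mean mu (real_mean t f) = mean mu f.
Proof.
move=> t0 bf; have [mf [M fM]] := bf.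
pose N := (`|M| + 1)%R; have N0 : (0 < N)%R by rewrite ltr_pwDr.
have fN y : (`|f y| <= N)%R by rewrite (le_trans (fM y))// (le_trans (ler_norm M))// lerDl.
have bs : bounded_mfun (fun y => f y + N)%R by exact: bounded_mfunDr.
have br := bounded_real_mean t0 bf.
have := @invariant_bounded t (fun y => f y + N)%R (2 * N)%R t0.
rewrite mulr_gt0// => /(_ isT (proj1 bs)) h.
have {h} : \int[mu]_z rtp_mean t (EFin \o (fun y => f y + N)%R) z = \int[mu]_z (f z + N)%:E.
  apply: h => z; have := fN z; rewrite ler_norml => /andP[h1 h2].
  by apply/andP; split; lra.
rewrite (meanE mu1 bs) (eq_integral (fun z => (real_mean t f z + N)%:E)); last first.
  by move=> z _; rewrite rtp_mean_real// real_meanDr.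
rewrite (@meanE _ _ _ mu _ mu1 (fun z => real_mean t f z + N)%R); last first.
  by exact: bounded_mfunDr.
rewrite (meanD mu1 br (bounded_mfun_cst _ N)) (meanD mu1 bf (bounded_mfun_cst _ N)).
by move=> [/addIr].
Qed.

(** Pointwise estimates hold only for positions in the interval, whereas [le_mean] asks for them on
    all of [state R]. Composing with this map bridges the gap and leaves means under [mu]
    unchanged. *)
Definition clip_state (z : state R) : state R := (clip l z.1, z.2).

Let measurable_clip_state : measurable_fun setT clip_state.
Proof.
apply: measurable_fun_pair; last exact: measurable_snd.
by apply: (@measurable_maxr _ _ _ _ (fun=> 0%R)) => //; apply: measurable_minr.
Qed.

Lemma mean_layer_clip v (u : measurableTypeR R -> R) : bounded_mfun u ->
  mean (layer v) (fun x => u (clip l x)) = mean (layer v) u.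
Proof.
move=> bu; have [mu' [M uM]] := bu.
have mcl : measurable_fun setT (fun x : measurableTypeR R => clip l x : measurableTypeR R).
  by apply: measurable_maxr => //; exact: measurable_minr.
have bc : bounded_mfun (fun x => u (clip l x)) := bounded_mfun_comp mcl bu.
have lv : layer v setT = (layer_mass omega L v)%:E by exact: layer_measureT.
have bM (g : measurableTypeR R -> R) : bounded_mfun g -> bounded_mfun (fun x => g x + M)%R.
  by move=> bg; exact: bounded_mfunDr.
apply: (@addIr _ (mean (layer v) (fun=> M))); apply: EFin_inj.
rewrite -!(meanD lv)//; [|exact: bounded_mfun_cst..].
rewrite -!(meanE lv); [|exact: bM..].
have uM0 x : 0 <= (u x + M)%:E.
  by rewrite lee_fin -lerBlDr sub0r; have := uM x; rewrite ler_norml => /andP[].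
rewrite !ge0_integral_layer//; [|by apply/measurable_EFinP;
  case: (bM _ bu)|by apply/measurable_EFinP; case: (bM _ bc)].
rewrite !clip_id ?lexx ?l0//; congr (_ + (_ * _ + _)).
by apply: eq_integral => x; rewrite inE/= in_itv/= => xl; rewrite clip_id.
Qed.

Lemma mean_layers (f : state R -> R) : bounded_mfun f ->
  mean mu f = ((2 + w * l)^-1 * \sum_v mean (layer v) (fun x => f (x, v)))%R.
Proof.
move=> bf; have [mf [M fM]] := bf.
have lv v : layer v setT = (layer_mass omega L v)%:E by exact: layer_measureT.
have bv v : bounded_mfun (fun x : measurableTypeR R => f (x, v)) :=
  bounded_mfun_comp (pair2_measurable v) bf.
have bM d' (S : measurableType d') (g : S -> R) : bounded_mfun g ->
  bounded_mfun (fun x => g x + M)%R.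
  by move=> bg; exact: bounded_mfunDr.
have fM0 z : 0 <= (f z + M)%:E.
  by rewrite lee_fin -lerBlDr sub0r; have := fM z; rewrite ler_norml => /andP[].
have h : (mean mu f + M = (2 + w * l)^-1 * \sum_v (mean (layer v) (fun x =>
  f (x, v)) + M * layer_mass omega L v))%R.
  apply: EFin_inj; rewrite -[X in (_ + X)%R](mulr1 M) -(mean_cst mu1) -(meanD mu1)//;
    last exact: bounded_mfun_cst.
  rewrite -(meanE mu1); last exact: bM.
  rewrite ge0_integral_invariant//; last by apply/measurable_EFinP; case: (bM _ _ _ bf).
  rewrite EFinM -sumEFin; congr (_ * _); apply: eq_bigr => v _.
  rewrite (meanE (lv v)); last exact: (bM _ _ _ (bv v)).
  by rewrite (meanD (lv v)) ?(mean_cst (lv v))//; exact: bounded_mfun_cst.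
apply: (@addIr _ M%R); rewrite h big_split/= mulrDr; congr (_ + _)%R.
rewrite big_velocity /layer_mass /=; field; rewrite gt_eqF//.
Qed.

Let coupling_const t : R := (merge_const omega L * expR (- merge_rate omega L * t))%R.

Let coupling_const_ge0 t : (0 <= coupling_const t)%R.
Proof. by rewrite mulr_ge0 ?expR_ge0// ltW// merge_const_gt0. Qed.

(** The velocities are shared, so the two terminal values differ only where the positions have not
    merged; Cauchy-Schwarz on that event and [(a - b) ^+ 2 <= 2 * (a ^+ 2 + b ^+ 2)] give the
    bound. *)
Lemma coupling_le t (f : state R -> R) v x x' : (0 <= t)%R -> bounded_mfun f ->
  (0 <= x <= l)%R -> (0 <= x' <= l)%R ->
  ((real_mean t f (x, v) - real_mean t f (x', v)) ^+ 2 <=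
   2 * coupling_const t * (real_mean t (fun y => f y ^+ 2) (x, v) +
                           real_mean t (fun y => f y ^+ 2) (x', v)))%R.
Proof.
move=> t0 bf xl x'l.
have b1 : bounded_mfun (f \o rtp_state x t) := bounded_path (x, v) t bf.
have b2 : bounded_mfun (f \o rtp_state x' t) := bounded_path (x', v) t bf.
have bs1 := bounded_mfun_sqr b1; have bs2 := bounded_mfun_sqr b2.
rewrite /real_mean /= -(meanB (mass1 v) b1 b2).
apply: le_trans (mean_sqr_le_set (mass1 v) (bounded_mfunB b1 b2)
  (measurable_unmerged_set x x' t) (unmerged_prob_le v t0 xl x'l) _) _.
  move=> om /= /negP; rewrite negbK => /eqP e.
  by rewrite /rtp_state e subrr.
rewrite -/(coupling_const t) -mulrA [leRHS]mulrCA ler_wpM2l//.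
rewrite -(meanD (mass1 v) bs1 bs2) -(meanZ (mass1 v) 2%R (bounded_mfunD bs1 bs2)).
apply: (le_mean (mass1 v)).
- exact: bounded_mfun_sqr (bounded_mfunB b1 b2).
- exact: bounded_mfunZ (bounded_mfunD bs1 bs2).
move=> om /=; set a := f _; set b := f _.
have := sqr_ge0 (a + b)%R; rewrite sqrrD sqrrB; lra.
Qed.

Let rtp_position_itv x t om : (0 <= pos x t om <= l)%R.
Proof. exact: clip_itv. Qed.

Let real_mean_clip t (f : state R -> R) : real_mean t (f \o clip_state) = real_mean t f.
Proof.
apply/funext => z; rewrite /real_mean; congr (mean _ _); apply/funext => om /=.
by rewrite /clip_state/= clip_id.
Qed.

Let real_mean_semigroup_le t s (f : state R -> R) v x : (0 <= t)%R -> (0 <= s)%R ->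
  bounded_mfun f -> (0 <= x <= l)%R ->
  (real_mean t (real_mean s f) (x, v) <= real_mean (t + s) f (x, v))%R.
Proof.
move=> t0 s0 bf xl; have [mf [M fM]] := bf.
have bM (g : state R -> R) : bounded_mfun g -> bounded_mfun (fun y => g y + M)%R.
  by move=> bg; exact: bounded_mfunDr.
have fM0 z : (0 <= f z + M)%R.
  by rewrite -lerBlDr sub0r; have := fM z; rewrite ler_norml => /andP[].
have bs := bounded_real_mean s0 bf.
have mk : measurable_fun setT (EFin \o (fun y => f y + M)%R) by apply/measurable_EFinP;
  case: (bM _ bf).
have k0 z : 0 <= (EFin \o (fun y => f y + M)%R) z by rewrite lee_fin.
have := @semigroup_le _ _ _ lam rtp_prob (rtp_flow l) p0 mflow [set y | (0 <= y <= l)%R]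
  _ _ _ t s v x (gmeas_slice mk) (slice_ge0 k0) t0 s0 xl.
move=> h; have {}h := h (fun v' u y _ _ => rtp_flow_itv l0 v' u y)
  (fun v' u r y u0 r0 yl => rtp_flowD l0 v' u0 r0 yl).
have sE : semigroup lam rtp_prob (rtp_flow l) (slice (EFin \o (fun y => f y + M)%R)) s =
    slice (EFin \o (fun y => real_mean s f y + M)%R).
  apply/funext => u; apply/funext => y; rewrite -rtp_meanE// rtp_mean_real ?real_meanDr//.
  exact: bM.
move: h; rewrite sE -!rtp_meanE//; last first.
- move=> z; rewrite lee_fin -real_meanDr//; apply: mean_ge0 => om /=; exact: fM0.
- by apply/measurable_EFinP; case: (bM _ bs).
- by rewrite addr_ge0.
by rewrite !rtp_mean_real ?real_meanDr ?lee_fin ?lerD2r//; exact: bM.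
Qed.

(** The inequality applied to [-1 * f] is the reverse inequality for [f]. *)
Lemma real_mean_semigroup t s (f : state R -> R) v x : (0 <= t)%R -> (0 <= s)%R ->
  bounded_mfun f -> (0 <= x <= l)%R ->
  real_mean t (real_mean s f) (x, v) = real_mean (t + s) f (x, v).
Proof.
move=> t0 s0 bf xl; apply/eqP; rewrite eq_le real_mean_semigroup_le//=.
have bN := bounded_mfunZ (-1)%R bf.
have := real_mean_semigroup_le v t0 s0 bN xl.
rewrite real_meanZ// (_ : real_mean s _ = (fun y => -1 * real_mean s f y)%R); last first.
  by apply/funext => y; rewrite real_meanZ.
rewrite real_meanZ; last exact: bounded_real_mean.
by rewrite !mulN1r lerN2.
Qed.

Lemma bounded_mfun_velocity (F : velocity -> R) : bounded_mfun (fun y : state R => F y.2).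
Proof.
split; last first.
  exists (`|F Neg2| + `|F Zero| + `|F Pos2|)%R => -[x v] /=.
  by case: v; have := normr_ge0 (F Neg2); have := normr_ge0 (F Zero); have := normr_ge0 (F Pos2);
    lra.
by apply: measurable_slices => v /=; exact: measurable_cst.
Qed.

Lemma sum_layer_mass (G : velocity -> R) :
  (\sum_v layer_mass omega L v * G v = (2 + w * l) / 4 * (G Neg2 + 2 * G Zero + G Pos2))%R.
Proof. by rewrite big_velocity /layer_mass /=; field. Qed.

(** The centring condition places [F] in the span of the two modes, with amplitudes [a] and [b];
    adding [m] makes the function nonnegative. The faster mode is bounded by the slower
    exponential. *)
Let velocity_mean_le t (F : velocity -> R) z : (0 <= t)%R ->
  (F Neg2 + 2 * F Zero + F Pos2 = 0)%R ->
  (real_mean t (fun y => F y.2) z <=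
   (`|(F Pos2 - F Neg2) / 2| + `|F Zero|) * expR (- lam%:num * t))%R.
Proof.
move=> t0 F0; pose a := ((F Pos2 - F Neg2) / 2)%R; pose b := (- F Zero)%R.
pose m := (`|a| + `|b|)%R.
have FE v : F v = (velocity_mean lam m a b 0 v - m)%R.
  rewrite /velocity_mean !mulr0 expR0 !mulr1 /a /b.
  by move: F0; case: v => /= F0; lra.
have bF := bounded_mfun_velocity F.
have h := @semigroup_velocity_mean R _ (measurableTypeR R) lam (rtp_flow l) mflow m a b (lexx _)
  t z.2 z.1 t0.
have bm : bounded_mfun (fun y : state R => F y.2 + m)%R.
  by exact: bounded_mfunDr.
have gE : slice (EFin \o (fun y : state R => F y.2 + m)%R) =
    (fun u _ => (velocity_mean lam m a b 0 u)%:E).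
  by apply/funext => u; apply/funext => y; rewrite /slice/= FE subrK.
have k0 y : 0 <= (EFin \o (fun y : state R => F y.2 + m)%R) y.
  have na := ler_norm a; have na' := ler_norm (- a)%R; rewrite normrN in na'.
  have nb := ler_norm b; have nb' := ler_norm (- b)%R; rewrite normrN in nb'.
  case: y => y v /=; rewrite lee_fin FE subrK /velocity_mean !mulr0 expR0 !mulr1 /m.
  by case: v => /=; lra.
have mk : measurable_fun setT (EFin \o (fun y : state R => F y.2 + m)%R).
  by apply/measurable_EFinP; case: bm.
have {h} : rtp_mean t (EFin \o (fun y : state R => F y.2 + m)%R) z <=
    (velocity_mean lam m a b t z.2)%:E.
  by rewrite {1}(surjective_pairing z) rtp_meanE// gE; exact: h.
rewrite rtp_mean_real// real_meanDr// lee_fin => h.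
rewrite -(normrN (F Zero)) -/a -/b.
have e0 : (0 <= expR (- (2 * lam%:num) * t))%R by exact: expR_ge0.
have e12 : (expR (- (2 * lam%:num) * t) <= expR (- lam%:num * t))%R.
  by rewrite ler_expR !mulNr lerN2 ler_wpM2r// ler_peMl// ler1n.
have h1 : (a * expR (- lam%:num * t) * odd_mode z.2 <= `|a| * expR (- lam%:num * t))%R.
  rewrite -mulrA [(_ * odd_mode _)%R]mulrC mulrA ler_wpM2r ?expR_ge0//.
  rewrite (le_trans (ler_norm _))// normrM ler_piMr//.
  by case: (z.2) => /=; rewrite ?normrN ?normr1 ?normr0.
have h2 : (b * expR (- (2 * lam%:num) * t) * even_mode z.2 <= `|b| * expR (- lam%:num * t))%R.
  apply: (@le_trans _ _ (`|b| * expR (- (2 * lam%:num) * t))%R); last by rewrite ler_wpM2l.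
  rewrite -mulrA [(_ * even_mode _)%R]mulrC mulrA ler_wpM2r//.
  rewrite (le_trans (ler_norm _))// normrM ler_piMr//.
  by case: (z.2) => /=; rewrite ?normrN ?normr1.
rewrite mulrDl -(lerD2r m) (le_trans h)// /velocity_mean -addrA [leLHS]addrC lerD2r; exact: lerD.
Qed.

Lemma velocity_decay t (F : velocity -> R) z : (0 <= t)%R ->
  (F Neg2 + 2 * F Zero + F Pos2 = 0)%R ->
  (real_mean t (fun y => F y.2) z ^+ 2 <=
   (`|(F Pos2 - F Neg2) / 2| + `|F Zero|) ^+ 2 * expR (- (2 * lam%:num) * t))%R.
Proof.
move=> t0 F0; have up := velocity_mean_le z t0 F0.
have F0' : (- F Neg2 + 2 * - F Zero + - F Pos2 = 0)%R by rewrite -[RHS]oppr0 -F0; ring.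
have bF := bounded_mfun_velocity F.
have := velocity_mean_le z t0 (F := fun v => - F v)%R F0'.
rewrite (_ : (fun y => _) = (fun y => -1 * F y.2)%R); last by apply/funext => y; rewrite mulN1r.
rewrite real_meanZ// mulN1r (normrN (F Zero)).
rewrite (_ : (- F Pos2 - - F Neg2) / 2 = - ((F Pos2 - F Neg2) / 2))%R; last by field.
rewrite normrN => dn.
have e2 : expR (- (2 * lam%:num) * t) = (expR (- lam%:num * t) ^+ 2)%R.
  by rewrite -expRM_natl; congr expR; ring.
rewrite e2 -exprMn -(real_normK (num_real (real_mean _ _ _))) ler_pXn2r ?nnegrE//.
by rewrite ler_norml up andbT lerNl.
Qed.

Lemma bounded_decay t s (f : state R -> R) : (0 <= t)%R -> (0 <= s)%R ->
  bounded_mfun f -> mean mu f = 0%R ->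
  (mean mu (fun z => real_mean (t + s) f z ^+ 2) <=
   (8 * coupling_const s + 8 * expR (- (2 * lam%:num) * t)) * mean mu (fun z => f z ^+ 2))%R.
Proof.
move=> t0 s0 bf f0; have bf2 := bounded_mfun_sqr bf.
have ts0 : (0 <= t + s)%R by rewrite addr_ge0.
pose h : state R -> R := real_mean s f \o clip_state.
pose q : state R -> R := real_mean s (fun z => f z ^+ 2)%R \o clip_state.
have bh : bounded_mfun h := bounded_mfun_comp measurable_clip_state (bounded_real_mean s0 bf).
have bq : bounded_mfun q := bounded_mfun_comp measurable_clip_state (bounded_real_mean s0 bf2).
have slice_b (u : state R -> R) v : bounded_mfun u ->
    bounded_mfun (fun x : measurableTypeR R => u (x, v)).
  by move=> bu; exact: (bounded_mfun_comp (pair2_measurable v) bu).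
have lv v : layer v setT = (layer_mass omega L v)%:E by exact: layer_measureT.
have N0 v : (0 < layer_mass omega L v)%R by exact: layer_mass_gt0.
have D0 : (0 < 2 + w * l)%R by [].
have mean_clip (u : state R -> R) : bounded_mfun u -> mean mu (u \o clip_state) = mean mu u.
  move=> bu; rewrite !mean_layers//; last exact: bounded_mfun_comp measurable_clip_state bu.
  congr (_ * _)%R; apply: eq_bigr => v _.
  exact: (mean_layer_clip v (slice_b u v bu)).
have mq : mean mu q = mean mu (fun z => f z ^+ 2)%R.
  by rewrite mean_clip ?mean_invariant//; exact: bounded_real_mean.
have mh : mean mu h = 0%R by rewrite mean_clip ?mean_invariant//; exact: bounded_real_mean.
have hq z : (h z ^+ 2 <= q z)%R by exact: real_mean_sqr.
pose F v := ((layer_mass omega L v)^-1 * mean (layer v) (fun x => h (x, v)))%R.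
have bF := bounded_mfun_velocity F.
have NF v : (layer_mass omega L v * F v = mean (layer v) (fun x => h (x, v)))%R.
  by rewrite /F mulVKf// gt_eqF.
(* Invariance keeps [h] centred, and the layer masses stand in the ratio [1 : 2 : 1], so [F] has no
   constant mode. *)
have F0 : (F Neg2 + 2 * F Zero + F Pos2 = 0)%R.
  have : (\sum_v layer_mass omega L v * F v = 0)%R.
    rewrite (eq_bigr _ (fun v _ => NF v)); move: mh; rewrite mean_layers// => /eqP.
    by rewrite mulf_eq0 invr_eq0 gt_eqF//= => /eqP.
  rewrite sum_layer_mass => /eqP.
  by rewrite mulf_eq0 gt_eqF ?divr_gt0//= => /eqP.
have F2 v : (layer_mass omega L v * F v ^+ 2 <= mean (layer v) (fun x => q (x, v)))%R.
  have := mean_sqr_le (lv v) (slice_b h v bh); rewrite -NF exprMn => h1.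
  have h2 : (mean (layer v) (fun x => h (x, v) ^+ 2) <= mean (layer v) (fun x => q (x, v)))%R.
    by apply: (le_mean (lv v)) => [||x];
      [exact: bounded_mfun_sqr (slice_b h v bh)|exact: slice_b|exact: hq].
  apply: le_trans h2; rewrite -(ler_pM2l (N0 v)) mulrA -expr2; exact: h1.
have A2 : ((`|(F Pos2 - F Neg2) / 2| + `|F Zero|) ^+ 2 <= 4 * mean mu (fun z => f z ^+ 2))%R.
  have h1 : (\sum_v layer_mass omega L v * F v ^+ 2 <= (2 + w * l) * mean mu (fun z =>
    f z ^+ 2))%R.
    by rewrite -mq mean_layers// mulVKf ?gt_eqF//; apply: ler_sum => v _; exact: F2.
  have h2 : (F Neg2 ^+ 2 + 2 * F Zero ^+ 2 + F Pos2 ^+ 2 <= 4 * mean mu (fun z => f z ^+ 2))%R.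
    move: h1; rewrite sum_layer_mass -mulrA ler_pM2l//.
    by rewrite ler_pdivrMl.
  exact: le_trans (mode_norm_le _ _ _) h2.
(* Two states of one layer share their velocity, so [coupling_le] provides the pairwise bound that
   [variance_le] requires. *)
have variance : (mean mu (fun z =>
  (h z - F z.2) ^+ 2) <= 4 * coupling_const s * mean mu (fun z => f z ^+ 2))%R.
  rewrite -mq !mean_layers//; last by apply: bounded_mfun_sqr; exact: bounded_mfunB.
  rewrite mulrCA ler_wpM2l ?invr_ge0 ?(ltW D0)// mulr_sumr; apply: ler_sum => v _.
  have K0 : (0 <= 2 * coupling_const s)%R by rewrite mulr_ge0.
  have := variance_le (lv v) (N0 v) K0 (slice_b h v bh) (slice_b q v bq).
  rewrite -/(F v) (_ : 2 * (2 * coupling_const s) = 4 * coupling_const s)%R; last by ring.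
  by apply=> x y; apply: coupling_le => //; exact: clip_itv.
pose u z := ((real_mean (t + s) f z) ^+ 2)%R.
have bu : bounded_mfun u by apply: bounded_mfun_sqr; exact: bounded_real_mean.
pose g z := (h z - F z.2)%R.
have bg : bounded_mfun g by exact: bounded_mfunB.
have bg2 := bounded_mfun_sqr bg.
pose E : R := expR (- (2 * lam%:num) * t).
pose A : R := ((`|(F Pos2 - F Neg2) / 2| + `|F Zero|) ^+ 2)%R.
pose b := (fun z : state R => 2 * real_mean t (fun y => g y ^+ 2) z + 2 * (A * E))%R.
have bb : bounded_mfun b.
  by apply: bounded_mfunDr; apply: bounded_mfunZ; exact: bounded_real_mean.
have key z : (u (clip_state z) <= b (clip_state z))%R.
  rewrite /u; have zl : (0 <= clip l z.1 <= l)%R by exact: clip_itv.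
  (* The process visits only clipped positions, so [P_s f] and its clipped version [h] have the same
     mean at time [t]. *)
  have e1 : real_mean (t + s) f (clip_state z) = real_mean t h (clip_state z).
    by rewrite real_mean_clip; apply: esym; exact: (real_mean_semigroup z.2 t0 s0 bf zl).
  have e2 : real_mean t h (clip_state z) =
     (real_mean t g (clip_state z) + real_mean t (fun y => F y.2) (clip_state z))%R.
    rewrite -(real_meanD t (clip_state z) bg bF); congr (real_mean _ _ _).
    by apply/funext => y; rewrite /g subrK.
  rewrite e1 e2.
  have hv := velocity_decay (clip_state z) t0 F0; rewrite -/E -/A in hv.
  have hg := real_mean_sqr t (clip_state z) bg.
  exact: sqrD_le_double.
rewrite -/u -(mean_clip u bu); apply: le_trans (le_mean mu1 _ _ key) _.
- exact: bounded_mfun_comp measurable_clip_state bu.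
- exact: bounded_mfun_comp measurable_clip_state bb.
rewrite (mean_clip b bb) /b.
have br := bounded_mfunZ 2%R (bounded_real_mean t0 bg2).
rewrite (meanD mu1 br (bounded_mfun_cst _ _)) (meanZ mu1 2%R (bounded_real_mean t0 bg2)).
rewrite (mean_cst mu1) mulr1 mean_invariant//.
have E0 : (0 <= E)%R by exact: expR_ge0.
have AE : (A * E <= 4 * mean mu (fun z => f z ^+ 2) * E)%R by rewrite ler_wpM2r.
exact: combine_bounds variance AE.
Qed.

Definition rtp_expectation (t : R) (f : state R -> R) (z : state R) : \bar R :=
  \int[P z.2]_om (f (rtp_state z.1 t om))%:E.

(** If the mean of [(f - g) ^+ 2] is infinite, the bound is trivial. Otherwise Cauchy-Schwarz makes
    [f - g] integrable along the path, and the expectation splits into that of [g] and a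
    remainder. *)
Lemma expectation_sqr_le t (f g : state R -> R) z : measurable_fun setT f ->
  bounded_mfun g ->
  `|rtp_expectation t f z| * `|rtp_expectation t f z| <=
  2%:E * (real_mean t g z ^+ 2)%:E +
  2%:E * rtp_mean t (fun y => ((f y - g y) ^+ 2)%:E) z.
Proof.
move=> mf bg; have mZ := measurable_rtp_state z.1 t.
have mfZ : measurable_fun setT (fun om => f (rtp_state z.1 t om)) := measurableT_comp mf mZ.
have bgZ := bounded_path z t bg.
have mdZ : measurable_fun setT (fun om => f (rtp_state z.1 t om) - g (rtp_state z.1 t om))%R.
  by apply: measurable_funB => //; case: bgZ.
have [->|fin] := eqVneq (rtp_mean t (fun y => ((f y - g y) ^+ 2)%:E) z) +oo.
  by rewrite mulry gtr0_sg// mul1e addey ?leey.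
have r0 : 0 <= rtp_mean t (fun y => ((f y - g y) ^+ 2)%:E) z.
  by apply: integral_ge0 => om _; rewrite lee_fin sqr_ge0.
have rfin : rtp_mean t (fun y => ((f y - g y) ^+ 2)%:E) z \is a fin_num.
  by rewrite ge0_fin_numE// ltey.
rewrite -(fineK rfin); set r := fine _; have rp : (0 <= r)%R by exact: fine_ge0.
have dn : \int[P z.2]_om (`|f (rtp_state z.1 t om) - g (rtp_state z.1 t om)|)%:E <= (Num.sqrt (1
  * r))%:E.
  apply: integral_norm_le_sqrt => //; [exact: probability_le1|by rewrite /r fineK].
have iD : (P z.2).-integrable setT (EFin \o (fun om =>
  f (rtp_state z.1 t om) - g (rtp_state z.1 t om))%R).
  apply/integrableP; split; first exact/measurable_EFinP.
  by apply: le_lt_trans dn _; exact: ltry.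
have iG := bounded_mfun_integrable (mass1 z.2) bgZ.
have fE : rtp_expectation t f z = (real_mean t g z)%:E +
    \int[P z.2]_om ((f (rtp_state z.1 t om) - g (rtp_state z.1 t om))%R)%:E.
  rewrite /real_mean -(meanE (mass1 z.2) bgZ) -integralD_EFin//.
  by apply: eq_integral => om _ /=; rewrite -EFinD addrC subrK.
have dfin := integrable_fin_num measurableT iD.
have : `|\int[P z.2]_om ((f (rtp_state z.1 t om) - g (rtp_state z.1 t om))%R)%:E| <= (Num.sqrt (1
  * r))%:E.
  by apply: le_trans dn; apply: le_abse_integral => //; exact/measurable_EFinP.
rewrite fE -(fineK dfin); set b := fine _; set a := real_mean t g z.
rewrite -EFinD !abse_EFin mul1r -!EFinM -EFinD !lee_fin => br.
rewrite -expr2 real_normK ?num_real//; apply: sqrD_le_double => //.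
by rewrite -(real_normK (num_real b)) -(sqr_sqrtr rp) ler_pXn2r ?nnegrE ?sqrtr_ge0.
Qed.

Lemma measurable_rtp_expectation t (f : state R -> R) : (0 <= t)%R ->
  measurable_fun setT f -> measurable_fun setT (rtp_expectation t f).
Proof.
move=> t0 mf; pose k := EFin \o f.
have mk : measurable_fun setT k by exact/measurable_EFinP.
have -> : rtp_expectation t f = (fun z => rtp_mean t k^\+ z - rtp_mean t k^\- z).
  apply/funext => z; rewrite /rtp_expectation integralE.
  by congr (_ - _); apply: eq_integral => om _; rewrite ?funeposE ?funenegE.
by apply: emeasurable_funB; apply: measurable_rtp_mean => //;
  [exact: measurable_funepos|exact: measurable_funeneg].
Qed.

(** The squared velocity part decays with exponent [2 * lam], that is [4 * w]; merging is the slower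
    mechanism and fixes the final rate. *)
Let merge_rate_le : (merge_rate omega L <= 4 * w)%R.
Proof.
rewrite /merge_rate ler_pdivrMr ?mulr_gt0 ?ltr_pwDl ?sqr_ge0//.
have := sqr_ge0 (w * l); set y := ((w * l) ^+ 2)%R => y0.
have : (0 <= w * y)%R by rewrite mulr_ge0.
have := w0; lra.
Qed.

Theorem expectation_decay t (f : state R -> R) : (0 <= t)%R -> measurable_fun setT f ->
  \int[mu]_z (f z ^+ 2)%:E < +oo -> \int[mu]_z (f z)%:E = 0 ->
  \int[mu]_z (`|rtp_expectation t f z| * `|rtp_expectation t f z|) <=
  (32 * (merge_const omega L + 1) * expR (- merge_rate omega L * t / 2))%:E * \int[mu]_z (f z ^+
    2)%:E.
Proof.
move=> t0 mf f2 f0.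
have fin2 : \int[mu]_z (f z ^+ 2)%:E \is a fin_num.
  by rewrite ge0_fin_numE//; apply: integral_ge0 => z _; rewrite lee_fin sqr_ge0.
set B := fine (\int[mu]_z (f z ^+ 2)%:E).
have B0 : (0 <= B)%R by apply: fine_ge0; apply: integral_ge0 => z _; rewrite lee_fin sqr_ge0.
rewrite -(fineK fin2) -/B -EFinM.
pose E := expR (- merge_rate omega L * t / 2)%R.
(* Time is split evenly between merging and the velocity; both exponentials at [t / 2] are at most
   [E]. *)
pose k0 := (8 * (merge_const omega L + 1) * E)%R.
have E0 : (0 <= E)%R by exact: expR_ge0.
have k00 : (0 <= k0)%R by rewrite !mulr_ge0// addr_ge0// ltW// merge_const_gt0.
apply/lee_addgt0Pr => eps eps0.
(* The approximation by [g] costs [(4 * k0 + 2) * d'] in total: [4 * k0 * d'] from the norm of [g]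
   and [2 * d'] from the remainder. *)
pose d' := (eps / (4 * k0 + 2))%R.
have den : (0 < 4 * k0 + 2)%R by rewrite ltr_pwDr// mulr_ge0.
have d0 : (0 < d')%R by rewrite divr_gt0.
have [g [bg g0 fg]] := bounded_approximation mu1 d0 mf f2 f0.
have mfg : measurable_fun setT (fun y => f y - g y)%R by apply: measurable_funB => //; case: bg.
have mfg2 : measurable_fun setT (fun y => ((f y - g y) ^+ 2)%:E).
  by apply/measurable_EFinP; exact: measurable_funX.
have bg2 := bounded_mfun_sqr bg.
have t2 : (0 <= t / 2)%R by rewrite divr_ge0.
have br2 : bounded_mfun (fun z => real_mean t g z ^+ 2)%R.
  by apply: bounded_mfun_sqr; exact: bounded_real_mean.
have mr2 : measurable_fun setT (fun z => (real_mean t g z ^+ 2)%:E).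
  by apply/measurable_EFinP; case: br2.
have mm2 : measurable_fun setT (rtp_mean t (fun y => ((f y - g y) ^+ 2)%:E)).
  by apply: measurable_rtp_mean => // z; rewrite lee_fin sqr_ge0.
have mm0 z : 0 <= rtp_mean t (fun y => ((f y - g y) ^+ 2)%:E) z.
  by apply: integral_ge0 => om _; rewrite lee_fin sqr_ge0.
have mexp := measurable_rtp_expectation t0 mf.
have gB : (mean mu (fun z => g z ^+ 2) <= 2 * B + 2 * d')%R.
  rewrite -lee_fin -(meanE mu1 bg2).
  apply: (@le_trans _ _ (\int[mu]_z (2%:E * (f z ^+ 2)%:E + 2%:E * ((f z - g z) ^+ 2)%:E))).
    apply: ge0_le_integral => //.
    - by move=> z _; rewrite lee_fin sqr_ge0.
    - by apply/measurable_EFinP; case: bg2.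
    - apply: emeasurable_funD; apply: emeasurable_funM => //.
      by apply/measurable_EFinP; exact: measurable_funX.
    - move=> z _; rewrite -!EFinM -EFinD lee_fin.
      have -> : g z = (f z + - (f z - g z))%R by ring.
      apply: (sqrD_le_double (lexx _)); by rewrite sqrrN (_ : (f z + - (f z - g z)) = g z)%R//;
        ring.
  rewrite ge0_integralD//; last 4 first.
  - by move=> z _; rewrite mule_ge0// lee_fin sqr_ge0.
  - by apply: emeasurable_funM => //; apply/measurable_EFinP; exact: measurable_funX.
  - by move=> z _; rewrite mule_ge0// lee_fin sqr_ge0.
  - exact: emeasurable_funM.
  rewrite !ge0_integralZl//; last 3 first.
  - by move=> z _; rewrite lee_fin sqr_ge0.
  - by apply/measurable_EFinP; exact: measurable_funX.
  - by move=> z _; rewrite lee_fin sqr_ge0.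
  rewrite -(fineK fin2) -/B (EFinD (2 * B)%R) (EFinM 2%R B) (EFinM 2%R d').
  apply: leeD => //.
  by apply: lee_wpmul2l.
have decay : (mean mu (fun z => real_mean t g z ^+ 2) <= k0 * mean mu (fun z => g z ^+ 2))%R.
  have := bounded_decay t2 t2 bg g0.
  rewrite (_ : t / 2 + t / 2 = t)%R; last by field.
  move=> /le_trans; apply; rewrite ler_wpM2r//; first by apply: mean_ge0 => z; exact: sqr_ge0.
  have -> : k0 = (8 * (merge_const omega L * E) + 8 * E)%R by rewrite /k0; ring.
  rewrite /coupling_const.
  rewrite (_ : - merge_rate omega L * (t / 2) = - merge_rate omega L * t / 2)%R; last by ring.
  rewrite -/E lerD2l ler_wpM2l// ler_expR -/lam /=.
  have h : (0 <= (4 * w - merge_rate omega L) * t)%R by rewrite mulr_ge0// subr_ge0.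
  lra.
apply: (@le_trans _ _ (\int[mu]_z (2%:E * (real_mean t g z ^+ 2)%:E +
    2%:E * rtp_mean t (fun y => ((f y - g y) ^+ 2)%:E) z))).
  apply: ge0_le_integral => //.
  - by apply: emeasurable_funM; apply: measurableT_comp.
  - by apply: emeasurable_funD; exact: emeasurable_funM.
  - by move=> z _; exact: expectation_sqr_le.
rewrite ge0_integralD//; last 4 first.
- by move=> z _; rewrite mule_ge0// lee_fin sqr_ge0.
- exact: emeasurable_funM.
- by move=> z _; rewrite mule_ge0.
- exact: emeasurable_funM.
rewrite !ge0_integralZl//; last by move=> z _; rewrite lee_fin sqr_ge0.
rewrite (meanE mu1 br2).
have inv : \int[mu]_z rtp_mean t (fun y => ((f y - g y) ^+ 2)%:E) z <= d'%:E.
  apply: le_trans fg; apply: (invariant_le (G := fun y => (f y - g y) ^+ 2)%R t0).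
    exact: measurable_funX.
  by move=> z; exact: sqr_ge0.
apply: (@le_trans _ _ (2%:E * (k0 * (2 * B + 2 * d'))%:E + 2%:E * d'%:E)).
  apply: leeD; apply: lee_wpmul2l => //; rewrite lee_fin (le_trans decay)//.
  by rewrite ler_wpM2l.
rewrite -!EFinM -!EFinD lee_fin.
have -> : (32 * (merge_const omega L + 1) * expR (- merge_rate omega L * t / 2) * B = 4 * k0 *
  B)%R.
  by rewrite /k0 -/E; ring.
have -> : eps = ((4 * k0 + 2) * d')%R by rewrite /d' mulrCA mulfV ?mulr1// gt_eqF.
by apply: eq_leW; ring.
Qed.

End jamming_process.

(** * From mean squares to norms *)

Lemma poweR_sqr {R : realType} (x : \bar R) : (0 <= x -> x `^ 2 = x * x)%E.
Proof.
case: x => [r|_|//]; first by rewrite lee_fin => r0; rewrite poweR_EFin powR_mulrn// expr2 EFinM.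
by rewrite mulyy poweRyr.
Qed.

Lemma Lnorm2_le d (T : measurableType d) {R : realType} (m : {measure set T -> \bar R})
    (f g : T -> \bar R) (c : R) : 0 <= c ->
  (\int[m]_x (`|f x| * `|f x|) <= (c ^+ 2)%:E * \int[m]_x (`|g x| * `|g x|))%E ->
  ('N[m]_2%:E[f] <= c%:E * 'N[m]_2%:E[g])%E.
Proof.
move=> c0 fg; rewrite unlock.
have pow0 (h : T -> \bar R) : (0 <= \int[m]_x (`|h x| `^ 2))%E.
  by apply: integral_ge0 => x _; exact: poweR_ge0.
have powE (h : T -> \bar R) : (\int[m]_x (`|h x| `^ 2) = \int[m]_x (`|h x| * `|h x|))%E.
  by apply: eq_integral => x _; rewrite poweR_sqr.
have -> : (c%:E = (c ^+ 2)%:E `^ 2^-1)%E.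
  by rewrite poweR_EFin -powR_mulrn// -powRrM mulfV// powRr1.
rewrite -poweRM ?lee_fin ?sqr_ge0//; apply: gt0_ler_poweR => //.
- by rewrite in_itv/= leey andbT.
- by rewrite in_itv/= leey andbT mule_ge0 ?lee_fin ?sqr_ge0.
- by rewrite !powE.
Qed.

Theorem corollary20 (R : realType) :
  exists K : R, 0 < K /\
  forall omega L : {posnum R},
  exists C : R, 0 < C /\
  forall (d : measure_display) (Omega : measurableType d)
    (P : velocity -> probability Omega R)
    (T : nat -> Omega -> R) (V : nat -> Omega -> velocity),
    (forall v : velocity,
       is_jump_process (rtp_rate omega%:num) v (P v) T V) ->
  forall (t : R) (f : state R -> R),
    0 <= t ->
    f \in Lfun (rtp_invariant omega L) 2%:E ->
    (\int[rtp_invariant omega L]_z (f z)%:E = 0)%E ->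
    ('N[rtp_invariant omega L]_2%:E [rtp_semigroup L%:num P T V t f] <=
     (C * expR (- (K * omega%:num / (1 + (omega%:num * L%:num) ^+ 2)) * t))%:E
     * 'N[rtp_invariant omega L]_2%:E [EFin \o f])%E.
Proof.
(* [merge_rate] carries the factor [1 / 10]; halving the time and taking the square root each cost a
   further factor [2]. *)
exists (1 / 40); split; first by [].
move=> omega L; pose C : R := 32 * (merge_const omega L + 1).
have mc0 := merge_const_gt0 omega L.
have C1 : 1 <= C by rewrite /C; lra.
have C0 : 0 < C by exact: lt_le_trans C1.
exists C; split => // d Omega P T V jp t f t0 fL2 f0.
set mu := rtp_invariant omega L; pose r := merge_rate omega L.
have if2 := Lfun2_integrable_sqr fL2.
have mf : measurable_fun setT f by move: fL2; rewrite inE => /andP[]; rewrite inE.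
have f2 : (\int[mu]_z (f z ^+ 2)%:E < +oo)%E by exact: integrable_lty if2.
have semE : rtp_semigroup L%:num P T V t f = rtp_expectation L P T V t f.
  by apply/funext => z; rewrite /rtp_semigroup unlock.
have rE : 1 / 40 * omega%:num / (1 + (omega%:num * L%:num) ^+ 2) = r / 4.
  rewrite /r /merge_rate; have : 0 < 1 + (omega%:num * L%:num) ^+ 2 by rewrite ltr_pwDl// sqr_ge0.
  by move=> D0; field; rewrite gt_eqF.
rewrite semE rE; set c := C * expR _.
have c0 : 0 <= c by rewrite mulr_ge0 ?expR_ge0// ltW.
(* As [C >= 1], it is at most its own square, so the same constant serves after the square root. *)
have c2 : 32 * (merge_const omega L + 1) * expR (- r * t / 2) <= c ^+ 2.
  have -> : c ^+ 2 = C ^+ 2 * expR (- r * t / 2).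
    by rewrite /c exprMn -expRM_natl; congr (_ * expR _); field.
  by rewrite ler_wpM2r ?expR_ge0// -/C expr2 ler_peMl// ltW.
apply: Lnorm2_le => //.
apply: le_trans (expectation_decay jp t0 mf f2 f0) _.
have -> : (\int[mu]_z (f z ^+ 2)%:E = \int[mu]_z (`|(f z)%:E| * `|(f z)%:E|))%E.
  by apply: eq_integral => z _; rewrite abse_EFin -EFinM -expr2 real_normK ?num_real.
apply: lee_wpmul2r; last by rewrite lee_fin.
by apply: integral_ge0 => z _; rewrite mule_ge0.
Qed.
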